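(* Let $F:\mathbb{R}^{d_\theta}\times\mathbb{R}^{d_z}\to\mathbb{R}^{d_\theta}$ be measurable, let $\{\alpha_n\}_{n\ge0}$ be positive reals, let $\theta_0\in\mathbb{R}^{d_\theta}$ be an arbitrary vector, and let $$\theta_{n+1}=\theta_n-\alpha_nF(\theta_n,Z_{n+1}),\qquad n\ge0,$$ where $\{Z_n\}_{n\ge0}$ is an $\mathbb{R}^{d_z}$-valued process on a probability space $(\Omega,\mathcal F,P)$ such that, for a family of transition kernels $\{\Pi_\theta(\cdot,\cdot)\}_{\theta\in\mathbb{R}^{d_\theta}}$ on $\mathbb{R}^{d_z}$, $P(Z_{n+1}\in B\mid\theta_0,Z_0,\dots,\theta_n,Z_n)=\Pi_{\theta_n}(Z_n,B)$ w.p.1 for all $n\ge0$ and measurable $B\subseteq\mathbb{R}^{d_z}$. Suppose: (1) $\lim_{n\to\infty}\alpha_n=0$, $\limsup_{n\to\infty}|\alpha_{n+1}^{-1}-\alpha_n^{-1}|<\infty$, $\sum_{n=0}^\infty\alpha_n=\infty$, and there is a real number $r\in(1,\infty)$ such that $\sum_{n=0}^\infty\alpha_n^2\gamma_n^{2r}<\infty$. (2) There exist a differentiable function $f:\mathbb{R}^{d_\theta}\to\mathbb{R}$ with locally Lipschitz continuous gradient and a measurable function $\tilde F:\mathbb{R}^{d_\theta}\times\mathbb{R}^{d_z}\to\mathbb{R}^{d_\theta}$ such that $F(\theta,z)-\nabla f(\theta)=\tilde F(\theta,z)-(\Pi\tilde F)(\theta,z)$ for all $\theta\in\mathbb{R}^{d_\theta}$,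 $z\in\mathbb{R}^{d_z}$, where $(\Pi\tilde F)(\theta,z)=\int\tilde F(\theta,z')\Pi_\theta(z,dz')$. (3) For any compact $Q\subset\mathbb{R}^{d_\theta}$ and $s\in(0,1)$ there is a measurable function $\varphi_{Q,s}:\mathbb{R}^{d_z}\to[1,\infty)$ such that $$\max\{\|F(\theta,z)\|,\|\tilde F(\theta,z)\|,\|(\Pi\tilde F)(\theta,z)\|\}\le\varphi_{Q,s}(z),$$ $$\|(\Pi\tilde F)(\theta',z)-(\Pi\tilde F)(\theta'',z)\|\le\varphi_{Q,s}(z)\|\theta'-\theta''\|^s$$ for all $\theta,\theta',\theta''\in Q$, $z\in\mathbb{R}^{d_z}$, and $$\sup_{n\ge0}E\big(\varphi_{Q,s}^2(Z_n)I_{\{\tau_Q\ge n\}}\mid\theta_0=\theta,Z_0=z\big)<\infty$$ for all $\theta\in\mathbb{R}^{d_\theta}$, $z\in\mathbb{R}^{d_z}$, where $\tau_Q=\inf(\{n\ge0:\theta_n\notin Q\}\cup\{\infty\})$. (4) For any compact $Q\subset\mathbb{R}^{d_\theta}$ and any $a\in f(Q)$ there exist $\delta_{Q,a}\in(0,1]$, $\mu_{Q,a}\in(1,2]$, $M_{Q,a}\in[1,\infty)$ such that $|f(\theta)-a|\le M_{Q,a}\|\nabla f(\theta)\|^{\mu_{Q,a}}$ for all $\theta\in Q$ satisfying $|f(\theta)-a|\le\delta_{Q,a}$. Then, with $p=\min\{1,r\}$: (i) $\hat\theta=\lim_{n\to\infty}\theta_n$ exists and satisfies $\nabla f(\hat\theta)=0$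 w.p.1 on $\{\sup_{n\ge0}\|\theta_n\|<\infty\}$. (ii) $\|\nabla f(\theta_n)\|^2=o(\gamma_n^{-\hat p})$, $|f(\theta_n)-f(\hat\theta)|=o(\gamma_n^{-\hat p})$ and $\|\theta_n-\hat\theta\|=o(\gamma_n^{-\hat q})$ w.p.1 on $\{\sup_{n\ge0}\|\theta_n\|<\infty\}\cap\{\hat r>r\}$. (iii) $\|\nabla f(\theta_n)\|^2=O(\gamma_n^{-\hat p})$, $|f(\theta_n)-f(\hat\theta)|=O(\gamma_n^{-\hat p})$ and $\|\theta_n-\hat\theta\|=O(\gamma_n^{-\hat q})$ w.p.1 on $\{\sup_{n\ge0}\|\theta_n\|<\infty\}\cap\{\hat r\le r\}$. (iv) $\|\nabla f(\theta_n)\|^2=o(\gamma_n^{-p})$ and $|f(\theta_n)-f(\hat\theta)|=o(\gamma_n^{-p})$ w.p.1 on $\{\sup_{n\ge0}\|\theta_n\|<\infty\}$.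
   Context: $\|\cdot\|$ is the Euclidean norm; $I$ denotes an indicator. $\gamma_0=0$ and $\gamma_n=\sum_{i=0}^{n-1}\alpha_i$ for $n\ge1$. ''W.p.1 on an event $\Lambda$'' means for all $\omega\in\Lambda$ outside a null set; $o,O$ are pathwise as $n\to\infty$ (constants may be random). As a consequence of hypothesis (4), for each $\theta$ there exist (and are fixed once and for all) $\delta_\theta\in(0,1]$, $\mu_\theta\in(1,2]$, $M_\theta\in[1,\infty)$ such that $|f(\theta')-f(\theta)|\le M_\theta\|\nabla f(\theta')\|^{\mu_\theta}$ for all $\theta'$ with $\|\theta'-\theta\|\le\delta_\theta$. Put $r_\theta=1/(2-\mu_\theta)$ if $\mu_\theta<2$ and $r_\theta=\infty$ if $\mu_\theta=2$; $p_\theta=\mu_\theta\min\{r,r_\theta\}$; $q_\theta=\min\{r,r_\theta\}-1$. Then $\hat r=r_{\hat\theta}$, $\hat p=p_{\hat\theta}$, $\hat q=q_{\hat\theta}$. *)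

(* Defs.v *)
From HB Require Import structures.
From mathcomp Require Import all_boot all_order all_algebra.
From mathcomp Require Import all_classical all_reals all_analysis.
From mathcomp Require Import measurable_realfun.

Set Implicit Arguments.
Unset Strict Implicit.
Unset Printing Implicit Defensive.

Import Order.TTheory GRing.Theory Num.Theory.
Import numFieldNormedType.Exports.

Local Open Scope classical_set_scope.
Local Open Scope ring_scope.

(* R^n is ['rV[R]_n].  Its library norm [`|x|] is the sup norm: it is used here
   only through the topology (and the notions of compactness, differentiability
   and local Lipschitz continuity), which does not depend on the choice of a
   norm.  Quantitative bounds use the Euclidean norm [enorm] below. *)

(* Borel sigma-algebra. *)
Section borel_rV.
Context (R : realType) (n : nat).

Let borel := <<s @open 'rV[R]_n >>.

Let borel0 : borel set0.
Proof. exact: sigma_algebra0. Qed.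

Let borelC A : borel A -> borel (~` A).
Proof. exact: sigma_algebraC. Qed.

Let borel_bigcup (A : (set 'rV[R]_n)^nat) :
  (forall i, borel (A i)) -> borel (\bigcup_i A i).
Proof. exact: sigma_algebra_bigcup. Qed.

HB.instance Definition _ := @isMeasurable.Build (sigma_display (@open 'rV[R]_n))
  'rV[R]_n borel borel0 borelC borel_bigcup.

End borel_rV.

Definition enorm (R : realType) (n : nat) (x : 'rV[R]_n) : R :=
  Num.sqrt (\sum_(i < n) x 0 i ^+ 2).

Definition grad (R : realType) (n : nat) (f : 'rV[R]_n -> R) (x : 'rV[R]_n) :
  'rV[R]_n := \row_i 'D_(delta_mx 0 i) f x.

Definition gamma (R : realType) (alpha : nat -> R) (n : nat) : R :=
  \sum_(0 <= i < n) alpha i.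

(* (Pi G)(theta, z), the integral of a vector-valued function, taken
   coordinatewise. *)
Definition kernel_int (R : realType) (dt dz m : nat)
    (Pi : 'rV[R]_dt -> R.-pker 'rV[R]_dz ~> 'rV[R]_dz)
    (G : 'rV[R]_dt -> 'rV[R]_dz -> 'rV[R]_m)
    (theta : 'rV[R]_dt) (z : 'rV[R]_dz) : 'rV[R]_m :=
  \row_i \int[Pi theta z]_z' (G theta z' 0 i).

(* The library's [Rintegral] is total; this is existence of the integral
   above. *)
Definition kernel_integrable (R : realType) (dt dz m : nat)
    (Pi : 'rV[R]_dt -> R.-pker 'rV[R]_dz ~> 'rV[R]_dz)
    (G : 'rV[R]_dt -> 'rV[R]_dz -> 'rV[R]_m)
    (theta : 'rV[R]_dt) (z : 'rV[R]_dz) : Prop :=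
  forall i, (Pi theta z).-integrable [set: 'rV[R]_dz]
    (fun z' => (G theta z' 0 i)%:E).

(* A system of sets generating the sigma-algebra
   sigma(theta_0, Z_0, ..., theta_n, Z_n). *)
Definition history (T : Type) (R : realType) (dt dz : nat)
    (theta : nat -> T -> 'rV[R]_dt) (Z : nat -> T -> 'rV[R]_dz) (n : nat) :
    set (set T) :=
  \bigcup_(k in [set k | (k <= n)%N])
    preimage_set_system [set: T] (fun w => (theta k w, Z k w)) measurable.

(* [Y] is a version of E(X | <<s G >>), for a nonnegative [X] (which need not
   be integrable) and a system [G] of events.  With [X := \1_E] this is the
   conditional probability of the event [E]. *)
Definition is_cond_expectation (d : measure_display) (T : measurableType d)
    (R : realType) (P : probability T R) (G : set (set T))
    (X Y : T -> \bar R) : Prop :=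
  [/\ measurable_fun [set: g_sigma_algebraType G]
        (Y : g_sigma_algebraType G -> \bar R),
      (forall w, (0 <= Y w)%E)
    & forall A, <<s G >> A -> (\int[P]_(w in A) Y w = \int[P]_(w in A) X w)%E].

(* The exit time inf ({n | theta_n \notin Q} \cup {oo}), along one path. *)
Definition exit_time (R : realType) (dt : nat) (Q : set 'rV[R]_dt)
    (theta : nat -> 'rV[R]_dt) : \bar R :=
  ereal_inf ([set (n%:R)%:E | n in [set n | ~ Q (theta n)]] `|` [set +oo%E]).

(* r_theta, p_theta and q_theta as functions of r and of the exponent
   mu = mu_theta in (1, 2].  [fine] is harmless as the minimum is finite. *)
Definition loj_r (R : realType) (mu : R) : \bar R :=
  if mu < 2 then ((2 - mu)^-1)%:E else +oo%E.

Definition loj_p (R : realType) (r mu : R) : R :=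
  mu * fine (Order.min r%:E (loj_r mu)).

Definition loj_q (R : realType) (r mu : R) : R :=
  fine (Order.min r%:E (loj_r mu)) - 1.

Definition bounded_path (R : realType) (dt : nat)
    (theta : nat -> 'rV[R]_dt) : Prop :=
  (ereal_sup (range (fun n => (enorm (theta n))%:E)) < +oo)%E.

(* Main.v *)
Require Import Defs.
From HB Require Import structures.
From mathcomp Require Import all_boot all_order all_algebra.
From mathcomp Require Import all_classical all_reals all_analysis.
From mathcomp Require Import measurable_realfun.
From mathcomp Require Import ring lra.
Import Order.TTheory GRing.Theory Num.Theory.
Import numFieldNormedType.Exports.
Local Open Scope classical_set_scope.
Local Open Scope ring_scope.

(** The recursion is a gradient descent with noise
    [xi k = F (theta k) (Z k.+1) - grad f (theta k)], and the theorem holds because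
    this noise, on almost every bounded path, sums up to a series whose tails
    are [o(gamma ^ (- r))]; the rest is a deterministic statement about one path.

    Probability.  It suffices that the series of [gamma ^ r * alpha * xi]
    converges almost surely on the paths that stay in a given box
    ([noise_sum_cvg]).  The Poisson equation writes [xi k] as a martingale
    increment plus a difference of the Poisson correction at [Z k] and at
    [Z k.+1].  The martingale part converges by Kolmogorov's maximal inequality
    ([martingale_cvg]), its variances being controlled by the moment bounds and
    the convergent series of [alpha ^ 2 * gamma ^ (2 r)]; that the increments are
    orthogonal to the past follows by integrating out the next noise variable
    against the kernel ([integrate_out]), where the exceptional null sets of the
    conditional probabilities have to be merged.  The correction part converges
    by summation by parts ([abel_cvgn]), because the weights vary slowly and the
    correction depends on the parameter in a Hoelder-continuous way.

    From noise to a clean descent.  Subtracting from [theta] the tail of its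
    noise gives a path [y] with [y n.+1 = y n - alpha n * grad f (theta n)] and
    [theta n - y n = o(gamma n ^ (- r))] ([noise_free_path]).  By polarization, [f]
    decreases along [y] by a multiple of [alpha * |grad f (y)| ^ 2], up to an error
    [e ^ 2] with [e] a small multiple of [gamma ^ (- r)] ([descent_step]).  Hence
    [f (y n)] converges, and the Lojasiewicz inequality holds at its limit [a].

    The Lojasiewicz inequality.  With [v = f (y) - a], one has
    [|v| <= M * |grad f (y)| ^ mu].  A small lift [V] of [v] is positive
    ([value_ge]), and the power [V ^ (1 - 1/mu)] decreases at each step by at
    least a multiple of the length of the step, up to the noise
    ([step_le_decrement]).  So [y] has finite length, and [theta] converges to the
    same limit, a critical point ([path_cvg], [grad_limit0]).  For the rate, [V]
    satisfies a discrete version of [V' <= - c * V ^ (2/mu)] as long as it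
    dominates the noise, which gives [V = O(gamma ^ (- mu * m))] where [m] is the
    smaller of [r] and of the exponent [1 / (2 - mu)] of that equation
    ([lifted_rate]).  The gradient is bounded by [V] because it cannot change much
    over a fixed time interval ([gradient_le]), and the distance to the limit by
    the remaining length.  The constants in these bounds can be taken arbitrarily
    small when the noise is the limiting factor, [m = r < 1 / (2 - mu)]:
    this is the difference between [o] and [O] ([path_rate], [path_conclusion]). *)

Set Implicit Arguments.
Unset Strict Implicit.
Unset Printing Implicit Defensive.

(** * Tangent-line inequalities for real powers *)

Section powR_inequalities.
Context {R : realType}.
Implicit Types x y k p z : R.

(** Bernoulli's inequality for an exponent in [0, 1]: Young's inequality with
    one of the two factors equal to 1. *)
Lemma powR_le_tangent1 k x : 0 <= k <= 1 -> 0 <= x -> x `^ k <= 1 + k * (x - 1).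
Proof.
move=> /andP[k0 k1] x0.
have [->|kn0] := eqVneq k 0; first by rewrite powRr0 mul0r addr0.
have [->|kn1] := eqVneq k 1; first by rewrite powRr1 // mul1r addrC subrK.
have kp : 0 < k by rewrite lt_neqAle eq_sym kn0.
have kl : 0 < 1 - k by rewrite subr_gt0 lt_neqAle kn1.
have H := @conjugate_powR R (x `^ k) 1 k^-1 (1 - k)^-1 (powR_ge0 _ _) ler01.
have {H} := H _ _ _; rewrite !invr_gt0 !invrK mulr1 => /(_ kp kl).
rewrite -powRrM mulfV // powRr1 // powR1 mul1r => H.
by apply: le_trans (H _) _; [rewrite addrC subrK|lra].
Qed.

(** The previous inequality with exponent [p^-1], applied to the tangent line
    itself where that line is nonnegative. *)
Lemma powR_ge_tangent1 p x : 1 <= p -> 0 <= x -> 1 + p * (x - 1) <= x `^ p.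
Proof.
move=> p1 x0; have p0 : 0 < p := lt_le_trans ltr01 p1.
have [neg|pos] := ltP (1 + p * (x - 1)) 0.
  by rewrite (le_trans (ltW neg)) // powR_ge0.
have ip : 0 <= p^-1 <= 1 by rewrite invr_ge0 ltW //= invf_le1.
have := powR_le_tangent1 ip pos.
have -> : 1 + p^-1 * (1 + p * (x - 1) - 1) = x by field; rewrite gt_eqF.
move=> H.
have := ge0_ler_powR (ltW p0) (powR_ge0 _ _) x0 H.
by rewrite -powRrM mulVf ?gt_eqF // powRr1.
Qed.

Lemma powRN_ge_tangent1 z x : 0 <= z -> 0 < x -> 1 - z * (x - 1) <= x `^ (- z).
Proof.
move=> z0 x0; rewrite /powR gt_eqF //; apply: le_trans (expR_ge1Dx _).
rewrite lerD2l mulNr lerN2 ler_wpM2l //.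
by have := @le_ln1Dx R (x - 1); rewrite [1 + _]addrC subrK; apply; lra.
Qed.

Lemma powR_div k x y : 0 <= x -> 0 < y -> (x / y) `^ k = x `^ k / y `^ k.
Proof.
move=> x0 y0; rewrite powRM // ?invr_ge0 ?(ltW y0) // -powR_inv1 ?(ltW y0) //.
by rewrite powRAC powR_inv1 // powR_ge0.
Qed.

(** Concavity of a power with exponent in [0, 1]. *)
Lemma powR_le_tangent k x y : 0 <= k <= 1 -> 0 < x -> 0 <= y ->
  y `^ k <= x `^ k + k * x `^ (k - 1) * (y - x).
Proof.
move=> k01 x0 y0.
have := powR_le_tangent1 k01 (divr_ge0 y0 (ltW x0)).
rewrite powR_div // ler_pdivrMr ?powR_gt0 // => H; apply: le_trans H _.
have -> : x `^ (k - 1) = x `^ k / x.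
  by rewrite powRB ?(gt_eqF x0) ?implybT // powRr1 // ltW.
rewrite le_eqVlt; apply/orP; left; apply/eqP; field.
by rewrite gt_eqF.
Qed.

(** Convexity of a power with negative exponent; [g0] and [g1] are two
    successive times, and summing this bound compares a series with an
    integral. *)
Lemma powR_telescope_ge r (g0 g1 : R) : 1 < r -> 0 < g0 -> 0 < g1 ->
  (r - 1) * (g1 - g0) * g1 `^ (- r) <= g0 `^ (1 - r) - g1 `^ (1 - r).
Proof.
move=> r1 g00 g10.
have := powR_ge_tangent1 (ltW r1) (divr_ge0 (ltW g10) (ltW g00)).
rewrite powR_div ?(ltW g10) // => H.
have E g : 0 < g -> g `^ (1 - r) = g / g `^ r.
  by move=> gp; rewrite powRB ?(gt_eqF gp) ?implybT // powRr1 // ltW.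
rewrite !E // powRN.
have a0 := powR_gt0 r g00; have b0 := powR_gt0 r g10.
set a := g0 `^ r in H a0 *; set b := g1 `^ r in H b0 *.
rewrite ler_pdivrMr //.
have -> : (g0 / a - g1 / b) * b = b / a * g0 - g1.
  by field; rewrite !gt_eqF.
have : (1 + r * (g1 / g0 - 1)) * g0 <= b / a * g0 by rewrite ler_wpM2r // ltW.
have -> : (1 + r * (g1 / g0 - 1)) * g0 = g0 + r * (g1 - g0).
  by field; rewrite gt_eqF.
by lra.
Qed.

Lemma powRN_le r x y : 0 <= r -> 0 < x -> x <= y -> y `^ (- r) <= x `^ (- r).
Proof.
move=> r0 x0 xy; have y0 := lt_le_trans x0 xy.
rewrite !powRN lef_pV2 ?posrE ?powR_gt0 //.
by apply: ge0_ler_powR => //; rewrite nnegrE ltW.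
Qed.

Lemma powR_mono r x y : 0 <= r -> 0 <= x -> x <= y -> x `^ r <= y `^ r.
Proof.
move=> r0 x0 xy; apply: ge0_ler_powR => //; rewrite nnegrE //.
exact: le_trans xy.
Qed.

Lemma powR_inv_le p x y : 0 < p -> 0 <= x -> 0 <= y -> x `^ p <= y `^ p -> x <= y.
Proof.
move=> p0 x0 y0; rewrite leNgt => h; rewrite leNgt; apply/negP => yx.
by move/negP: h; apply; apply: gt0_ltr_powR; rewrite ?nnegrE.
Qed.

Lemma powRK p x : 0 < p -> 0 <= x -> (x `^ p) `^ p^-1 = x.
Proof. by move=> p0 x0; rewrite -powRrM mulfV ?gt_eqF // powRr1. Qed.

End powR_inequalities.

(* Unification must never unfold a real power into exponentials. *)
#[local] Opaque powR expR ln.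

(** * Sums along the time scale of the step sizes *)

Section time_scale.
Context {R : realType} (al ga : nat -> R).
Hypothesis al_gt0 : forall n, 0 < al n.
Hypothesis gaS : forall n, ga n.+1 = ga n + al n.

Lemma time_le n m : (n <= m)%N -> ga n <= ga m.
Proof.
move=> nm; rewrite -(subnKC nm); elim: (m - n)%N => [|k IH]; first by rewrite addn0.
by rewrite addnS gaS (le_trans IH) // lerDl ltW.
Qed.

Lemma sum_steps n m : (n <= m)%N -> \sum_(n <= k < m) al k = ga m - ga n.
Proof.
move=> nm; rewrite -(telescope_sumr _ nm); apply: eq_big_nat => k _.
by rewrite gaS addrAC subrr add0r.
Qed.

(** Comparison with the integral of [t `^ (- r)].  A step is at most the elapsed
    time, so that successive times differ by a factor at most 2: hence [2 `^ r]. *)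
Lemma sum_steps_powRN r n m : 1 < r -> 0 < ga n ->
  (forall k, (n <= k)%N -> al k <= ga k) -> (n <= m)%N ->
  \sum_(n <= k < m) al k * ga k `^ (- r) <= 2 `^ r / (r - 1) * ga n `^ (1 - r).
Proof.
move=> r1 gan algan nm.
have r0 : 0 <= r by lra.
have gap k : (n <= k)%N -> 0 < ga k.
  by move=> nk; apply: lt_le_trans gan _; exact: time_le.
have C0 : 0 <= 2 `^ r / (r - 1) by rewrite divr_ge0 ?powR_ge0 //; lra.
apply: (@le_trans _ _ (\sum_(n <= k < m)
    2 `^ r / (r - 1) * (ga k `^ (1 - r) - ga k.+1 `^ (1 - r)))).
  apply: ler_sum_nat => k /andP[nk _].
  have h := powR_telescope_ge r1 (gap _ nk) (gap _ (leqW nk)).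
  have -> : al k * ga k `^ (- r)
      = 2 `^ r / (r - 1) * ((r - 1) * al k * (2 `^ (- r) * ga k `^ (- r))).
    have p2 : 2 `^ r != 0 :> R by rewrite gt_eqF ?powR_gt0.
    have pg : ga k `^ r != 0 by rewrite gt_eqF ?powR_gt0 ?gap.
    by rewrite !powRN; field; rewrite p2 pg subr_eq0 gt_eqF.
  apply: ler_wpM2l => //; apply: le_trans h.
  have -> : ga k.+1 - ga k = al k by rewrite gaS; lra.
  rewrite ler_wpM2l ?mulr_ge0 ?(ltW (al_gt0 _)) //; first lra.
  rewrite -powRM // ?(ltW (gap _ nk)) //; apply: powRN_le => //.
    exact: gap (leqW nk).
  by rewrite gaS mulr_natl mulr2n lerD2l algan.
rewrite -mulr_sumr ler_wpM2l //.
rewrite (eq_bigr (fun k => - (ga k.+1 `^ (1 - r) - ga k `^ (1 - r)))); last first.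
  by move=> k _; rewrite opprB.
by rewrite sumrN telescope_sumr // opprB lerBlDr lerDl powR_ge0.
Qed.

End time_scale.

(** * Perturbed descent under a gradient inequality *)

(** A real sequence [v] tends to 0 and decreases by a multiple of [g ^+ 2] at each
    step, up to an error [e] that is negligible on the time scale [ga]; in turn
    [g] controls [v] through a power [mu].  This is what remains of a descent
    path once [v] is the distance of the value to its limit and [g] is the norm
    of the gradient. *)
Section perturbed_descent.
Context {R : realType} (al ga v g e V : nat -> R) (r mu M ep : R).
Hypothesis al_gt0 : forall n, 0 < al n.
Hypothesis gaS : forall n, ga n.+1 = ga n + al n.
Hypothesis ga_ge1 : forall n, 1 <= ga n.
Hypothesis al_le1 : forall n, al n <= 1.
Hypothesis r_gt1 : 1 < r.
Hypothesis mu_gt1 : 1 < mu.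
Hypothesis mu_le2 : mu <= 2.
Hypothesis M_ge1 : 1 <= M.
Hypothesis ep_gt0 : 0 < ep.
Hypothesis g_ge0 : forall n, 0 <= g n.
Hypothesis v_cvg0 : v n @[n --> \oo] --> (0 : R).

Hypothesis eE : forall n, e n = ep * ga n `^ (- r).
Hypothesis v_descent :
  forall n, v n.+1 <= v n - al n / 2 * (g n ^+ 2 - e n ^+ 2).
Hypothesis v_loj : forall n, `|v n| <= M * g n `^ mu.

(** The lift by twice the lower bound of [v] found below makes the value
    positive, so that its real powers can be used, and keeps the descent
    inequality because the lift is nonincreasing. *)
Hypothesis VE : forall n, V n = v n + 2 * (M * e n `^ mu).

Local Notation s n := (M * e n `^ mu).
Local Notation k := (1 - mu^-1).
Local Notation C1 := (2 * (3 * M) `^ mu^-1 / k).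

Let ga_gt0 n : 0 < ga n. Proof. exact: lt_le_trans (ga_ge1 n). Qed.
Let e_gt0 n : 0 < e n. Proof. by rewrite eE mulr_gt0 // powR_gt0. Qed.
Let s_gt0 n : 0 < s n.
Proof. by rewrite mulr_gt0 ?powR_gt0 // (lt_le_trans ltr01). Qed.
Let r_ge0 : 0 <= r. Proof. exact: ltW (lt_trans ltr01 r_gt1). Qed.
Let mu_gt0 : 0 < mu. Proof. exact: lt_trans mu_gt1. Qed.
Let M_gt0 : 0 < M. Proof. exact: lt_le_trans M_ge1. Qed.

Let e_noninc n m : (n <= m)%N -> e m <= e n.
Proof.
move=> nm; rewrite !eE ler_wpM2l ?(ltW ep_gt0) //.
by apply: powRN_le => //; exact: time_le.
Qed.

Let s_noninc n m : (n <= m)%N -> s m <= s n.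
Proof.
move=> nm; rewrite ler_wpM2l ?(ltW M_gt0) //.
by apply: powR_mono; rewrite ?(ltW mu_gt0) ?(ltW (e_gt0 _)) ?e_noninc.
Qed.

(** If [v] fell below this bound, the gradient inequality would keep the gradient
    above the noise at all later times; [v] would go on decreasing and could not
    tend to 0. *)
Lemma value_ge n : - s n <= v n.
Proof.
rewrite leNgt; apply/negP => vs.
have vk j : v (n + j)%N <= v n.
  elim: j => [|j IH]; first by rewrite addn0.
  rewrite addnS (le_trans (v_descent _)) // (le_trans _ IH) // gerBl.
  rewrite mulr_ge0 ?divr_ge0 ?(ltW (al_gt0 _)) // subr_ge0.
  rewrite lerXn2r ?nnegrE ?(ltW (e_gt0 _)) //.
  apply: (powR_inv_le mu_gt0); rewrite ?(ltW (e_gt0 _)) //.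
  rewrite -(ler_pM2l M_gt0) (le_trans _ (v_loj _)) //.
  have skn := s_noninc (leq_addr j n); have sn0 := s_gt0 n.
  rewrite ler0_norm; first by lra.
  by lra.
have vn0 : v n < 0 by have := s_gt0 n; lra.
have [N _ /(_ (n + N)%N) H] := cvgr_gt 0 v_cvg0 _ vn0.
by have /= := H (leq_addl _ _); rewrite ltNge vk.
Qed.

Lemma lifted_ge n : s n <= V n.
Proof. by rewrite VE; have := value_ge n; lra. Qed.

Lemma lifted_gt0 n : 0 < V n.
Proof. exact: lt_le_trans (lifted_ge n). Qed.

Lemma lifted_descent n : V n.+1 <= V n - al n / 2 * (g n ^+ 2 - e n ^+ 2).
Proof.
rewrite !VE; have := v_descent n.
by have := s_noninc (leqnSn n); lra.
Qed.

Lemma lifted_le n : V n <= M * g n `^ mu + 2 * s n.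
Proof.
rewrite VE lerD2r.
exact: le_trans (ler_norm _) (v_loj n).
Qed.

Let mui : 2^-1 <= mu^-1 < 1.
Proof. by rewrite lef_pV2 ?posrE // mu_le2 invf_lt1. Qed.

Let k_gt0 : 0 < k. Proof. by have := mui; lra. Qed.

(** The classical length estimate: the decrement of the concave power [V `^ k] is
    at least its derivative times the decrement of [V], and the gradient
    inequality turns that derivative into the inverse of [g].  This needs the
    gradient to dominate the noise; otherwise the last term pays for the step. *)
Lemma step_le_decrement n :
  al n * g n <= C1 * (V n `^ k - V n.+1 `^ k) + 4 * (al n * e n).
Proof.
have k01 : 0 <= k <= 1 by have := mui; lra.
have Vn := lifted_gt0 n.
have := powR_le_tangent k01 Vn (ltW (lifted_gt0 n.+1)).
have -> : k - 1 = - mu^-1 by lra.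
rewrite powRN; set u := V n `^ mu^-1; set T := (3 * M) `^ mu^-1.
have u0 : 0 < u by rewrite powR_gt0.
have T0 : 0 < T by rewrite powR_gt0 // mulr_gt0.
have gn := g_ge0 n; have en := e_gt0 n; have an := al_gt0 n.
have HVd := lifted_descent n => tang.
have dec : k / u * (al n / 2 * (g n ^+ 2 - e n ^+ 2)) <= V n `^ k - V n.+1 `^ k.
  have : k / u * (al n / 2 * (g n ^+ 2 - e n ^+ 2)) <= k / u * (V n - V n.+1).
    by rewrite ler_wpM2l ?divr_ge0 ?(ltW k_gt0) ?(ltW u0) //; lra.
  by lra.
rewrite -/T.
suff key : g n <= T / u * (g n ^+ 2 - e n ^+ 2) + 4 * e n.
  apply: (@le_trans _ _ (C1 * (k / u * (al n / 2 * (g n ^+ 2 - e n ^+ 2)))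
      + 4 * (al n * e n))); last first.
    by rewrite lerD2r ler_wpM2l // -/T !(mulr_ge0, invr_ge0) // ltW.
  have -> : C1 * (k / u * (al n / 2 * (g n ^+ 2 - e n ^+ 2)))
      = al n * (T / u * (g n ^+ 2 - e n ^+ 2)).
    have kn0 : k != 0 by rewrite gt_eqF ?k_gt0.
    rewrite -/T; move: k kn0 => x xn0.
    by field; rewrite xn0 gt_eqF.
  by rewrite [4 * _]mulrCA -mulrDr ler_wpM2l // ltW.
(* Either the gradient dominates the noise, or the step itself is small. *)
have [eg|ge] := leP (e n) (g n).
  have gp : 0 < g n := lt_le_trans en eg.
  have uT : u <= T * g n.
    rewrite -[g n in leRHS](@powRK _ mu) // /T -powRM ?powR_ge0 //; last first.
      by rewrite mulr_ge0 // ltW.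
    apply: powR_mono; first (by have := mui; lra); first exact: ltW.
    apply: le_trans (lifted_le n) _.
    have : s n <= M * g n `^ mu.
      rewrite ler_wpM2l ?(ltW M_gt0) //.
      by apply: powR_mono; rewrite ?(ltW mu_gt0) ?(ltW en).
    by rewrite -mulrA; lra.
  have Tu : (g n)^-1 <= T / u.
    by rewrite ler_pdivlMr // ler_pdivrMl // mulrC.
  have d0 : 0 <= g n ^+ 2 - e n ^+ 2 by rewrite subr_ge0 lerXn2r ?nnegrE // ltW.
  apply: (@le_trans _ _ ((g n)^-1 * (g n ^+ 2 - e n ^+ 2) + e n)); last first.
    by apply: lerD; [exact: ler_wpM2r|lra].
  have -> : (g n)^-1 * (g n ^+ 2 - e n ^+ 2) = g n - e n * (e n / g n).
    by field; rewrite gt_eqF.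
  have : e n * (e n / g n) <= e n * 1.
    by rewrite ler_wpM2l ?(ltW en) // ler_pdivrMr // mul1r.
  by lra.
have Tu : T * e n <= 3 * u.
  rewrite /T powRM ?(ltW M_gt0) // -mulrA; apply: ler_pM.
  - exact: powR_ge0.
  - by rewrite mulr_ge0 ?powR_ge0 // ltW.
  - by apply: ler1_powR => //; have := mui; lra.
  rewrite -[e n in leLHS](@powRK _ mu) ?(ltW en) // -powRM ?powR_ge0 ?(ltW M_gt0) //.
  apply: powR_mono; [by have := mui; lra| |exact: lifted_ge].
  exact: ltW.
have h0 : T / u * e n <= 3 by rewrite mulrAC ler_pdivrMr.
have : 0 <= T / u * g n ^+ 2 by rewrite mulr_ge0 ?sqr_ge0 ?divr_ge0 // ltW.
set q := T / u in h0 *; move=> h1.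
have h2 : q * e n * e n <= 3 * e n by rewrite ler_wpM2r // ltW.
by rewrite mulrBr [e n ^+ 2]expr2 mulrA; lra.
Qed.

Lemma sum_gradient_le n m : (n <= m)%N ->
  \sum_(n <= i < m) al i * g i <=
  2 * (3 * M) `^ mu^-1 / (1 - mu^-1) * V n `^ (1 - mu^-1)
  + 4 * ep * (2 `^ r / (r - 1)) * ga n `^ (1 - r).
Proof.
move=> nm.
apply: (@le_trans _ _ (\sum_(n <= i < m)
   (- (C1 * (V i.+1 `^ k - V i `^ k)) + 4 * ep * (al i * ga i `^ (- r))))).
  apply: ler_sum_nat => i _; apply: le_trans (step_le_decrement i) _.
  by rewrite eE; lra.
rewrite big_split /= sumrN -!mulr_sumr telescope_sumr //.
apply: lerD.
  rewrite -mulrN opprB ler_wpM2l //; last by rewrite gerBl powR_ge0.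
  by rewrite !(mulr_ge0, invr_ge0, powR_ge0) // ltW.
rewrite -[leRHS]mulrA ler_wpM2l //; first by rewrite mulr_ge0 // ltW.
apply: sum_steps_powRN => // i _; exact: le_trans (al_le1 _) (ga_ge1 _).
Qed.

Hypothesis ga_unbounded : forall A, exists n, A < ga n.

Section rate.
Variables K m : R.
Hypothesis K_gt0 : 0 < K.
Hypothesis m_ge1 : 1 <= m.
Hypothesis m_le_r : m <= r.
Hypothesis ep_le1 : ep <= 1.
Hypothesis ep_small : 4 * M * (2 * ep) `^ mu <= K.
(** In applications [m] is the smaller of the two rates, that of the noise and that
    allowed by the gradient inequality.  The exponent of [ga] below is positive
    when the noise is the limiting factor, and then every [K] is eventually
    admissible; it vanishes otherwise, and [K] has to be large. *)
Hypothesis gain_large : forall n,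
  mu * m + 1 <= (2 * M) `^ (- (2 / mu)) / 4 * K `^ (2 / mu - 1)
                * ga n `^ (1 - m * (2 - mu)).

Local Notation z := (mu * m + 1).
Local Notation T n := (ga n `^ (- (mu * m))).

Let mum_ge0 : 0 <= mu * m.
Proof. by rewrite mulr_ge0 ?(ltW mu_gt0) // (le_trans ler01). Qed.
Let z_ge0 : 0 <= z. Proof. by rewrite addr_ge0. Qed.

Let s_le n : M * (2 * e n) `^ mu <= K * T n / 4.
Proof.
rewrite eE mulrA powRM ?powR_ge0 //; last by rewrite mulr_ge0 // ltW.
rewrite -powRrM mulNr.
have h : ga n `^ (- (r * mu)) <= T n.
  by apply: ler_powR => //; rewrite lerN2 [r * mu]mulrC ler_wpM2l // ltW.
have h2 : M * (2 * ep) `^ mu <= K / 4 by have := ep_small; lra.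
rewrite mulrA [K * _ / 4]mulrAC; apply: ler_pM => //; last exact: powR_ge0.
by rewrite mulr_ge0 ?powR_ge0 // ltW.
Qed.

(** While the value lies above the target, the gradient term wins over the
    noise, and the value decreases faster than a higher power of time. *)
Lemma fast_decrease n : K * T n <= V n ->
  V n.+1 * ga n.+1 `^ z <= V n * ga n `^ z.
Proof.
move=> KV; have Vn := lifted_gt0 n; have gan := ga_gt0 n.
have gan1 := ga_gt0 n.+1; have an := al_gt0 n.
have en := e_gt0 n; have gn := g_ge0 n.
have sn := s_le n.
have s2 : M * e n `^ mu <= M * (2 * e n) `^ mu.
  rewrite ler_wpM2l ?(ltW M_gt0) //.
  by apply: powR_mono; [exact: ltW|exact: ltW|lra].
have Vg := lifted_le n.
have Vg2 : V n / (2 * M) <= g n `^ mu.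
  rewrite ler_pdivrMr ?mulr_gt0 //; lra.
have g2e : 2 * e n <= g n.
  apply: (powR_inv_le mu_gt0) => //; first by rewrite mulr_ge0 // ltW.
  rewrite -(ler_pM2l M_gt0).
  have : M * (V n / (2 * M)) <= M * g n `^ mu by rewrite ler_pM2l.
  have -> : M * (V n / (2 * M)) = V n / 2 by field; rewrite gt_eqF.
  lra.
have V1 : V n.+1 <= V n - al n / 4 * g n ^+ 2.
  apply: le_trans (lifted_descent n) _.
  have : (2 * e n) ^+ 2 <= g n ^+ 2.
    by rewrite lerXn2r // ?nnegrE // mulr_ge0 // ltW.
  rewrite exprMn => h; rewrite lerD2l lerN2.
  have -> : al n / 4 * g n ^+ 2 = al n / 2 * (g n ^+ 2 / 2) by field.
  rewrite ler_wpM2l ?divr_ge0 ?(ltW an) //.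
  by have := sqr_ge0 (g n); lra.
have g2 : (2 * M) `^ (- (2 / mu)) * (V n * V n `^ (2 / mu - 1)) <= g n ^+ 2.
  rewrite mulr_powRB1 ?(ltW Vn) ?divr_gt0 //.
  have -> : g n ^+ 2 = (g n `^ mu) `^ (2 / mu).
    by rewrite -powRrM mulrCA mulfV ?gt_eqF // mulr1 powR_mulrn.
  rewrite powRN mulrC -powR_div ?mulr_gt0 ?(ltW Vn) //.
  apply: powR_mono => //; first by rewrite divr_ge0 // ltW.
  by rewrite divr_ge0 ?mulr_ge0 // ltW.
have VT : K `^ (2 / mu - 1) * ga n `^ (- (m * (2 - mu))) <= V n `^ (2 / mu - 1).
  have -> : - (m * (2 - mu)) = - (mu * m) * (2 / mu - 1).
    by field; rewrite gt_eqF.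
  rewrite powRrM -powRM ?powR_ge0 ?(ltW K_gt0) //.
  apply: powR_mono => //; first by rewrite subr_ge0 ler_pdivlMr // mul1r.
  by rewrite mulr_ge0 ?powR_ge0 // ltW.
have zle : z * (al n / ga n) <= al n / 4 * ((2 * M) `^ (- (2 / mu))
      * V n `^ (2 / mu - 1)).
  apply: (@le_trans _ _ (al n * ((2 * M) `^ (- (2 / mu)) / 4 *
     (K `^ (2 / mu - 1) * ga n `^ (- (m * (2 - mu))))))).
    rewrite mulrCA ler_wpM2l ?(ltW an) // ler_pdivrMr //.
    apply: le_trans (gain_large n) _.
    rewrite le_eqVlt; apply/orP; left; apply/eqP.
    rewrite -!mulrA; congr (_ * (_ * (_ * _))).
    have -> : 1 - m * (2 - mu) = - (m * (2 - mu)) + 1 by lra.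
    by rewrite powRD ?(gt_eqF gan) ?implybT // powRr1 // ltW.
  have -> : al n / 4 * ((2 * M) `^ (- (2 / mu)) * V n `^ (2 / mu - 1))
      = al n * ((2 * M) `^ (- (2 / mu)) / 4 * V n `^ (2 / mu - 1)) by ring.
  rewrite ler_wpM2l ?(ltW an) // ler_wpM2l //.
  by rewrite divr_ge0 ?powR_ge0.
have V2 : V n.+1 <= V n * (1 - z * (ga n.+1 / ga n - 1)).
  apply: le_trans V1 _; rewrite mulrBr mulr1 lerD2l lerN2.
  have -> : ga n.+1 / ga n - 1 = al n / ga n.
    by rewrite gaS; field; rewrite gt_eqF.
  apply: (@le_trans _ _ (V n * (al n / 4 * ((2 * M) `^ (- (2 / mu))
      * V n `^ (2 / mu - 1))))); first by rewrite ler_wpM2l // ltW.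
  rewrite mulrCA ler_wpM2l ?divr_ge0 ?(ltW an) //.
  by rewrite mulrCA.
have := @powRN_ge_tangent1 R z (ga n.+1 / ga n) z_ge0 (divr_gt0 gan1 gan).
rewrite powR_div ?(ltW gan1) // !powRN invrK => h.
have {}V2 : V n.+1 <= V n * ((ga n.+1 `^ z)^-1 * ga n `^ z).
  by apply: le_trans V2 _; rewrite ler_wpM2l // ltW.
rewrite -ler_pdivlMr ?powR_gt0 //; apply: le_trans V2 _.
by rewrite [_^-1 * _]mulrC mulrA.
Qed.

Let powz n : V n * ga n `^ z = V n * ga n `^ (mu * m) * ga n.
Proof.
have gan := ga_gt0 n.
by rewrite powRD ?(gt_eqF gan) ?implybT // powRr1 ?(ltW gan) // mulrA.
Qed.

Let normalize n x : x * T n <= V n <-> x <= V n * ga n `^ (mu * m).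
Proof. by rewrite powRN ler_pdivrMr ?powR_gt0. Qed.

(** The normalized value [W] decreases as long as it exceeds [K], and from below
    [K] it can jump at most by the factor [2 `^ z].  It cannot stay above [K]
    for ever, since then [W * ga] would be bounded while time is not. *)
Lemma lifted_rate : exists N, forall n, (N <= n)%N ->
  V n <= 2 `^ (mu * m + 1) * K * T n.
Proof.
pose W n := V n * ga n `^ (mu * m).
have W0 n : 0 < W n by rewrite mulr_gt0 ?powR_gt0 // lifted_gt0.
have Wdec n : K <= W n -> W n.+1 <= W n.
  move=> /normalize /fast_decrease; rewrite !powz -!/(W _) => h.
  rewrite -(ler_pM2r (ga_gt0 n)) (le_trans _ h) // ler_wpM2l ?(ltW (W0 _)) //.
  exact: time_le.
have B0 : K <= 2 `^ z * K.
  by rewrite ler_peMl ?(ltW K_gt0) // -[leLHS](@powRr0 R 2) ler_powR // ler1n.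
have Wsmall n : W n < K -> W n.+1 <= 2 `^ z * K.
  move=> WK; have gan := ga_gt0 n; have gan1 := ga_gt0 n.+1.
  have Vn : V n <= K * T n.
    by rewrite powRN -ler_pdivrMr ?invr_gt0 ?powR_gt0 // invrK ltW.
  have sn := s_le n; have en := e_gt0 n.
  have e1 : e n <= 1.
    rewrite eE -[leRHS]mulr1; apply: ler_pM; rewrite ?powR_ge0 ?(ltW ep_gt0) //.
    by rewrite powRN invf_le1 ?powR_gt0 // -[leLHS](@powRr0 R (ga n)) ler_powR.
  have e2 : e n ^+ 2 <= K * T n.
    have h1 : e n ^+ 2 <= e n `^ mu.
      rewrite -powR_mulrn ?(ltW en) //; apply: ger_powR => //.
      by rewrite en e1.
    have h2 : e n `^ mu <= M * (2 * e n) `^ mu.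
      rewrite -[leLHS]mul1r; apply: ler_pM => //; first exact: powR_ge0.
      by apply: powR_mono; [exact: ltW|exact: ltW|lra].
    have : 0 <= K * T n by rewrite mulr_ge0 ?powR_ge0 // ltW.
    lra.
  have V1 : V n.+1 <= 2 * (K * T n).
    apply: le_trans (lifted_descent n) _.
    have an := al_gt0 n; have an1 := al_le1 n.
    have h : al n / 2 * e n ^+ 2 <= 1 * e n ^+ 2.
      by rewrite ler_wpM2r ?sqr_ge0 //; lra.
    have : 0 <= al n / 2 * g n ^+ 2 by rewrite mulr_ge0 ?sqr_ge0 ?divr_ge0 // ltW.
    by rewrite mulrBr; lra.
  have Tn : T n <= 2 `^ (mu * m) * T n.+1.
    rewrite !powRN ler_pdivlMr ?powR_gt0 // ler_pdivrMl ?powR_gt0 //.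
    rewrite -powRM ?(ltW gan) //; apply: powR_mono => //; first exact: ltW.
    by rewrite gaS mulr_natr mulr2n lerD2l (le_trans (al_le1 _)).
  rewrite /W -ler_pdivlMr ?powR_gt0 // -powRN.
  apply: le_trans V1 _; rewrite powRD ?pnatr_eq0 ?implybT // powRr1 //.
  have -> : 2 `^ (mu * m) * 2 * K * T n.+1 = 2 * (K * (2 `^ (mu * m) * T n.+1)).
    by ring.
  by rewrite ler_pM2l // ler_pM2l.
have Winv n : W n <= 2 `^ z * K -> W n.+1 <= 2 `^ z * K.
  move=> WB; have [KW|WK] := leP K (W n); last exact: Wsmall.
  exact: le_trans (Wdec _ KW) WB.
have [[N WN]|noN] := pselect (exists n, W n < K).
  exists N => n Nn.
  suff : W n <= 2 `^ z * K by rewrite powRN ler_pdivlMr ?powR_gt0.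
  rewrite -(subnKC Nn); elim: (n - N)%N => [|j IH]; last first.
    by rewrite addnS; exact: Winv.
  by rewrite addn0 (le_trans (ltW WN)).
have KW n : K <= W n by rewrite leNgt; apply/negP => h; apply: noN; exists n.
have Wga n : W n * ga n <= W 0%N * ga 0%N.
  elim: n => // n IH; apply: le_trans IH.
  by rewrite /W -!powz; apply: fast_decrease; apply/normalize; exact: KW.
have [n hn] := ga_unbounded (W 0%N * ga 0%N / K).
have : K * ga n <= W 0%N * ga 0%N.
  by apply: le_trans (Wga n); rewrite ler_wpM2r ?(ltW (ga_gt0 _)).
by rewrite -ler_pdivlMl // leNgt mulrC hn.
Qed.

End rate.

Section gradient.
Variable L : R.
Hypothesis L_gt0 : 0 < L.
Hypothesis g_lip : forall n m, (n <= m)%N ->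
  `|g m - g n| <= L * \sum_(n <= i < m) al i * (g i + e i).

(** Over a time interval of length [1 / (4 L)] the gradient keeps its order of
    magnitude, so a large gradient would make the value drop by a comparable
    amount; but the lifted value stays positive. *)
Lemma gradient_le n : g n ^+ 2 <= 9 * e n ^+ 2 + 72 * L * V n.
Proof.
have en := e_gt0 n; have gn := g_ge0 n; have Vn := lifted_gt0 n.
have [small|large] := leP (g n) (3 * e n).
  have : g n ^+ 2 <= (3 * e n) ^+ 2 by rewrite lerXn2r ?nnegrE // mulr_ge0 // ltW.
  have : 0 < L * V n by rewrite mulr_gt0.
  by rewrite exprMn; lra.
pose t := (4 * L)^-1.
have t0 : 0 < t by rewrite invr_gt0 mulr_gt0.
have Lt : L * t = 4^-1 by rewrite /t; field; rewrite gt_eqF.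
pose D j := \sum_(n <= i < n + j) al i * (g i + e i).
have D0 : D 0%N = 0 by rewrite /D addn0 big_geq.
have DS j : D j.+1 = D j + al (n + j)%N * (g (n + j)%N + e (n + j)%N).
  by rewrite /D addnS big_nat_recr //= leq_addr.
have gD j : `|g (n + j)%N - g n| <= L * D j by apply: g_lip; exact: leq_addr.
have HD j : ga (n + j)%N - ga n <= t ->
    D j <= 2 * (ga (n + j)%N - ga n) * (g n + e n).
  elim: j => [|j IH] hj; first by rewrite D0 addn0 subrr mulr0 mul0r.
  have {}hj : ga (n + j)%N - ga n <= t.
    by apply: le_trans hj; rewrite lerD2r; apply: time_le => //; rewrite addnS.
  have {}IH := IH hj; rewrite DS addnS gaS.
  have gb : g (n + j)%N + e (n + j)%N <= 2 * (g n + e n).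
    have := ler_norm (g (n + j)%N - g n); have := gD j.
    have := e_noninc (leq_addr j n).
    have : L * D j <= L * (2 * t * (g n + e n)).
      rewrite ler_pM2l // (le_trans IH) // ler_wpM2r; [by []|lra|].
      by rewrite ler_pM2l.
    have -> : L * (2 * t * (g n + e n)) = 2 * (L * t) * (g n + e n) by ring.
    by rewrite Lt; lra.
  have : al (n + j)%N * (g (n + j)%N + e (n + j)%N)
      <= al (n + j)%N * (2 * (g n + e n)) by rewrite ler_pM2l.
  by lra.
have gj j : ga (n + j)%N - ga n <= t -> g n / 3 <= g (n + j)%N.
  move=> hj; have := HD _ hj; have := gD j; rewrite ler_norml => /andP[gl _] hD.
  have : L * D j <= L * (2 * t * (g n + e n)).
    rewrite ler_pM2l // (le_trans hD) // ler_wpM2r; [by []|lra|].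
    by rewrite ler_pM2l.
  have -> : L * (2 * t * (g n + e n)) = 2 * (L * t) * (g n + e n) by ring.
  by rewrite Lt; lra.
have Vj j : (forall i, (i < j)%N -> ga (n + i)%N - ga n <= t) ->
    V (n + j)%N <= V n - (ga (n + j)%N - ga n) / 2 * (g n ^+ 2 / 9 - e n ^+ 2).
  elim: j => [|j IH] hj; first by rewrite addn0 subrr !mul0r subr0.
  have {}IH := IH (fun i ij => hj i (ltnW ij)).
  have h := hj j (ltnSn j); have gl := gj _ h.
  rewrite addnS gaS; apply: le_trans (lifted_descent _) _.
  have h1 : (g n / 3) ^+ 2 <= g (n + j)%N ^+ 2.
    by rewrite lerXn2r ?nnegrE // divr_ge0.
  have h2 : e (n + j)%N ^+ 2 <= e n ^+ 2.
    by rewrite lerXn2r ?nnegrE ?(ltW (e_gt0 _)) // e_noninc // leq_addr.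
  have h3 : al (n + j)%N / 2 * (g n ^+ 2 / 9 - e n ^+ 2) <=
            al (n + j)%N / 2 * (g (n + j)%N ^+ 2 - e (n + j)%N ^+ 2).
    rewrite ler_wpM2l ?divr_ge0 ?(ltW (al_gt0 _)) //.
    by move: h1; rewrite expr_div_n; lra.
  by lra.
have exj : exists j, ga n + t < ga (n + j)%N.
  have [j hj] := ga_unbounded (ga n + t); exists j.
  by apply: lt_le_trans hj _; apply: time_le => //; exact: leq_addl.
case: (ex_minnP exj) => j hj jmin.
have before i : (i < j)%N -> ga (n + i)%N - ga n <= t.
  move=> ij; rewrite lerBlDl leNgt; apply/negP => /jmin.
  by rewrite leqNgt ij.
have hV := Vj j before.
have V0 := lifted_gt0 (n + j)%N.
have q0 : 0 <= g n ^+ 2 / 9 - e n ^+ 2.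
  have : (3 * e n) ^+ 2 <= g n ^+ 2.
    by rewrite lerXn2r ?nnegrE ?(ltW large) // mulr_ge0 // ltW.
  by rewrite exprMn; lra.
have : t * (g n ^+ 2 / 9 - e n ^+ 2)
     <= (ga (n + j)%N - ga n) * (g n ^+ 2 / 9 - e n ^+ 2).
  by rewrite ler_wpM2r // lerBrDl ltW.
move=> h1.
have h3 : t * (g n ^+ 2 / 9 - e n ^+ 2) <= 2 * V n by lra.
have : 4 * L * (t * (g n ^+ 2 / 9 - e n ^+ 2)) <= 4 * L * (2 * V n).
  by rewrite ler_pM2l // mulr_gt0.
have -> : 4 * L * (t * (g n ^+ 2 / 9 - e n ^+ 2)) = 4 * (L * t) * (g n ^+ 2 / 9 - e n ^+ 2) by ring.
by rewrite Lt; lra.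
Qed.

End gradient.

End perturbed_descent.

(** * Euclidean geometry of row vectors *)

Section euclidean.
Context {R : realType} {n : nat}.
Implicit Types (u v w : 'rV[R]_n) (a : R).

Definition dot u v : R := (u *m v^T) 0 0.

Lemma dotE u v : dot u v = \sum_i u 0 i * v 0 i.
Proof. by rewrite /dot mxE; apply: eq_bigr => i _; rewrite mxE. Qed.

Lemma dotC u v : dot u v = dot v u.
Proof. by rewrite !dotE; apply: eq_bigr => i _; rewrite mulrC. Qed.

Lemma dotDl u v w : dot (u + v) w = dot u w + dot v w.
Proof. by rewrite /dot mulmxDl mxE. Qed.

Lemma dotZl a u v : dot (a *: u) v = a * dot u v.
Proof. by rewrite /dot -scalemxAl mxE. Qed.

Lemma dotNl u v : dot (- u) v = - dot u v.
Proof. by rewrite -scaleN1r dotZl mulN1r. Qed.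

Lemma dotBl u v w : dot (u - v) w = dot u w - dot v w.
Proof. by rewrite dotDl dotNl. Qed.

Lemma dotZr a u v : dot u (a *: v) = a * dot u v.
Proof. by rewrite dotC dotZl dotC. Qed.

Lemma dotDr u v w : dot u (v + w) = dot u v + dot u w.
Proof. by rewrite dotC dotDl !(dotC _ u). Qed.

Lemma dotBr u v w : dot u (v - w) = dot u v - dot u w.
Proof. by rewrite dotC dotBl !(dotC _ u). Qed.

Lemma enorm_ge0 u : 0 <= enorm u.
Proof. exact: sqrtr_ge0. Qed.

Lemma sqr_enorm u : enorm u ^+ 2 = dot u u.
Proof.
rewrite sqr_sqrtr; last by apply: sumr_ge0 => i _; exact: sqr_ge0.
by rewrite dotE; apply: eq_bigr => i _; rewrite expr2.
Qed.

Lemma enorm0 : enorm (0 : 'rV[R]_n) = 0.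
Proof.
by rewrite /enorm big1 ?sqrtr0 // => i _; rewrite mxE expr0n.
Qed.

Lemma coord_le_enorm u i : `|u 0 i| <= enorm u.
Proof.
rewrite -sqrtr_sqr ler_sqrt; last by apply: sumr_ge0 => j _; exact: sqr_ge0.
rewrite (bigD1 i) //= lerDl; apply: sumr_ge0 => j _; exact: sqr_ge0.
Qed.

Lemma enorm0_eq0 u : enorm u = 0 -> u = 0.
Proof.
move=> u0; apply/rowP => i; rewrite [RHS]mxE; apply/eqP; rewrite -normr_le0.
by rewrite -u0; exact: coord_le_enorm.
Qed.

Lemma dot_le_enorm u v : dot u v <= enorm u * enorm v.
Proof.
have [/enorm0_eq0 ->|u0] := eqVneq (enorm u) 0.
  by rewrite enorm0 mul0r dotE big1 // => i _; rewrite mxE mul0r.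
have [/enorm0_eq0 ->|v0] := eqVneq (enorm v) 0.
  by rewrite enorm0 mulr0 dotE big1 // => i _; rewrite mxE mulr0.
have p : 0 < enorm u * enorm v by rewrite mulr_gt0 // lt_neqAle eq_sym ?u0 ?v0 enorm_ge0.
have := sqr_ge0 (enorm (enorm v *: u - enorm u *: v)).
rewrite sqr_enorm dotBl !dotBr !dotZl !dotZr -!sqr_enorm (dotC v u) => h.
rewrite -(ler_pM2l p) -subr_ge0 -(@pmulr_rge0 _ 2) //.
by apply: le_trans h _; rewrite le_eqVlt; apply/orP; left; apply/eqP; ring.
Qed.

Lemma ler_enormD u v : enorm (u + v) <= enorm u + enorm v.
Proof.
rewrite -(ler_pXn2r (n:=2)) // ?nnegrE ?addr_ge0 ?enorm_ge0 //.
rewrite sqr_enorm dotDl !dotDr -!sqr_enorm (dotC v u) sqrrD.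
by have := dot_le_enorm u v; lra.
Qed.

Lemma enormZ a u : enorm (a *: u) = `|a| * enorm u.
Proof.
apply/eqP; rewrite -(eqrXn2 (n:=2)) ?mulr_ge0 ?enorm_ge0 //.
by rewrite exprMn !sqr_enorm dotZl dotZr real_normK ?num_real // mulrA -expr2.
Qed.

Lemma enormN u : enorm (- u) = enorm u.
Proof. by rewrite -scaleN1r enormZ normrN normr1 mul1r. Qed.

Lemma enormB u v : enorm (u - v) = enorm (v - u).
Proof. by rewrite -enormN opprB. Qed.

Lemma ler_enormB u v w : enorm (u - w) <= enorm (u - v) + enorm (v - w).
Proof. by apply: le_trans (ler_enormD _ _); rewrite addrA subrK. Qed.

Lemma ler_dist_enorm u v : `|enorm u - enorm v| <= enorm (u - v).
Proof.
have h1 := ler_enormD (u - v) v; have h2 := ler_enormD (v - u) u.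
rewrite !subrK in h1 h2; rewrite enormB in h2.
by rewrite ler_norml; apply/andP; split; lra.
Qed.

Lemma polarization u v : dot u v = (enorm u ^+ 2 + enorm v ^+ 2 - enorm (u - v) ^+ 2) / 2.
Proof. by rewrite !sqr_enorm dotBl !dotBr (dotC v u); field. Qed.

Lemma ler_enorm_sum (I : Type) (r : seq I) (P : pred I) (F : I -> 'rV[R]_n) :
  enorm (\sum_(i <- r | P i) F i) <= \sum_(i <- r | P i) enorm (F i).
Proof.
elim/big_rec2 : _ => [|i x y _ h]; first by rewrite enorm0.
by rewrite (le_trans (ler_enormD _ _)) // lerD2l.
Qed.

Lemma enorm_le_sum u : enorm u <= \sum_i `|u 0 i|.
Proof.
rewrite {1}(row_sum_delta u) (le_trans (ler_enorm_sum _ _ _)) //.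
apply: ler_sum => i _; rewrite enormZ ler_piMr //.
rewrite -(ler_pXn2r (n:=2)) // ?nnegrE ?enorm_ge0 // sqr_enorm dotE.
rewrite (bigD1 i) //= big1 ?mxE ?eqxx ?mulr1 ?addr0 ?expr1n // => j ji.
by rewrite mxE eqxx (negbTE ji) mulr0.
Qed.

Lemma coord_le_mxnorm u i : `|u 0 i| <= `|u|.
Proof.
rewrite [leRHS](mx_normrE u).
exact: (le_bigmax _ (fun ij : 'I_1 * 'I_n => `|u ij.1 ij.2|) (0, i)).
Qed.

Lemma mxnorm_le_enorm u : `|u| <= enorm u.
Proof.
rewrite [leLHS](mx_normrE u); apply: bigmax_le => [|[i j] _]; first exact: enorm_ge0.
by rewrite /= ord1; exact: coord_le_enorm.
Qed.

Lemma enorm_le_mxnorm u : enorm u <= n%:R * `|u|.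
Proof.
rewrite (le_trans (enorm_le_sum u)) //.
apply: (@le_trans _ _ (\sum_(i < n) `|u|)).
  by apply: ler_sum => i _; exact: coord_le_mxnorm.
by rewrite sumr_const card_ord mulr_natl.
Qed.

Lemma enorm_continuous : continuous (@enorm R n).
Proof.
move=> x.
apply/(@cvgrPdist_le _ _ _ (nbhs (x : 'rV[R]_n)) (nbhs_filter x)) => e e0.
have np : 0 < n%:R + 1 :> R by rewrite ltr_wpDl.
have d0 : 0 < e / (n%:R + 1) by rewrite divr_gt0.
apply: filterS (nbhsx_ballx x _ d0) => t; rewrite -ball_normE /= => xt.
apply: le_trans (ler_dist_enorm _ _) _.
apply: le_trans (enorm_le_mxnorm _) _.
apply: (@le_trans _ _ ((n%:R + 1) * `|x - t|)).
  by rewrite ler_wpM2r // lerDl.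
by rewrite -ler_pdivlMl // mulrC ltW.
Qed.

End euclidean.

(** * Smooth functions on compact convex sets *)

Section smooth.
Context {R : realType} {n : nat}.
Implicit Types (f : 'rV[R]_n -> R) (x y d : 'rV[R]_n).

(** Local Lipschitz continuity bounds the increments near every pair of points,
    including distinct ones; compactness of [K `*` K] makes the constant uniform. *)
Lemma lipschitz_on_compact (h : 'rV[R]_n -> 'rV[R]_n) (K : set 'rV[R]_n) :
  compact K -> [locally [lipschitz h x | x in setT]] ->
  exists2 L, 0 < L & forall x y, K x -> K y ->
    enorm (h x - h y) <= L * enorm (x - y).
Proof.
move=> cK lip.
have cKK : compact (K `*` K) by exact: compact_setX.
have /compact_near_coveringP cov := cKK.
pose P (M : R) (p : 'rV[R]_n * 'rV[R]_n) := `|h p.1 - h p.2| <= M * `|p.1 - p.2|.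
have : \forall M \near +oo, K `*` K `<=` P M.
  apply: cov => p _.
  have [M0 [M0real HM]] := lip p (conj I I).
  have {}HM := HM (M0 + 1) (ltr_pwDr ltr01 (lexx _)).
  have near_p : \forall p' \near p, P (M0 + 1) p'.
    move: HM; rewrite /dominated_by /within /self_sub /=.
    by apply: filterS => p' /(_ (conj I I)).
  exists ([set p' | P (M0 + 1) p'], [set M | M0 + 1 < M]).
    split => //=; exists (M0 + 1); split => //; exact: num_real.
  move=> [p' M] /= [Pp' ltM]; apply: le_trans Pp' _.
  by rewrite ler_wpM2r // ltW.
move=> [M0 [_ HM]]; pose M := Num.max M0 0 + 1.
have M0M : M0 < M by rewrite /M ltr_pwDr // le_max lexx.
have M_gt0 : 0 < M by rewrite /M ltr_pwDr // le_max lexx orbT.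
exists (n%:R * M + 1); first by rewrite ltr_wpDl // mulr_ge0 // ltW.
move=> x y Kx Ky; have /= := HM _ M0M (x, y) (conj Kx Ky); rewrite /P /= => h1.
apply: le_trans (enorm_le_mxnorm _) _.
apply: (@le_trans _ _ (n%:R * M * enorm (x - y))).
  rewrite -mulrA ler_wpM2l // (le_trans h1) // ler_pM2l //.
  exact: mxnorm_le_enorm.
by rewrite ler_wpM2r ?enorm_ge0 // lerDl.
Qed.

Lemma derive_dot f x d : differentiable f x -> 'D_d f x = dot (grad f x) d.
Proof.
move=> df; rewrite deriveE // {1}(row_sum_delta d) linear_sum dotE.
apply: eq_bigr => i _; rewrite linearZ /= -deriveE // /grad mxE.
by rewrite mulrC.
Qed.

Lemma mean_value f x d : (forall x, differentiable f x) ->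
  exists2 t, 0 <= t <= 1 & f (x + d) - f x = dot (grad f (x + t *: d)) d.
Proof.
move=> df; pose phi t := f (x + t *: d).
have dphi (t : R) : is_derive t 1 phi ('D_d f (x + t *: d)).
  have E : (fun h : R => h^-1 *: ((phi \o shift t) (h *: 1) - phi t))
         = (fun h : R => h^-1 *: ((f \o shift (x + t *: d)) (h *: d) - f (x + t *: d))).
    apply/funext => h; rewrite /phi /= /shift /=; congr (_ *: (f _ - _)).
    by rewrite [h *: 1]mulr1 scalerDl addrCA.
  have D : derivable f (x + t *: d) d by exact: diff_derivable.
  by apply: DeriveDef; rewrite /derivable /derive E.
have cphi : {within `[0, 1], continuous phi}.
  by apply: derivable_within_continuous => t _; have [] := dphi t.
have [t t01 Ht] := @MVT_segment R phi _ 0 1 ler01 (fun t _ => dphi t) cphi.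
exists t; first by move: t01; rewrite in_itv.
by move: Ht; rewrite /phi scale0r addr0 scale1r subr0 mulr1 derive_dot.
Qed.

(** The mean value theorem on the segment gives the quadratic term with the
    constant [L], which is all that descent needs. *)
Lemma descent_inequality f (K : set 'rV[R]_n) L x d :
  (forall x, differentiable f x) ->
  (forall x y, K x -> K y -> enorm (grad f x - grad f y) <= L * enorm (x - y)) ->
  0 <= L -> (forall t, 0 <= t <= 1 -> K (x + t *: d)) ->
  f (x + d) <= f x + dot (grad f x) d + L * enorm d ^+ 2.
Proof.
move=> df lip L0 seg; have [t t01 Ht] := mean_value x d df.
have K0 : K x by have := seg 0; rewrite scale0r addr0; apply; rewrite lexx ler01.
have -> : f (x + d) = f x + (f (x + d) - f x) by rewrite addrCA subrr addr0.
rewrite Ht -addrA lerD2l -lerBlDl -dotBl.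
apply: le_trans (dot_le_enorm _ _) _.
rewrite expr2 mulrA ler_wpM2r ?enorm_ge0 //.
apply: le_trans (lip _ _ (seg _ t01) K0) _.
rewrite ler_wpM2l // addrC addKr enormZ.
case/andP: t01 => t0 t1; rewrite ger0_norm // ler_piMl ?enorm_ge0 //.
Qed.

(** Sup-norm balls are compact and convex, and countably many of them exhaust the
    space. *)
Definition box (A : R) : set 'rV[R]_n := [set x | `|x| <= A].

Lemma box_compact A : compact (box A).
Proof.
apply: bounded_closed_compact.
  exists A; split; first exact: num_real.
  by move=> B AB x /= xA; exact: le_trans xA (ltW AB).
rewrite (_ : box A = (@Num.norm _ _ : 'rV[R]_n -> R) @^-1` [set r | r <= A]) //.
by apply: preimage_closed => [x _|]; [exact: norm_continuous|exact: closed_le].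
Qed.

Lemma box_convex A x d t : box A x -> box A (x + d) -> 0 <= t <= 1 -> box A (x + t *: d).
Proof.
rewrite /box /= => xA xdA /andP[t0 t1].
have -> : x + t *: d = (1 - t) *: x + t *: (x + d).
  by rewrite scalerBl scale1r scalerDr addrA subrK.
apply: le_trans (ler_normD _ _) _; rewrite !normrZ !ger0_norm ?subr_ge0 //.
have : (1 - t) * `|x| <= (1 - t) * A by rewrite ler_wpM2l // subr_ge0.
have : t * `|x + d| <= t * A by rewrite ler_wpM2l.
by lra.
Qed.

End smooth.

(** * Cauchy sequences and weighted noise *)

Section cauchy.
Context {R : realType}.
Implicit Types (u : nat -> R) (e : R).

Lemma cvgn_cauchy u : cvgn u -> forall e, 0 < e ->
  exists N, forall n m, (N <= n)%N -> (n <= m)%N -> `|u m - u n| <= e.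
Proof.
move=> /cvg_ex[l ul] e e0.
have [N _ HN] := @cvgr_dist_le _ _ _ _ _ _ _ ul (e / 2) (divr_gt0 e0 (ltr0Sn _ 1)).
exists N => n m Nn nm.
have h1 := HN n Nn; have h2 := HN m (leq_trans Nn nm).
have -> : u m - u n = (l - u n) - (l - u m) by ring.
by apply: le_trans (ler_normB _ _) _; move: h1 h2 => /=; lra.
Qed.

Lemma cauchy_cvgn u : (forall e, 0 < e ->
  exists N, forall n m, (N <= n)%N -> (n <= m)%N -> `|u m - u n| <= e) -> cvgn u.
Proof.
move=> H; apply/cauchy_cvgP/cauchy_exP => e e0.
have [N HN] := H (e / 2) (divr_gt0 e0 (ltr0Sn _ 1)).
exists (u N), N => // n /= Nn; rewrite -ball_normE /= distrC.
by apply: le_lt_trans (HN _ _ (leqnn N) Nn) _; rewrite ltr_pdivrMr // ltr_pMr // ltr1n.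
Qed.

Lemma small_tails (a : nat -> R) B : (forall n, 0 <= a n) ->
  (forall n, \sum_(0 <= k < n) a k <= B) -> forall e, 0 < e ->
  exists N, forall n m, (N <= n)%N -> (n <= m)%N -> \sum_(n <= k < m) a k <= e.
Proof.
move=> a0 aB e e0.
have homo : {homo (fun n => \sum_(0 <= k < n) a k) : n m / (n <= m)%N >-> n <= m}.
  move=> n m nm; rewrite (big_cat_nat _ nm) //= lerDl.
  exact: sumr_ge0.
have cv : cvgn (fun n => \sum_(0 <= k < n) a k).
  by apply: nondecreasing_is_cvgn => //; exists B => _ [n _ <-].
have [N HN] := cvgn_cauchy cv e0; exists N => n m Nn nm.
have := HN n m Nn nm; rewrite (big_cat_nat _ nm) //= addrAC subrr add0r.
exact: le_trans (ler_norm _).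
Qed.

(** Summation by parts turns convergence of the weighted series into a rate
    for the tails of the unweighted one. *)
Lemma weighted_tail (x w : nat -> R) :
  (forall n, (0 < n)%N -> 0 < w n) -> {homo w : n m / (n <= m)%N >-> n <= m} ->
  cvgn (fun n => \sum_(0 <= k < n) w k * x k) ->
  exists s, forall e, 0 < e -> \forall n \near \oo,
    `|s - \sum_(0 <= k < n) x k| <= e / w n.
Proof.
move=> w0 wmono cv; pose S n := \sum_(0 <= k < n) w k * x k.
pose X n := \sum_(0 <= k < n) x k.
have wi n m : (0 < n)%N -> (n <= m)%N -> (w m)^-1 <= (w n)^-1.
  move=> n0 nm; rewrite lef_pV2 ?posrE ?w0 ?wmono //.
  exact: leq_trans nm.
have parts n j : (0 < n)%N -> X (n + j)%N - X n = (S (n + j)%N - S n) / w (n + j)%N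
    + \sum_(n <= k < n + j) ((w k)^-1 - (w k.+1)^-1) * (S k.+1 - S n).
  move=> n0; elim: j => [|j IH].
    by rewrite addn0 !subrr mul0r big_geq // addr0.
  rewrite addnS big_nat_recr ?leq_addr //=.
  have -> : X (n + j).+1 = X (n + j)%N + x (n + j)%N by rewrite /X big_nat_recr.
  have SS : S (n + j).+1 = S (n + j)%N + w (n + j)%N * x (n + j)%N.
    by rewrite /S big_nat_recr.
  have -> : X (n + j)%N + x (n + j)%N - X n = (X (n + j)%N - X n) + x (n + j)%N.
    by ring.
  have nj : (0 < n + j)%N by rewrite addn_gt0 n0.
  have wn0 : w (n + j)%N != 0 by rewrite gt_eqF // w0.
  have wn1 : w (n + j).+1 != 0 by rewrite gt_eqF // w0.
  by rewrite IH SS; move: (\sum_(_ <= _ < _) _) => T; field; rewrite wn0 wn1.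
have bound e : 0 < e -> exists N, forall n m, (N <= n)%N -> (0 < n)%N -> (n <= m)%N ->
    `|X m - X n| <= e / w n.
  move=> e0; have [N HN] := cvgn_cauchy cv e0; exists N => n m Nn n0 nm.
  rewrite -(subnKC nm) parts //; set j := (m - n)%N.
  apply: le_trans (ler_normD _ _) _.
  apply: (@le_trans _ _ (e / w (n + j)%N +
     \sum_(n <= k < n + j) ((w k)^-1 - (w k.+1)^-1) * e)).
    apply: lerD.
      rewrite normrM normfV (gtr0_norm (w0 _ _)) ?addn_gt0 ?n0 //.
      by rewrite ler_wpM2r ?invr_ge0 ?(ltW (w0 _ _)) ?addn_gt0 ?n0 // HN // leq_addr.
    apply: le_trans (ler_norm_sum _ _ _) _; apply: ler_sum_nat => k /andP[nk _].
    have k0 := leq_trans n0 nk.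
    rewrite normrM ger0_norm ?subr_ge0 ?wi //.
    by rewrite ler_wpM2l ?subr_ge0 ?wi // HN // leqW.
  rewrite -mulr_suml.
  rewrite (eq_bigr (fun k => - ((w k.+1)^-1 - (w k)^-1))); last first.
    by move=> k _; rewrite opprB.
  rewrite sumrN telescope_sumr ?leq_addr // opprB.
  by rewrite le_eqVlt; apply/orP; left; apply/eqP; ring.
have cX : cvgn X.
  apply: cauchy_cvgn => e e0.
  have w1 := w0 1%N isT.
  have [N HN] := bound (e * w 1%N) (mulr_gt0 e0 w1); exists (maxn N 1) => n m.
  rewrite geq_max => /andP[Nn n0] nm; apply: le_trans (HN _ _ Nn n0 nm) _.
  rewrite ler_pdivrMr ?w0 // ler_wpM2l ?(ltW e0) //.
  exact: wmono.
exists (limn X) => e e0; have [N HN] := bound e e0.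
exists (maxn N 1) => // n /=; rewrite geq_max => /andP[Nn n0].
have cXn : `|X m - X n| @[m --> \oo] --> `|limn X - X n|.
  by apply: cvg_norm; apply: cvgB => //; exact: cvg_cst.
have -> : `|limn X - X n| = limn (fun m => `|X m - X n|) by rewrite (cvg_lim _ cXn).
apply: limr_le; first by apply/cvg_ex; eexists; exact: cXn.
by exists n => // m /= nm; exact: HN.
Qed.

Lemma cvg_rV n (u : nat -> 'rV[R]_n) (l : 'rV[R]_n) :
  (forall i, u k 0 i @[k --> \oo] --> l 0 i) -> u k @[k --> \oo] --> l.
Proof.
move=> H; apply/cvgrPdist_le => e e0.
have : \forall k \near \oo, forall i, `|l 0 i - u k 0 i| <= e.
  by apply: filter_forall => i; have /cvgr_dist_le /(_ e e0) := H i.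
apply: filterS => k Hk; rewrite [leLHS](mx_normrE (l - u k)).
by apply: bigmax_le => [|[i j] _]; rewrite ?(ltW e0) //= ord1 !mxE.
Qed.

Lemma cvg_enorm n (u : nat -> 'rV[R]_n) (l : 'rV[R]_n) :
  (forall e, 0 < e -> \forall k \near \oo, enorm (l - u k) <= e) ->
  u k @[k --> \oo] --> l.
Proof.
move=> H; apply/cvgrPdist_le => e e0; apply: filterS (H e e0) => k.
exact: le_trans (mxnorm_le_enorm _).
Qed.

Lemma cvg_enorm_dist n (u : nat -> 'rV[R]_n) (l : 'rV[R]_n) e : 0 < e ->
  u k @[k --> \oo] --> l -> \forall k \near \oo, enorm (u k - l) <= e.
Proof.
move=> e0 ul.
have np : 0 < n%:R + 1 :> R by rewrite ltr_wpDl.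
have /cvgr_dist_le /(_ _ (divr_gt0 e0 np)) := ul.
apply: filterS => k h; rewrite enormB; apply: le_trans (enorm_le_mxnorm _) _.
apply: (@le_trans _ _ ((n%:R + 1) * `|l - u k|)).
  by rewrite ler_wpM2r // lerDl.
by rewrite -ler_pdivlMl // mulrC.
Qed.

End cauchy.

(** * Gradient descent along a perturbed path *)

Lemma sqrrD_le2 (R : realType) (x y : R) : (x + y) ^+ 2 <= 2 * x ^+ 2 + 2 * y ^+ 2.
Proof. by have := sqr_ge0 (x - y); rewrite sqrrB sqrrD; lra. Qed.

Lemma mulr_le_sqrD (R : realType) (x y : R) : x * y <= x ^+ 2 + y ^+ 2.
Proof.
have := sqr_ge0 (x - y); have := sqr_ge0 x; have := sqr_ge0 y.
by rewrite sqrrB; lra.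
Qed.

Lemma norm_le_lifted (R : realType) (x s : R) : 0 <= s -> s <= x + 2 * s ->
  `|x| <= x + 2 * s.
Proof. by move=> s0 xs; rewrite ler_norml; apply/andP; split; lra. Qed.

(** Two descent inequalities, one from each end of a segment, combined: [p] and
    [q] are the linear terms and [w] the common quadratic one. *)
Lemma two_sided_bound (R : realType) (u v p q w ge g2 e2 : R) :
  u <= v + p + w -> v <= u + q + w -> p <= ge -> q <= ge + e2 -> w <= e2 ->
  ge <= g2 + e2 -> 0 <= e2 -> `|u - v| <= g2 + 3 * e2.
Proof. by move=> *; rewrite ler_norml; apply/andP; split; lra. Qed.

(** How the constants of the length estimate and of the noise add up in the final
    bound on a distance. *)
Lemma five_terms_bound (R : realType) (s1 s2 c1 v ep c3 q ck kk p : R) :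
  s1 <= c1 * v + 4 * ep * c3 * q -> s2 <= ep * (c3 * q) ->
  c1 * v <= c1 * (ck * kk * p) -> ep * (c3 * q) <= kk * (c3 * p) ->
  s1 + s2 <= (c1 * ck + 5 * c3) * kk * p.
Proof. by lra. Qed.

Section gradient_path.
Context {R : realType} {d : nat} (al : nat -> R) (r : R) (f : 'rV[R]_d -> R).
Context (theta y : nat -> 'rV[R]_d) (A : R).
Hypothesis al_gt0 : forall n, 0 < al n.
Hypothesis al_cvg0 : al n @[n --> \oo] --> (0 : R).
Hypothesis ga_unbounded : forall B, exists n, B < gamma al n.
Hypothesis r_gt1 : 1 < r.
Hypothesis f_diff : forall x, differentiable f x.
Hypothesis f_lip : [locally [lipschitz (grad f) x | x in setT]].
Hypothesis theta_box : forall n, box A (theta n).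
Hypothesis yS : forall n, y n.+1 = y n - al n *: grad f (theta n).
Hypothesis noise : forall e, 0 < e ->
  \forall n \near \oo, enorm (theta n - y n) <= e * gamma al n `^ (- r).

Local Notation ga := (gamma al).
Local Notation G n := (enorm (grad f (y n))).

Lemma gammaS n : ga n.+1 = ga n + al n.
Proof. by rewrite /gamma big_nat_recr. Qed.

Lemma gamma_near B : \forall n \near \oo, B <= ga n.
Proof.
have [N hN] := ga_unbounded B; exists N => // n /= Nn.
by apply: le_trans (ltW hN) _; apply: time_le => //; exact: gammaS.
Qed.

Lemma f_continuous : continuous f.
Proof. by move=> x; exact: differentiable_continuous. Qed.

Lemma grad_continuous : continuous (grad f).
Proof.
move=> x; have cb := @box_compact R d (`|x| + 1).
have [L L0 HL] := lipschitz_on_compact cb f_lip.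
apply/(@cvgrPdist_le _ _ _ (nbhs (x : 'rV[R]_d)) (nbhs_filter x)) => e e0.
have np : 0 < L * (d%:R + 1) by rewrite mulr_gt0 // ltr_wpDl.
have q0 : 0 < Num.min 1 (e / (L * (d%:R + 1))) by rewrite lt_min ltr01 divr_gt0.
apply: filterS (nbhsx_ballx x _ q0) => t; rewrite -ball_normE /= lt_min.
move=> /andP[xt1 xt2].
apply: le_trans (mxnorm_le_enorm _) _.
apply: le_trans (HL _ _ _ _) _.
- by rewrite /box /= lerDl.
- rewrite /box /=; have -> : t = x - (x - t) by rewrite opprB addrC subrK.
  by apply: le_trans (ler_normB _ _) _; rewrite lerD2l ltW.
apply: (@le_trans _ _ (L * ((d%:R + 1) * `|x - t|))).
  rewrite ler_pM2l //; apply: le_trans (enorm_le_mxnorm _) _.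
  by rewrite ler_wpM2r // lerDl.
by rewrite mulrA -ler_pdivlMl // mulrC ltW.
Qed.

(** The box is enlarged by 1 so as to contain eventually the noise-free path as
    well as the given one. *)
Lemma lipschitz_constant : exists2 L, 1 <= L & forall x x', box (A + 1) x ->
  box (A + 1) x' -> enorm (grad f x - grad f x') <= L * enorm (x - x').
Proof.
have [L L0 HL] := lipschitz_on_compact (@box_compact R d (A + 1)) f_lip.
exists (L + 1); first by rewrite lerDr ltW.
move=> x x' bx bx'; apply: le_trans (HL _ _ bx bx') _.
by rewrite ler_wpM2r ?enorm_ge0 // lerDl.
Qed.

Section lipschitz.
Variable L : R.
Hypothesis L_ge1 : 1 <= L.
Hypothesis grad_lip : forall x x', box (A + 1) x -> box (A + 1) x' ->
  enorm (grad f x - grad f x') <= L * enorm (x - x').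

Let L_gt0 : 0 < L. Proof. exact: lt_le_trans L_ge1. Qed.

Lemma theta_box1 n : box (A + 1) (theta n).
Proof. by have := theta_box n; rewrite /box /=; lra. Qed.

Lemma eventually_small ep : 0 < ep -> \forall n \near \oo,
  [/\ 1 <= ga n, al n <= 1, L * al n <= 2^-1,
      L * enorm (theta n - y n) <= ep * ga n `^ (- r) & box (A + 1) (y n)].
Proof.
move=> ep0; have g1 := gamma_near 1.
have Li : 0 < (2 * L)^-1 by rewrite invr_gt0 mulr_gt0.
have /cvgr_dist_le /(_ _ ltr01) a1 := al_cvg0.
have /cvgr_dist_le /(_ _ Li) a2 := al_cvg0.
have n1 := noise (divr_gt0 ep0 L_gt0); have n2 := noise ltr01.
near=> n.
have gn : 1 <= ga n by near: n.
split => //.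
- have : `|0 - al n| <= 1 by near: n.
  by rewrite sub0r normrN gtr0_norm.
- have : `|0 - al n| <= (2 * L)^-1 by near: n.
  rewrite sub0r normrN gtr0_norm // => h.
  have -> : 2^-1 = L * (2 * L)^-1 by field; rewrite gt_eqF.
  by rewrite ler_pM2l.
- have : enorm (theta n - y n) <= ep / L * ga n `^ (- r) by near: n.
  by rewrite -ler_pdivlMl // mulrA [L^-1 * ep]mulrC.
- have h : enorm (theta n - y n) <= 1 * ga n `^ (- r) by near: n.
  have p1 : ga n `^ (- r) <= 1.
    rewrite -[leRHS](@powRr0 R (ga n)) ler_powR // oppr_le0.
    exact: ltW (lt_trans ltr01 r_gt1).
  rewrite /box /=; have -> : y n = theta n - (theta n - y n).
    by rewrite opprB addrC subrK.
  apply: le_trans (ler_normB _ _) _; apply: lerD; first exact: theta_box.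
  by apply: le_trans (mxnorm_le_enorm _) _; apply: le_trans h _; rewrite mul1r.
Unshelve. all: by end_near. Qed.

(** Polarization: a step along the gradient at [theta n] decreases [f] as a
    step along the gradient at [y n] would, up to the squared difference of the
    two gradients. *)
Lemma descent_step n e : 0 <= e -> L * al n <= 2^-1 ->
  L * enorm (theta n - y n) <= e -> box (A + 1) (y n) -> box (A + 1) (y n.+1) ->
  f (y n.+1) <= f (y n) - al n / 2 * (G n ^+ 2 - e ^+ 2).
Proof.
move=> e0 La We by0 by1; set h := grad f (theta n).
have an := al_gt0 n.
have D : f (y n + (- (al n *: h))) <=
    f (y n) + dot (grad f (y n)) (- (al n *: h)) + L * enorm (- (al n *: h)) ^+ 2.
  apply: (descent_inequality f_diff grad_lip (ltW L_gt0)) => t t01.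
  by apply: box_convex => //; rewrite -yS.
rewrite -yS in D; apply: le_trans D _.
rewrite enormN enormZ gtr0_norm // exprMn -scaleNr dotZr polarization.
have We2 : enorm (grad f (y n) - h) ^+ 2 <= e ^+ 2.
  rewrite lerXn2r ?nnegrE ?enorm_ge0 //; apply: le_trans We.
  by rewrite [enorm (theta n - _)]enormB; apply: grad_lip => //; exact: theta_box1.
have La2 : L * al n * (al n * enorm h ^+ 2) <= 2^-1 * (al n * enorm h ^+ 2).
  by rewrite ler_wpM2r // mulr_ge0 ?sqr_ge0 // ltW.
have aWe : al n * enorm (grad f (y n) - h) ^+ 2 <= al n * e ^+ 2 by rewrite ler_pM2l.
set X := enorm (grad f (y n)) ^+ 2 in We2 *; set Y := enorm h ^+ 2 in La2 *.
set T := enorm (grad f (y n) - h) ^+ 2 in aWe *.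
have -> : L * (al n ^+ 2 * Y) = L * al n * (al n * Y) by ring.
by lra.
Qed.

Lemma movement_le n m : (n <= m)%N ->
  enorm (y m - y n) <= \sum_(n <= i < m) al i * enorm (grad f (theta i)).
Proof.
move=> nm; rewrite -(telescope_sumr y nm).
apply: le_trans (ler_enorm_sum _ _ _) _; apply: ler_sum => i _.
by rewrite yS addrAC subrr add0r enormN enormZ gtr0_norm.
Qed.

(** Everything that holds eventually along the path is made to hold from time 0
    on by a shift of the indices; [P] collects what else a later argument wants
    to hold. *)
Lemma path_setup ep (P : nat -> Prop) : 0 < ep -> (\forall n \near \oo, P n) ->
  exists N, [/\ (forall n, 1 <= ga (n + N)) /\ (forall n, al (n + N) <= 1),
   (forall n, f (y (n.+1 + N)) <= f (y (n + N)) - al (n + N) / 2 *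
       (G (n + N) ^+ 2 - (ep * ga (n + N) `^ (- r)) ^+ 2)),
   (forall n, [/\ box (A + 1) (y (n + N)),
      L * enorm (theta (n + N) - y (n + N)) <= ep * ga (n + N) `^ (- r) & P (n + N)%N]),
   (forall n, enorm (grad f (theta (n + N))) <= G (n + N) + ep * ga (n + N) `^ (- r)) &
   (forall n m, (n <= m)%N -> enorm (y (m + N) - y (n + N)) <=
      \sum_(n <= i < m) al (i + N)%N * (G (i + N) + ep * ga (i + N) `^ (- r)))].
Proof.
move=> ep0 HP; have [N _ HN] := filterI (eventually_small ep0) HP.
have {}HN n := HN (n + N)%N (leq_addl _ _).
have gth n : enorm (grad f (theta (n + N))) <= G (n + N) + ep * ga (n + N) `^ (- r).
  have [[_ _ _ We byn] _] := HN n.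
  rewrite -lerBlDl; apply: le_trans We.
  apply: le_trans (grad_lip (theta_box1 _) byn).
  exact: le_trans (ler_norm _) (ler_dist_enorm _ _).
exists N; split => //.
- by split => n; have [[]] := HN n.
- move=> n; have [[_ _ La We byn] _] := HN n; have [[_ _ _ _ byn1] _] := HN n.+1.
  by apply: descent_step => //; rewrite mulr_ge0 ?powR_ge0 // ltW.
- by move=> n; have [[]] := HN n.
- move=> n m nm; apply: le_trans (movement_le _) _; first by rewrite leq_add2r.
  rewrite big_addn addnK; apply: ler_sum_nat => i _.
  by rewrite ler_pM2l.
Qed.

(** Subtracting the partial sums of the errors, which converge, makes the value
    nonincreasing; it is bounded below because the path stays in a compact set. *)
Lemma value_cvg : cvgn (fun n => f (y n)).
Proof.
have [N [[g1 a1] desc box1 _ _]] := path_setup ltr01 (@filterT _ \oo _).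
pose e2 n := al (n + N)%N / 2 * (1 * ga (n + N) `^ (- r)) ^+ 2.
pose S n := \sum_(0 <= k < n) e2 k.
have e20 n : 0 <= e2 n by rewrite mulr_ge0 ?sqr_ge0 ?divr_ge0 // ltW.
have cS : cvgn S.
  apply: nondecreasing_is_cvgn => [n m nm|].
    by rewrite /S (big_cat_nat _ nm) //= lerDl; apply: sumr_ge0.
  exists (2 `^ r / (r - 1) * ga (0 + N) `^ (1 - r)) => _ [n _ <-].
  apply: le_trans (@sum_steps_powRN _ (fun k => al (k + N)%N) (fun k => ga (k + N))
    _ _ r 0 n r_gt1 _ _ (leq0n n)) => //.
  - apply: ler_sum => k _; rewrite /e2 mul1r -mulrA ler_pM2l //.
    have p1 : ga (k + N) `^ (- r) <= 1.
      rewrite -[leRHS](@powRr0 R (ga (k + N))) ler_powR // oppr_le0.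
      exact: ltW (lt_trans ltr01 r_gt1).
    have := powR_ge0 (ga (k + N)) (- r); set x := powR _ _ in p1 * => x0.
    have : x * x <= x * 1 by rewrite ler_wpM2l.
    by rewrite expr2; lra.
  - by move=> k; rewrite addSn gammaS.
  - exact: lt_le_trans ltr01 (g1 0%N).
  - by move=> k _; exact: le_trans (a1 k) (g1 k).
pose u n := f (y (n + N)) - S n.
have cu : cvgn u.
  apply: nonincreasing_is_cvgn => [|].
    apply/nonincreasing_seqP => n; rewrite /u /S big_nat_recr //= -/(S n).
    have := desc n; rewrite mulrBr -/(e2 n).
    have : 0 <= al (n + N)%N / 2 * G (n + N) ^+ 2.
      by rewrite mulr_ge0 ?sqr_ge0 ?divr_ge0 // ltW.
    by lra.
  have ne : (@box R d (A + 1)) !=set0 by exists (theta 0%N); exact: theta_box1.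
  have [c _ cmin] := @EVT_min_rV R d f (box (A + 1)) ne (@box_compact R d _)
    (continuous_subspaceT f_continuous).
  have [B SB] : exists B, forall n, S n <= B.
    exists (limn S) => n; apply: nondecreasing_cvgn_le => // n' m nm.
    by rewrite /S (big_cat_nat _ nm) //= lerDl; apply: sumr_ge0.
  exists (f c - B) => _ [n _ <-]; have := SB n; have [bn _ _] := box1 n.
  by have := cmin _ (mem_set bn); rewrite /u; lra.
have : cvgn (fun n => f (y (n + N))).
  rewrite (_ : (fun n => _) = u \+ S); first exact: is_cvgD.
  by apply/funext => n /=; rewrite /u subrK.
by move=> /cvg_ex[l h]; apply/cvg_ex; exists l; rewrite -(cvg_shiftn N).
Qed.

Section level.
Variables (mu M a : R).
Hypothesis mu_gt1 : 1 < mu.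
Hypothesis mu_le2 : mu <= 2.
Hypothesis M_ge1 : 1 <= M.
Hypothesis value_to_a : f (y n) @[n --> \oo] --> a.
Hypothesis loj : \forall n \near \oo, `|f (y n) - a| <= M * G n `^ mu.

Let shift_cvg N : f (y (n + N)) - a @[n --> \oo] --> (0 : R).
Proof.
rewrite -(subrr a); apply: cvgB; last exact: cvg_cst.
by move: value_to_a; rewrite -(cvg_shiftn N).
Qed.

(** The total length is bounded by the estimate for perturbed descent, applied
    with the level [a]. *)
Lemma finite_length : exists N B,
  (forall n, \sum_(0 <= i < n) al (i + N)%N * G (i + N) <= B) /\
  (forall e, 0 < e -> exists N', forall n m, (N' <= n)%N -> (n <= m)%N ->
     enorm (y (m + N) - y (n + N)) <= e).
Proof.
have [N [[g1 a1] desc box1 _ move_le]] := path_setup ltr01 loj.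
have al' n : 0 < al (n + N)%N by [].
have ga' n : ga (n.+1 + N) = ga (n + N) + al (n + N)%N by rewrite addSn gammaS.
have lj n : `|f (y (n + N)) - a| <= M * G (n + N) `^ mu by have [] := box1 n.
have desc' n : f (y (n.+1 + N)) - a <= f (y (n + N)) - a - al (n + N)%N / 2 *
    (G (n + N) ^+ 2 - (1 * ga (n + N) `^ (- r)) ^+ 2) by have := desc n; lra.
have G0 n : 0 <= G (n + N) by exact: enorm_ge0.
pose V n := f (y (n + N)) - a + 2 * (M * (1 * ga (n + N) `^ (- r)) `^ mu).
have SG n m := @sum_gradient_le R (fun k => al (k + N)%N) (fun k => ga (k + N))
  (fun k => f (y (k + N)) - a) (fun k => G (k + N)) (fun k => 1 * ga (k + N) `^ (- r))
  V r mu M 1 al' ga' g1 a1 r_gt1 mu_gt1 mu_le2 M_ge1 ltr01 G0 (shift_cvg N)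
  (fun=> erefl) desc' lj (fun=> erefl) n m.
pose B1 := 2 * (3 * M) `^ mu^-1 / (1 - mu^-1) * V 0%N `^ (1 - mu^-1)
  + 4 * 1 * (2 `^ r / (r - 1)) * ga (0 + N) `^ (1 - r).
pose B2 := 2 `^ r / (r - 1) * ga (0 + N) `^ (1 - r).
have Sg n : \sum_(0 <= k < n) al (k + N)%N * ga (k + N) `^ (- r) <= B2.
  apply: (@sum_steps_powRN _ (fun k => al (k + N)%N) (fun k => ga (k + N))
    al' ga' r 0 n r_gt1 _ _ (leq0n n)).
    exact: lt_le_trans ltr01 (g1 0%N).
  by move=> k _; exact: le_trans (a1 k) (g1 k).
exists N, B1; split => [n|e e0]; first exact: SG.
pose b i := al (i + N)%N * (G (i + N) + 1 * ga (i + N) `^ (- r)).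
have b0 i : 0 <= b i.
  by rewrite mulr_ge0 ?(ltW (al' _)) // addr_ge0 // mul1r powR_ge0.
have bB n : \sum_(0 <= k < n) b k <= B1 + B2.
  rewrite /b (eq_bigr (fun k => al (k + N)%N * G (k + N)
     + al (k + N)%N * ga (k + N) `^ (- r))); last first.
    by move=> k _; rewrite mul1r mulrDr.
  by rewrite big_split /=; apply: lerD; [exact: SG|exact: Sg].
have [N' HN'] := small_tails b0 bB e0.
by exists N' => n m Nn nm; apply: le_trans (move_le _ _ nm) (HN' _ _ Nn nm).
Qed.

Lemma path_cvg : exists yhat : 'rV[R]_d, y n @[n --> \oo] --> yhat.
Proof.
have [N [B [_ cau]]] := finite_length.
have cj j : cvgn (fun n => y (n + N)%N 0 j).
  apply: cauchy_cvgn => e e0; have [N' HN'] := cau e e0; exists N' => n m Nn nm.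
  apply: le_trans (HN' _ _ Nn nm).
  by apply: le_trans (coord_le_enorm _ j); rewrite !mxE.
exists (\row_j limn (fun n => y (n + N)%N 0 j)).
by rewrite -(cvg_shiftn N); apply: cvg_rV => j; rewrite mxE; exact: cj.
Qed.

(** A gradient bounded away from zero for an infinite time would give the path
    infinite length. *)
Lemma grad_limit0 (yhat : 'rV[R]_d) : y n @[n --> \oo] --> yhat -> grad f yhat = 0.
Proof.
move=> yy; apply: enorm0_eq0; apply/eqP; rewrite eq_le enorm_ge0 andbT leNgt.
apply/negP => c0; set c := enorm (grad f yhat) in c0 *.
have Gc : G n @[n --> \oo] --> c.
  have c1 : {for yhat, continuous (@enorm R d \o grad f)}.
    by apply: continuous_comp; [exact: grad_continuous|exact: enorm_continuous].
  exact: (continuous_cvg _ c1 yy).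
have c2 : c / 2 < c by rewrite ltr_pdivrMr // ltr_pMr // ltr1n.
have [N1 _ HN1] := cvgr_gt _ Gc _ c2.
have [N [B [SB _]]] := finite_length.
have [n hn] := ga_unbounded (2 * B / c + ga (N1 + N)).
have Nn : (N1 + N <= n)%N.
  rewrite leqNgt; apply/negP => nN.
  have : ga n <= ga (N1 + N)%N.
    by apply: time_le => //; [exact: gammaS|exact: ltnW].
  have B0 : 0 <= B by have := SB 0%N; rewrite big_geq.
  have : 0 <= 2 * B / c by rewrite divr_ge0 ?mulr_ge0 ?(ltW c0).
  by lra.
have nE : n = (n - N + N)%N by rewrite subnK // (leq_trans _ Nn) // leq_addl.
have Nn' : (N1 <= n - N)%N by rewrite leq_subRL ?(leq_trans _ Nn) ?leq_addl // addnC.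
have := SB (n - N)%N; rewrite (big_cat_nat _ Nn') //=.
have h1 : 0 <= \sum_(0 <= i < N1) al (i + N)%N * G (i + N).
  by apply: sumr_ge0 => i _; rewrite mulr_ge0 ?enorm_ge0 // ltW.
have h2 : (ga n - ga (N1 + N)) * (c / 2)
     <= \sum_(N1 <= i < n - N) al (i + N)%N * G (i + N).
  rewrite {1}nE -(@sum_steps R (fun k => al (k + N)%N) (fun k => ga (k + N)) _ N1 (n - N)) //; last first.
    by move=> k; rewrite addSn gammaS.
  rewrite mulr_suml; apply: ler_sum_nat => i /andP[N1i _].
  have N1i' : (N1 <= i + N)%N by rewrite (leq_trans N1i) // leq_addr.
  have h := HN1 _ N1i'; rewrite ler_pM2l; last exact: al_gt0.
  exact: ltW.
move=> h3; have h4 : 2 * B / c < ga n - ga (N1 + N) by lra.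
have : 2 * B / c * (c / 2) < (ga n - ga (N1 + N)) * (c / 2).
  by rewrite ltr_pM2r // divr_gt0.
have -> : 2 * B / c * (c / 2) = B by field; rewrite gt_eqF.
by lra.
Qed.

Section rates.
Variables (m : R) (yhat : 'rV[R]_d).
Hypothesis m_ge1 : 1 <= m.
Hypothesis m_le_r : m <= r.
Hypothesis m_loj : m * (2 - mu) <= 1.
Hypothesis y_to : y n @[n --> \oo] --> yhat.

Local Notation k := (1 - mu^-1).
Local Notation T n := (ga n `^ (- (mu * m))).

Let k_gt0 : 0 < k. Proof. by rewrite subr_gt0 invf_lt1 // (lt_trans ltr01). Qed.

(** The constant [D] does not depend on [K]: where every positive [K] is
    admissible, letting it tend to 0 improves a bound [O] to [o]. *)
Lemma path_rate : exists2 D, 0 < D & forall K, 0 < K ->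
  (\forall n \near \oo, mu * m + 1 <=
     (2 * M) `^ (- (2 / mu)) / 4 * K `^ (2 / mu - 1) * ga n `^ (1 - m * (2 - mu))) ->
  \forall n \near \oo,
   [/\ enorm (grad f (theta n)) ^+ 2 <= D * K * T n,
       `|f (theta n) - a| <= D * K * T n
     & enorm (theta n - yhat) <= D * K `^ k * ga n `^ (1 - m)].
Proof.
have mu0 : 0 < mu := lt_trans ltr01 mu_gt1.
have M0 : 0 < M := lt_le_trans ltr01 M_ge1.
have exp1 : - (mu * m) * k <= 1 - m.
  have -> : - (mu * m) * k = - m * (mu - 1) by field; rewrite gt_eqF.
  by have := m_loj; lra.
have exp2 : - r <= 1 - m by have := m_le_r; lra.
pose c := 2 `^ (mu * m + 1).
have c0 : 0 < c by rewrite powR_gt0.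
pose C1 := 2 * (3 * M) `^ mu^-1 / k.
have C10 : 0 <= C1 by rewrite divr_ge0 ?(ltW k_gt0) // mulr_ge0 // powR_ge0.
pose C3 := 2 `^ r / (r - 1).
have C30 : 0 <= C3 by rewrite divr_ge0 ?powR_ge0 // subr_ge0 ltW.
pose D1 := 9 + 72 * L * c.
have D10 : 0 < D1 by have := mulr_gt0 L_gt0 c0; rewrite /D1; lra.
pose D2 := C1 * c `^ k + 5 * C3 + 1.
have D20 : 0 < D2.
  have := mulr_ge0 C10 (powR_ge0 c k); rewrite /D2; lra.
pose D := 2 * D1 + D2 + c + 3.
have D_gt0 : 0 < D by rewrite /D; lra.
have DA : 2 * D1 + 2 <= D by rewrite /D; lra.
have DB : D1 + 3 + c <= D by rewrite /D; lra.
have DC : 1 + (C1 * c `^ k + 5 * C3) <= D by rewrite /D /D2 in D20 *; lra.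
exists D => // K K0 gain.
(* The noise level, small compared with [K] in each of the three estimates. *)
pose ep := Num.min (Num.min 1 K) (Num.min (K `^ k) ((K / (4 * M)) `^ mu^-1 / 2)).
have ep0 : 0 < ep.
  by rewrite !lt_min ltr01 K0 powR_gt0 // divr_gt0 ?powR_gt0 // divr_gt0 // mulr_gt0.
have ep1 : ep <= 1 by rewrite /ep !ge_min lexx.
have epK : ep <= K by rewrite /ep !ge_min lexx orbT.
have epKk : ep <= K `^ k by rewrite /ep !ge_min lexx !orbT.
have ep_small : 4 * M * (2 * ep) `^ mu <= K.
  have : ep <= (K / (4 * M)) `^ mu^-1 / 2 by rewrite /ep !ge_min lexx !orbT.
  rewrite ler_pdivlMr // mulrC => h.
  rewrite mulrC -ler_pdivlMr ?mulr_gt0 //.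
  apply: le_trans (powR_mono (ltW mu0) _ h) _; first by rewrite mulr_ge0 // ltW.
  have KM : 0 <= K / (4 * M) by rewrite divr_ge0 ?mulr_ge0 ?(ltW M0) ?(ltW K0).
  by rewrite -powRrM mulVf ?gt_eqF // powRr1.
have [N [[g1 a1] desc box1 gth move_le]] := path_setup ep0 (filterI loj gain).
have al' n : 0 < al (n + N)%N by [].
have ga' n : ga (n.+1 + N) = ga (n + N) + al (n + N)%N by rewrite addSn gammaS.
have ga0 n : 0 < ga (n + N) := lt_le_trans ltr01 (g1 n).
pose e n := ep * ga (n + N) `^ (- r).
have e0 n : 0 < e n by rewrite mulr_gt0 // powR_gt0.
have lj n : `|f (y (n + N)) - a| <= M * G (n + N) `^ mu by have [_ _ []] := box1 n.
have gain' n : mu * m + 1 <= (2 * M) `^ (- (2 / mu)) / 4 * K `^ (2 / mu - 1)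
    * ga (n + N) `^ (1 - m * (2 - mu)) by have [_ _ []] := box1 n.
have desc' n : f (y (n.+1 + N)) - a <= f (y (n + N)) - a - al (n + N)%N / 2 *
    (G (n + N) ^+ 2 - e n ^+ 2) by have := desc n; rewrite /e; lra.
have G0 n : 0 <= G (n + N) by exact: enorm_ge0.
have ga_unb B : exists n, B < ga (n + N).
  have [n hn] := ga_unbounded B; exists n; apply: lt_le_trans hn _.
  by apply: time_le => //; [exact: gammaS|exact: leq_addr].
pose V n := f (y (n + N)) - a + 2 * (M * e n `^ mu).
have SG n m' := @sum_gradient_le R (fun k => al (k + N)%N) (fun k => ga (k + N))
  (fun k => f (y (k + N)) - a) (fun k => G (k + N)) e
  V r mu M ep al' ga' g1 a1 r_gt1 mu_gt1 mu_le2 M_ge1 ep0 G0 (shift_cvg N)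
  (fun=> erefl) desc' lj (fun=> erefl) n m'.
have Vpos n := @lifted_gt0 R (fun k => al (k + N)%N) (fun k => ga (k + N))
  (fun k => f (y (k + N)) - a) (fun k => G (k + N)) e
  V r mu M ep al' ga' g1 r_gt1 mu_gt1 M_ge1 ep0 G0 (shift_cvg N)
  (fun=> erefl) desc' lj (fun=> erefl) n.
have Vge n := @lifted_ge R (fun k => al (k + N)%N) (fun k => ga (k + N))
  (fun k => f (y (k + N)) - a) (fun k => G (k + N)) e
  V r mu M ep al' ga' g1 r_gt1 mu_gt1 M_ge1 ep0 G0 (shift_cvg N)
  (fun=> erefl) desc' lj (fun=> erefl) n.
have [N1 rate] := @lifted_rate R (fun k => al (k + N)%N) (fun k => ga (k + N))
  (fun k => f (y (k + N)) - a) (fun k => G (k + N)) e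
  V r mu M ep al' ga' g1 a1 r_gt1 mu_gt1 mu_le2 M_ge1 ep0 G0 (shift_cvg N)
  (fun=> erefl) desc' lj (fun=> erefl) ga_unb K m K0 m_ge1 m_le_r ep1 ep_small gain'.
have g_lip n m' : (n <= m')%N -> `|G (m' + N) - G (n + N)| <=
    L * \sum_(n <= i < m') al (i + N)%N * (G (i + N) + e i).
  move=> nm; apply: le_trans (ler_dist_enorm _ _) _.
  have [b1 _ _] := box1 m'; have [b2 _ _] := box1 n.
  apply: le_trans (grad_lip b1 b2) _.
  by rewrite ler_pM2l //; exact: move_le.
have Gle n := @gradient_le R (fun k => al (k + N)%N) (fun k => ga (k + N))
  (fun k => f (y (k + N)) - a) (fun k => G (k + N)) e
  V r mu M ep al' ga' g1 r_gt1 mu_gt1 M_ge1 ep0 G0 (shift_cvg N)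
  (fun=> erefl) desc' lj (fun=> erefl) ga_unb L L_gt0 g_lip n.
exists (N1 + N)%N => // n' /= Nn'.
have [n [nE Nn]] : exists n, n' = (n + N)%N /\ (N1 <= n)%N.
  have Nn2 : (N <= n')%N by apply: leq_trans Nn'; exact: leq_addl.
  by exists (n' - N)%N; rewrite subnK // leq_subRL // addnC.
rewrite {n' Nn'}nE; set g := ga (n + N).
have gp : 0 < g := ga0 n.
have g1n : 1 <= g := g1 n.
have T0 : 0 < T (n + N) by rewrite powR_gt0.
have Vn : V n <= c * K * T (n + N) := rate n Nn.
have [byn We _] := box1 n.
have en1 : e n <= ep.
  rewrite /e -[leRHS]mulr1 ler_pM2l // -[leRHS](@powRr0 R g) ler_powR // oppr_le0.
  exact: ltW (lt_trans ltr01 r_gt1).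
have e2 : e n ^+ 2 <= K * T (n + N).
  rewrite /e exprMn; apply: ler_pM; rewrite ?sqr_ge0 //.
    apply: le_trans epK; rewrite expr2 -[leRHS]mul1r ler_wpM2r //; exact: ltW.
  rewrite -[X in _ ^+ X]/(2%N) -powR_mulrn ?powR_ge0 // -powRrM ler_powR //.
  rewrite mulNr lerN2 [r * 2]mulrC; apply: ler_pM => //; first exact: ltW.
  exact: le_trans ler01 m_ge1.
have Gn : G (n + N) ^+ 2 <= D1 * (K * T (n + N)).
  apply: le_trans (Gle n) _.
  have -> : D1 * (K * T (n + N)) = 9 * (K * T (n + N)) + 72 * L * (c * K * T (n + N)).
    by rewrite /D1; ring.
  by apply: lerD; rewrite ler_pM2l ?mulr_gt0.
have KT0 : 0 < K * T (n + N) by rewrite mulr_gt0.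
have gth_n : enorm (grad f (theta (n + N))) <= G (n + N) + e n := gth n.
have Ge : (G (n + N) + e n) ^+ 2 <= 2 * G (n + N) ^+ 2 + 2 * e n ^+ 2 := sqrrD_le2 _ _.
have Wn : enorm (theta (n + N) - y (n + N)) <= e n.
  by apply: le_trans We; rewrite ler_peMl ?enorm_ge0.
have e2L : L * enorm (theta (n + N) - y (n + N)) ^+ 2 <= e n ^+ 2.
  rewrite !expr2 mulrA; apply: ler_pM; rewrite ?enorm_ge0 //.
  by rewrite mulr_ge0 ?enorm_ge0 // ltW.
have bth := theta_box1 (n + N).
have fv : `|f (y (n + N)) - a| <= c * (K * T (n + N)).
  rewrite mulrA; apply: le_trans Vn.
  have s0 : 0 <= M * e n `^ mu by rewrite mulr_ge0 ?powR_ge0 // ltW.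
  exact: norm_le_lifted s0 (Vge n).
have fd : `|f (theta (n + N)) - f (y (n + N))| <= G (n + N) ^+ 2 + 3 * e n ^+ 2.
  set w := theta (n + N) - y (n + N) in Wn e2L *.
  have E1 : y (n + N) + w = theta (n + N) by rewrite /w addrC subrK.
  have E2 : theta (n + N) + (- w) = y (n + N) by rewrite /w opprB addrC subrK.
  have up : f (y (n + N) + w) <=
      f (y (n + N)) + dot (grad f (y (n + N))) w + L * enorm w ^+ 2.
    apply: (descent_inequality f_diff grad_lip (ltW L_gt0)) => t t01.
    by apply: box_convex => //; rewrite E1.
  have dn : f (theta (n + N) + (- w)) <=
      f (theta (n + N)) + dot (grad f (theta (n + N))) (- w) + L * enorm (- w) ^+ 2.
    apply: (descent_inequality f_diff grad_lip (ltW L_gt0)) => t t01.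
    by apply: box_convex => //; rewrite E2.
  rewrite E1 in up; rewrite E2 enormN in dn.
  have d1 := dot_le_enorm (grad f (y (n + N))) w.
  have d2 := dot_le_enorm (grad f (theta (n + N))) (- w); rewrite enormN in d2.
  have q1 : enorm (grad f (y (n + N))) * enorm w <= G (n + N) * e n.
    by rewrite ler_wpM2l ?enorm_ge0.
  have q2 : enorm (grad f (theta (n + N))) * enorm w <= (G (n + N) + e n) * e n.
    by apply: ler_pM; rewrite ?enorm_ge0.
  rewrite mulrDl -expr2 in q2.
  exact: (two_sided_bound up dn (le_trans d1 q1) (le_trans d2 q2) e2L
    (mulr_le_sqrD _ _) (sqr_ge0 _)).
have Tk : T (n + N) `^ k <= g `^ (1 - m).
  by rewrite -powRrM ler_powR.
have r1m : g `^ (1 - r) <= g `^ (1 - m) by rewrite ler_powR // lerD2l lerN2.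
have rm : g `^ (- r) <= g `^ (1 - m).
  by rewrite ler_powR.
have p0 : 0 <= g `^ (1 - m) := powR_ge0 _ _.
have Kk0 : 0 <= K `^ k := powR_ge0 _ _.
have ydist : enorm (y (n + N) - yhat) <= (C1 * c `^ k + 5 * C3) * K `^ k * g `^ (1 - m).
  have fin j : (n <= j)%N -> enorm (y (n + N) - y (j + N)) <=
      (C1 * c `^ k + 5 * C3) * K `^ k * g `^ (1 - m).
    move=> nj; rewrite enormB; apply: le_trans (move_le _ _ nj) _.
    rewrite (eq_bigr (fun i => al (i + N)%N * G (i + N)
       + ep * (al (i + N)%N * ga (i + N) `^ (- r)))); last first.
      by move=> i _; rewrite mulrDr; congr (_ + _); ring.
    rewrite big_split /= -mulr_sumr.
    have s1 := SG n j nj.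
    have s2 : \sum_(n <= i < j) al (i + N)%N * ga (i + N) `^ (- r) <= C3 * g `^ (1 - r).
      apply: (@sum_steps_powRN _ (fun k => al (k + N)%N) (fun k => ga (k + N))
        al' ga' r n j r_gt1 gp _ nj).
      by move=> i _; exact: le_trans (a1 i) (g1 i).
    have s3 : V n `^ k <= c `^ k * K `^ k * g `^ (1 - m).
      apply: le_trans (powR_mono (ltW k_gt0) (ltW (Vpos n)) Vn) _.
      rewrite !powRM ?mulr_ge0 ?powR_ge0 ?(ltW c0) ?(ltW K0) //.
      by rewrite ler_wpM2l // mulr_ge0 ?powR_ge0.
    have s4 : C1 * V n `^ k <= C1 * (c `^ k * K `^ k * g `^ (1 - m)).
      by rewrite ler_wpM2l.
    have s5 : ep * (C3 * g `^ (1 - r)) <= K `^ k * (C3 * g `^ (1 - m)).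
      apply: ler_pM; [exact: ltW|exact: (mulr_ge0 C30 (powR_ge0 _ _))|exact: epKk|].
      exact: ler_wpM2l.
    have s6 : ep * \sum_(n <= i < j) al (i + N)%N * ga (i + N) `^ (- r)
        <= ep * (C3 * g `^ (1 - r)) by rewrite ler_pM2l.
    exact: (five_terms_bound s1 s6 s4 s5).
  have cv : enorm (y (n + N) - y (j + N)) @[j --> \oo] --> enorm (y (n + N) - yhat).
    have c1 : y (n + N) - y (j + N) @[j --> \oo] --> y (n + N) - yhat.
      by apply: cvgB; [exact: cvg_cst|rewrite cvg_shiftn].
    exact: (continuous_cvg _ (@enorm_continuous R d _) c1).
  rewrite -(cvg_lim _ cv) //; apply: limr_le.
    by apply/cvg_ex; eexists; exact: cv.
  by exists n => // j /= nj; exact: fin.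
split.
- apply: (@le_trans _ _ ((G (n + N) + e n) ^+ 2)).
    rewrite lerXn2r ?nnegrE ?enorm_ge0 // addr_ge0 //; exact: ltW.
  apply: le_trans Ge _; rewrite -mulrA.
  apply: (@le_trans _ _ ((2 * D1 + 2) * (K * T (n + N)))); last by rewrite ler_pM2r.
  rewrite [leRHS]mulrDl; apply: lerD; last by rewrite ler_pM2l.
  by rewrite -[leRHS]mulrA ler_pM2l.
- have -> : f (theta (n + N)) - a = (f (theta (n + N)) - f (y (n + N)))
      + (f (y (n + N)) - a) by rewrite addrA subrK.
  apply: le_trans (ler_normD _ _) _; rewrite -mulrA.
  apply: (@le_trans _ _ ((D1 + 3 + c) * (K * T (n + N)))); last by rewrite ler_pM2r.
  rewrite [leRHS]mulrDl; apply: lerD => //; rewrite [leRHS]mulrDl; apply: le_trans fd _; apply: lerD => //.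
  by rewrite ler_pM2l.
- apply: le_trans (ler_enormB _ (y (n + N)) _) _.
  have h1 : enorm (theta (n + N) - y (n + N)) <= 1 * K `^ k * g `^ (1 - m).
    rewrite mul1r; apply: le_trans Wn _.
    exact: (ler_pM (ltW ep0) (powR_ge0 _ _) epKk rm).
  rewrite -/g; apply: le_trans (lerD h1 ydist) _.
  by rewrite -[leLHS]mulrDl -mulrDl; do 2 apply: ler_wpM2r => //.
Qed.

End rates.
End level.
End lipschitz.
End gradient_path.

(** * Convergence and rates along one path *)

Section one_path.
Context {R : realType} {d : nat} (al : nat -> R) (r : R) (f : 'rV[R]_d -> R).
Context (theta xi : nat -> 'rV[R]_d) (A : R).
Hypothesis al_gt0 : forall n, 0 < al n.
Hypothesis al_cvg0 : al n @[n --> \oo] --> (0 : R).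
Hypothesis ga_unbounded : forall B, exists n, B < gamma al n.
Hypothesis r_gt1 : 1 < r.
Hypothesis f_diff : forall x, differentiable f x.
Hypothesis f_lip : [locally [lipschitz (grad f) x | x in setT]].
Hypothesis theta_box : forall n, box A (theta n).
Hypothesis thetaS :
  forall n, theta n.+1 = theta n - al n *: (grad f (theta n) + xi n).
Hypothesis xi_sum : forall i, cvgn (fun n =>
  \sum_(0 <= k < n) gamma al k `^ r * (al k * xi k 0 i)).
Hypothesis f_loj : forall (Q : set 'rV[R]_d) (a : R), compact Q -> (f @` Q) a ->
   exists delta mu M : R,
     [/\ 0 < delta <= 1, 1 < mu <= 2, 1 <= M
       & forall x, Q x -> `|f x - a| <= delta ->
           `|f x - a| <= M * enorm (grad f x) `^ mu].

Local Notation ga := (gamma al).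

(** Removing the tail of the noise series from [theta] leaves a gradient
    descent whose gradient is read at a nearby point. *)
Lemma noise_free_path : exists y : nat -> 'rV[R]_d,
  (forall n, y n.+1 = y n - al n *: grad f (theta n)) /\
  (forall e : R, 0 < e -> \forall n \near \oo,
     enorm (theta n - y n) <= e * ga n `^ (- r)).
Proof.
have gS n : ga n.+1 = ga n + al n := gammaS al n.
have g0 n : 0 <= ga n.
  have -> : 0 = ga 0%N by rewrite /gamma big_geq.
  exact: time_le.
have gp n : (0 < n)%N -> 0 < ga n.
  by case: n => // n _; rewrite gS ltr_wpDl.
have w0 n : (0 < n)%N -> 0 < ga n `^ r by move=> /gp gn; rewrite powR_gt0.
have wmono : {homo (fun n => ga n `^ r) : n m / (n <= m)%N >-> n <= m}.
  move=> n m nm; apply: powR_mono => //; first exact: ltW (lt_trans ltr01 r_gt1).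
  exact: time_le.
have ex (i : 'I_d) := weighted_tail (x := fun k => al k * xi k 0 i) w0 wmono (@xi_sum i).
have /choice[s Hs] := ex.
pose W n := \row_i s i - \sum_(0 <= k < n) al k *: xi k.
exists (fun n => theta n - W n); split=> [n|e e0].
  rewrite thetaS /W big_nat_recr //= scalerDr.
  by apply/rowP => j; rewrite !mxE; ring.
have dp : 0 < d%:R + 1 :> R by rewrite ltr_wpDl.
have : \forall n \near \oo, forall i,
    `|s i - \sum_(0 <= k < n) al k * xi k 0 i| <= e / (d%:R + 1) / ga n `^ r.
  by apply: filter_forall => i; apply: Hs; rewrite divr_gt0.
apply: filterS => n Hn; rewrite opprB addrC subrK.
apply: le_trans (enorm_le_sum _) _.
apply: (@le_trans _ _ (\sum_(i < d) e / (d%:R + 1) * ga n `^ (- r))).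
  apply: ler_sum => i _; rewrite powRN; apply: le_trans (Hn i).
  rewrite /W !mxE summxE le_eqVlt; apply/orP; left; apply/eqP; congr (`|_ - _|).
  by apply: eq_bigr => k _; rewrite mxE.
rewrite sumr_const card_ord -[leLHS]mulr_natl mulrA ler_wpM2r ?powR_ge0 //.
by rewrite mulrCA ler_piMr ?(ltW e0) // ler_pdivrMr // mul1r lerDl.
Qed.

Context (delta mu M : 'rV[R]_d -> R).
Hypothesis loj_at : forall x,
  [/\ 0 < delta x <= 1, 1 < mu x <= 2, 1 <= M x
    & forall x', enorm (x' - x) <= delta x ->
        `|f x' - f x| <= M x * enorm (grad f x') `^ mu x].

(** The gradient inequality is used twice.  At the limit [a] of the values it holds
    on a whole compact set, which makes the path converge; once the limit point
    is known, its own exponent governs the rate. *)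
Lemma path_limit : exists thetahat : 'rV[R]_d,
  [/\ theta n @[n --> \oo] --> thetahat, grad f thetahat = 0 &
   forall m, 1 <= m -> m <= r -> m * (2 - mu thetahat) <= 1 ->
   exists2 D, 0 < D & forall K, 0 < K ->
    (\forall n \near \oo, mu thetahat * m + 1 <=
     (2 * M thetahat) `^ (- (2 / mu thetahat)) / 4 * K `^ (2 / mu thetahat - 1)
       * ga n `^ (1 - m * (2 - mu thetahat))) ->
    \forall n \near \oo,
   [/\ enorm (grad f (theta n)) ^+ 2 <= D * K * ga n `^ (- (mu thetahat * m)),
       `|f (theta n) - f thetahat| <= D * K * ga n `^ (- (mu thetahat * m))
     & enorm (theta n - thetahat) <= D * K `^ (1 - (mu thetahat)^-1) * ga n `^ (1 - m)]].
Proof.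
have [y [yS noise]] := noise_free_path.
have [L L1 HL] := lipschitz_constant A f_lip.
have small ep (ep0 : 0 < ep) := eventually_small al_gt0 al_cvg0 ga_unbounded
  r_gt1 theta_box noise L1 ep0.
have /cvg_ex[a fa] := value_cvg al_gt0 al_cvg0 ga_unbounded r_gt1 f_diff
  theta_box yS noise L1 HL.
have cf : continuous f := f_continuous f_diff.
have cb : compact (@box R d (A + 1)) by exact: box_compact.
have ybox : \forall n \near \oo, box (A + 1) (y n).
  by apply: filterS (small 1 ltr01) => n [].
have Qa : (f @` (@box R d (A + 1))) a.
  have clo : closed (f @` (@box R d (A + 1))).
    apply: compact_closed; first exact: norm_hausdorff.
    exact: continuous_compact (continuous_subspaceT cf) cb.
  apply: (@closed_cvg _ _ _ _ (fun n => f (y n)) _ clo _ a fa).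
  by apply: filterS ybox => n; exists (y n).
have [dl [m0 [M0 [/andP[dl0 _] /andP[m01 m02] M01 lj]]]] := f_loj cb Qa.
have lj0 : \forall n \near \oo, `|f (y n) - a| <= M0 * enorm (grad f (y n)) `^ m0.
  have /cvgr_dist_le /(_ _ dl0) near_a := fa.
  apply: filterS2 ybox near_a => n bn na; apply: lj => //.
  by rewrite distrC.
have [yhat yto] := path_cvg al_gt0 al_cvg0 ga_unbounded r_gt1 f_diff
  theta_box yS noise L1 HL m01 m02 M01 fa lj0.
have g0 := grad_limit0 al_gt0 al_cvg0 ga_unbounded r_gt1 f_diff f_lip
  theta_box yS noise L1 HL m01 m02 M01 fa lj0 yto.
exists yhat; split => //.
  apply: cvg_enorm => e e0; have e2 : 0 < e / 2 by rewrite divr_gt0.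
  apply: filterS3 (cvg_enorm_dist e2 yto) (noise _ e2) (small 1 ltr01).
  move=> n h1 h2 [g1 _ _ _ _]; rewrite enormB.
  apply: le_trans (ler_enormB _ (y n) _) _.
  have h3 : e / 2 * ga n `^ (- r) <= e / 2.
    rewrite ler_piMr ?(ltW e2) // -[leRHS](@powRr0 R (ga n)) ler_powR // oppr_le0.
    exact: ltW (lt_trans ltr01 r_gt1).
  by have := le_trans h2 h3; lra.
have [/andP[d0 _] /andP[mu1 mu2] M1 ljh] := loj_at yhat.
have fyhat : f (y n) @[n --> \oo] --> f yhat by exact: (continuous_cvg _ (cf yhat) yto).
have ljh' : \forall n \near \oo,
    `|f (y n) - f yhat| <= M yhat * enorm (grad f (y n)) `^ mu yhat.
  by apply: filterS (cvg_enorm_dist d0 yto) => n; exact: ljh.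
move=> m m1 mr mmu.
exact: (path_rate al_gt0 al_cvg0 ga_unbounded r_gt1 f_diff theta_box yS noise
  L1 HL mu1 mu2 M1 fyhat ljh' m1 mr mmu yto).
Qed.

Lemma gamma_powR_large t C : 0 < t -> \forall n \near \oo, C <= ga n `^ t.
Proof.
move=> t0; have := gamma_near al_gt0 ga_unbounded (Num.max C 0 `^ t^-1).
apply: filterS => n h.
have C0 : 0 <= Num.max C 0 by rewrite le_max lexx orbT.
apply: (@le_trans _ _ (Num.max C 0)); first by rewrite le_max lexx.
rewrite -(@powRr1 R (Num.max C 0)) // -(mulVf (lt0r_neq0 t0)) powRrM.
by apply: powR_mono => //; [exact: ltW|exact: powR_ge0].
Qed.

Lemma littleo_gamma (u : nat -> R) s : (forall n, 0 <= u n) ->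
  (forall e, 0 < e -> \forall n \near \oo, u n <= e * ga n `^ s) ->
  u =o_\oo (fun n => ga n `^ s).
Proof.
move=> u0 H; apply/eqoP => e e0; apply: filterS (H e e0) => n.
by rewrite !ger0_norm ?powR_ge0.
Qed.

Lemma bigO_gamma (u : nat -> R) s C : (forall n, 0 <= u n) -> 0 < C ->
  (\forall n \near \oo, u n <= C * ga n `^ s) -> u =O_\oo (fun n => ga n `^ s).
Proof.
move=> u0 C0 H; apply/eqO_exP; exists C => //; apply: filterS H => n.
by rewrite !ger0_norm ?powR_ge0.
Qed.

Lemma littleo_gammaW (u : nat -> R) s t C : (forall n, 0 <= u n) -> s < t -> 0 < C ->
  (\forall n \near \oo, u n <= C * ga n `^ s) -> u =o_\oo (fun n => ga n `^ t).
Proof.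
move=> u0 st C0 H; apply: littleo_gamma => // e e0.
have ts : 0 < t - s by rewrite subr_gt0.
apply: filterS3 H (gamma_powR_large (C / e) ts) (gamma_near al_gt0 ga_unbounded 1).
move=> n h1 h2 g1; apply: le_trans h1 _.
have gn : 0 < ga n := lt_le_trans ltr01 g1.
have -> : ga n `^ t = ga n `^ (t - s) * ga n `^ s.
  by rewrite -powRD ?subrK // (gt_eqF gn) implybT.
rewrite mulrA ler_wpM2r ?powR_ge0 //.
by move: h2; rewrite ler_pdivrMr // mulrC.
Qed.

(** The two regimes differ in the admissible constants [K]: an arbitrarily small one
    when the noise limits the rate, a fixed one when the exponent at the limit
    does.  In both, the exponent of the bound exceeds 1, whence the last claim. *)
Lemma path_conclusion :
  let thetahat := limn theta in
  let rhat := loj_r (mu thetahat) in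
  let phat := loj_p r (mu thetahat) in
  let qhat := loj_q r (mu thetahat) in
  [/\ cvgn theta /\ grad f thetahat = 0,
      (r%:E < rhat)%E ->
         [/\ (fun n => enorm (grad f (theta n)) ^+ 2)
               =o_\oo (fun n => ga n `^ (- phat)),
             (fun n => `|f (theta n) - f thetahat|)
               =o_\oo (fun n => ga n `^ (- phat))
           & (fun n => enorm (theta n - thetahat))
               =o_\oo (fun n => ga n `^ (- qhat))],
      (rhat <= r%:E)%E ->
         [/\ (fun n => enorm (grad f (theta n)) ^+ 2)
               =O_\oo (fun n => ga n `^ (- phat)),
             (fun n => `|f (theta n) - f thetahat|)
               =O_\oo (fun n => ga n `^ (- phat))
           & (fun n => enorm (theta n - thetahat))
               =O_\oo (fun n => ga n `^ (- qhat))]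
    & (fun n => enorm (grad f (theta n)) ^+ 2)
           =o_\oo (fun n => ga n `^ (- Num.min 1 r)) /\
      (fun n => `|f (theta n) - f thetahat|)
           =o_\oo (fun n => ga n `^ (- Num.min 1 r))].
Proof.
have [th [thto gth rate]] := path_limit.
have lth : limn theta = th by apply: cvg_lim => //; exact: norm_hausdorff.
rewrite /= lth; have [_ /andP[mu1 mu2] M1 _] := loj_at th.
have M0 : 0 < M th := lt_le_trans ltr01 M1.
have mu0 : 0 < mu th := lt_trans ltr01 mu1.
have k0 : 0 < 1 - (mu th)^-1 by rewrite subr_gt0 invf_lt1.
have sq0 n : 0 <= enorm (grad f (theta n)) ^+ 2 by exact: sqr_ge0.
have en0 n : 0 <= enorm (theta n - th) by exact: enorm_ge0.
have -> : Num.min 1 r = 1 by rewrite min_l // ltW.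
have cstO : 0 < (2 * M th) `^ (- (2 / mu th)) / 4.
  by rewrite divr_gt0 // powR_gt0 // mulr_gt0.
set c0 := (2 * M th) `^ _ / 4 in rate cstO.
have [rlt|rge] := ltP r%:E (loj_r (mu th)).
  (* The Lojasiewicz exponent does not limit the rate: any factor K > 0 is
     eventually admissible. *)
  have mE : fine (Order.min r%:E (loj_r (mu th))) = r by rewrite min_l // ltW.
  rewrite /loj_p /loj_q mE.
  have rmu : r * (2 - mu th) < 1.
    move: rlt; rewrite /loj_r; case: (ltP (mu th) 2) => [mlt2|mge2] => rlt; last first.
      have -> : mu th = 2 by apply/eqP; rewrite eq_le mu2.
      by rewrite subrr mulr0.
    have t2 : 0 < 2 - mu th by rewrite subr_gt0.
    by move: rlt; rewrite lte_fin -[_^-1]div1r ltr_pdivlMr.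
  have [D D0 HD] := rate r (ltW r_gt1) (lexx r) (ltW rmu).

  have gain K : 0 < K -> \forall n \near \oo, mu th * r + 1 <=
      c0 * K `^ (2 / mu th - 1) * ga n `^ (1 - r * (2 - mu th)).
    move=> K0; have t0 : 0 < 1 - r * (2 - mu th) by rewrite subr_gt0.
    have q0 : 0 < c0 * K `^ (2 / mu th - 1) by rewrite mulr_gt0 // powR_gt0.
    apply: filterS (gamma_powR_large ((mu th * r + 1) / (c0 * K `^ (2 / mu th - 1))) t0).
    by move=> n; rewrite ler_pdivrMr // [X in _ <= X -> _]mulrC.
  have HDK K (K0 : 0 < K) := HD K K0 (gain K K0).
  have main e : 0 < e -> \forall n \near \oo,
      [/\ enorm (grad f (theta n)) ^+ 2 <= e * ga n `^ (- (mu th * r)),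
          `|f (theta n) - f th| <= e * ga n `^ (- (mu th * r))
        & enorm (theta n - th) <= e * ga n `^ (1 - r)].
    move=> e0; pose K := Num.min (e / D) ((e / D) `^ (1 - (mu th)^-1)^-1).
    have K0 : 0 < K by rewrite lt_min divr_gt0 // powR_gt0 // divr_gt0.
    have K1 : D * K <= e.
      by rewrite mulrC -ler_pdivlMr // /K ge_min lexx.
    have K2 : D * K `^ (1 - (mu th)^-1) <= e.
      rewrite mulrC -ler_pdivlMr //.
      have : K <= (e / D) `^ (1 - (mu th)^-1)^-1 by rewrite /K ge_min lexx orbT.
      move=> /(powR_mono (ltW k0) (ltW K0)) h; apply: le_trans h _.
      by rewrite -powRrM mulVf ?gt_eqF // powRr1 // divr_ge0 // ltW.
    apply: filterS (HDK K K0) => n [h1 h2 h3]; split.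
    - by apply: le_trans h1 _; rewrite ler_wpM2r ?powR_ge0.
    - by apply: le_trans h2 _; rewrite ler_wpM2r ?powR_ge0.
    - by apply: le_trans h3 _; rewrite ler_wpM2r ?powR_ge0.
  have pr : - (mu th * r) < - 1.
    by rewrite ltrN2 (lt_trans r_gt1) // ltr_pMl // (lt_trans ltr01).
  have m1 : \forall n \near \oo,
      enorm (grad f (theta n)) ^+ 2 <= 1 * ga n `^ (- (mu th * r)).
    by apply: filterS (main 1 ltr01) => n [].
  have m2 : \forall n \near \oo,
      `|f (theta n) - f th| <= 1 * ga n `^ (- (mu th * r)).
    by apply: filterS (main 1 ltr01) => n [].
  split.
  - by split => //; apply/cvg_ex; exists th.
  - move=> _; split.
    + by apply: littleo_gamma => // e /main; apply: filterS => n [].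
    + by apply: littleo_gamma => // e /main; apply: filterS => n [].
    + rewrite opprB; apply: littleo_gamma => // e /main; apply: filterS => n [].
      by [].
  - by [].
  - split; first exact: littleo_gammaW sq0 pr ltr01 m1.
    exact: littleo_gammaW (fun=> normr_ge0 _) pr ltr01 m2.
have mlt2 : mu th < 2.
  by move: rge; rewrite /loj_r; case: (ltP (mu th) 2) => // _; rewrite leye_eq.
move: rge; rewrite /loj_r mlt2 lee_fin => rge.
pose m := (2 - mu th)^-1; rewrite -/m in rge.
have t2 : 0 < 2 - mu th by rewrite subr_gt0.
have mmu : m * (2 - mu th) = 1 by rewrite /m mulVf // gt_eqF.
have m1 : 1 <= m by rewrite invf_ge1 //; lra.
have mE : fine (Order.min r%:E (loj_r (mu th))) = m.
  by rewrite /loj_r mlt2 min_r.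
rewrite /loj_p /loj_q mE.
have mmu1 : m * (2 - mu th) <= 1 by rewrite mmu.
have [D D0 HD] := rate m m1 rge mmu1.
have x0 : 0 < 2 / mu th - 1 by rewrite subr_gt0 ltr_pdivlMr // mul1r.
have z0 : 0 < mu th * m + 1 by rewrite addr_gt0 // mulr_gt0 // (lt_le_trans ltr01).
pose K := ((mu th * m + 1) / c0) `^ (2 / mu th - 1)^-1.
have K0 : 0 < K by rewrite powR_gt0 // divr_gt0.
have gain : \forall n \near \oo, mu th * m + 1 <=
      c0 * K `^ (2 / mu th - 1) * ga n `^ (1 - m * (2 - mu th)).
  near=> n; rewrite mmu subrr powRr0 mulr1 /K -powRrM mulVf ?gt_eqF //.
  rewrite powRr1 ?(ltW (divr_gt0 z0 cstO)) //.
  by rewrite [c0 * _]mulrC divfK // gt_eqF.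
have main := HD K K0 gain.
have DK : 0 < D * K by rewrite mulr_gt0.
have DKk : 0 < D * K `^ (1 - (mu th)^-1) by rewrite mulr_gt0 // powR_gt0.
have b1 : \forall n \near \oo,
    enorm (grad f (theta n)) ^+ 2 <= D * K * ga n `^ (- (mu th * m)).
  by apply: filterS main => n [].
have b2 : \forall n \near \oo,
    `|f (theta n) - f th| <= D * K * ga n `^ (- (mu th * m)).
  by apply: filterS main => n [].
have b3 : \forall n \near \oo,
    enorm (theta n - th) <= D * K `^ (1 - (mu th)^-1) * ga n `^ (1 - m).
  by apply: filterS main => n [].
have pr : - (mu th * m) < - 1.
  by rewrite ltrN2 (lt_le_trans mu1) // ler_peMr // ltW.
split.
- by split => //; apply/cvg_ex; exists th.
- by [].
- move=> _; split.
  + exact: bigO_gamma sq0 DK b1.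
  + exact: bigO_gamma (fun=> normr_ge0 _) DK b2.
  + by rewrite opprB; exact: bigO_gamma en0 DKk b3.
- split; first exact: littleo_gammaW sq0 pr DK b1.
  exact: littleo_gammaW (fun=> normr_ge0 _) pr DK b2.
Unshelve. all: by end_near. Qed.

End one_path.

(** * Step sizes and weights *)

Section steps.
Context {R : realType} (al : nat -> R) (r : R).
Hypothesis al_gt0 : forall n, 0 < al n.
Hypothesis al_cvg0 : al n @[n --> \oo] --> (0 : R).
Hypothesis al_inv : (limn_esup
     (fun n => `|(al n.+1)^-1 - (al n)^-1|%:E) < +oo)%E.
Hypothesis al_sum : (\sum_(0 <= n <oo) (al n)%:E = +oo)%E.
Hypothesis r_gt1 : 1 < r.
Hypothesis al_sq : (\sum_(0 <= n <oo)
     (al n ^+ 2 * gamma al n `^ (2 * r))%:E < +oo)%E.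

Local Notation ga := (gamma al).

Lemma nneseries_bounded (u : nat -> R) : (forall n, 0 <= u n) ->
  (\sum_(0 <= n <oo) (u n)%:E < +oo)%E ->
  exists B, forall n, \sum_(0 <= k < n) u k <= B.
Proof.
move=> u0 h; exists (fine (\sum_(0 <= n <oo) (u n)%:E)) => n.
have ge0 : (0 <= \sum_(0 <= n <oo) (u n)%:E)%E.
  by apply: nneseries_ge0 => k _ _; rewrite lee_fin.
rewrite -lee_fin fineK ?ge0_fin_numE //.
rewrite -sumEFin; apply: nneseries_lim_ge => k _ _.
by rewrite lee_fin.
Qed.

Lemma gamma_unbounded B : exists n, B < ga n.
Proof.
apply: contrapT => H.
have Bn n : ga n <= B by rewrite leNgt; apply/negP => h; apply: H; exists n.
have : (\sum_(0 <= n <oo) (al n)%:E <= B%:E)%E.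
  apply: lime_le; first by apply: is_cvg_nneseries => k _ _; rewrite lee_fin ltW.
  by near=> n; rewrite sumEFin lee_fin; exact: Bn.
by rewrite al_sum leye_eq.
Unshelve. all: by end_near. Qed.

Lemma inverse_increments : exists C, 0 < C /\
  \forall n \near \oo, `|(al n.+1)^-1 - (al n)^-1| <= C.
Proof.
have [_ [A [N _ NA] <-] Alt] := ereal_inf_lt al_inv.
set s := ereal_sup _ in Alt.
have us n : (N <= n)%N -> (`|(al n.+1)^-1 - (al n)^-1|%:E <= s)%E.
  by move=> Nn; apply: ereal_sup_ubound; exists n => //; exact: NA.
case: s Alt us => [s| |] // _ us; last first.
  by have := us N (leqnn N); rewrite leeNy_eq.
exists (Num.max s 1); split; first by rewrite lt_max ltr01 orbT.
by exists N => // n /us; rewrite lee_fin le_max => ->.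
Qed.

Definition weight n : R := al n * ga n `^ r.

(** The weights by which second moments of the noise enter: Hoelder continuity
    with exponent 2/3, Abel summation, and martingale increments. *)
Definition moment_weight n : R :=
  weight n * al n.-1 `^ (2 / 3) + `|weight n - weight n.-1| + weight n ^+ 2.

Lemma weight_ge0 n : 0 <= weight n.
Proof. by rewrite mulr_ge0 ?powR_ge0 // ltW. Qed.

Lemma moment_weight_ge0 n : 0 <= moment_weight n.
Proof.
apply: addr_ge0; last exact: sqr_ge0.
by apply: addr_ge0 => //; exact: mulr_ge0 (weight_ge0 n) (powR_ge0 _ _).
Qed.

Lemma sqr_weight n : weight n ^+ 2 = al n ^+ 2 * ga n `^ (2 * r).
Proof.
by rewrite exprMn; congr (_ * _); rewrite [2 * r]mulrC powRrM powR_mulrn ?powR_ge0.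
Qed.

(** Where [alpha] exceeds [gamma ^ (- 3 r)] the first term dominates, elsewhere
    the second one does. *)
Lemma holder_weight_le a g : 0 < a -> 1 <= g ->
  a `^ (2 / 3) * (a * g `^ r) <= a ^+ 2 * g `^ (2 * r) + a * g `^ (- r).
Proof.
move=> a0 g1; have g0 : 0 < g := lt_le_trans ltr01 g1.
have -> : g `^ (2 * r) = g `^ r ^+ 2.
  by rewrite [2 * r]mulrC powRrM powR_mulrn ?powR_ge0.
rewrite powRN; have x0 : 0 < g `^ r by rewrite powR_gt0.
set x := g `^ r in x0 *.
have [t [t0 ->]] : exists t, 0 < t /\ a = t ^+ 3.
  exists (a `^ 3^-1); rewrite powR_gt0 //; split => //.
  by rewrite -powR_mulrn ?powR_ge0 // -powRrM mulVf // powRr1 // ltW.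
have -> : (t ^+ 3) `^ (2 / 3) = t ^+ 2.
  rewrite -[t ^+ 3]powR_mulrn ?(ltW t0) // -powRrM mulrC divfK //.
  by rewrite powR_mulrn // ltW.
have t3 : 0 < t ^+ 3 by rewrite exprn_gt0.
have [tx|tx] := leP 1 (t * x).
  have h : t ^+ 2 * (t ^+ 3 * x) <= (t ^+ 3) ^+ 2 * x ^+ 2.
    have -> : (t ^+ 3) ^+ 2 * x ^+ 2 = t ^+ 2 * (t ^+ 3 * x) * (t * x) by ring.
    by rewrite ler_peMr // mulr_ge0 ?sqr_ge0 // mulr_ge0 // ltW.
  by apply: le_trans h _; rewrite lerDl divr_ge0 // ltW.
have h : t ^+ 2 * (t ^+ 3 * x) <= t ^+ 3 / x.
  rewrite ler_pdivlMr //.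
  have -> : t ^+ 2 * (t ^+ 3 * x) * x = t ^+ 3 * (t * x) ^+ 2 by ring.
  by rewrite ler_piMr ?(ltW t3) // expr_le1 ?(ltW tx) // mulr_ge0 // ltW.
by apply: le_trans h _; rewrite lerDr mulr_ge0 ?sqr_ge0.
Qed.

(** The bound on the increments of [al^-1] makes two successive weights differ by
    [O(al ^+ 2 * ga `^ r)].  With the splitting of the Hoelder term, everything is
    dominated by the two summable series [al ^+ 2 * ga `^ (2 * r)] and
    [al * ga `^ (- r)]. *)
Lemma moment_weight_sum : exists B, forall n, \sum_(0 <= k < n) moment_weight k <= B.
Proof.
have [C [C0 HC]] := inverse_increments.
have /cvgr_dist_le /(_ _ ltr01) a1 := al_cvg0.
have C2 : 0 < (2 * C)^-1 by rewrite invr_gt0 mulr_gt0.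
have /cvgr_dist_le /(_ _ C2) a2 := al_cvg0.
have [N _ HN] := filterI HC (filterI a1 (filterI a2 (gamma_near al_gt0 gamma_unbounded 1))).
have {}HN n : (N <= n)%N -> [/\ `|(al n.+1)^-1 - (al n)^-1| <= C, al n <= 1,
    al n <= (2 * C)^-1 & 1 <= ga n].
  move=> /HN [h1 [h2 [h3 h4]]]; split => //.
    by move: h2; rewrite sub0r normrN gtr0_norm.
  by move: h3; rewrite sub0r normrN gtr0_norm.
have sq0 n : 0 <= al n ^+ 2 * ga n `^ (2 * r) by rewrite mulr_ge0 ?sqr_ge0 ?powR_ge0.
have [B1 HB1] := nneseries_bounded sq0 al_sq.
pose K := 2 `^ (1 + r) + (2 * C + r) * 2 `^ r.
have r0 : 0 <= r := ltW (lt_trans ltr01 r_gt1).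
have K0 : 0 <= K by rewrite /K addr_ge0 ?powR_ge0 // mulr_ge0 ?powR_ge0 // addr_ge0 // mulr_ge0 // ltW.
have step n : (N <= n)%N -> moment_weight n.+1 <=
    K * (al n ^+ 2 * ga n `^ (2 * r) + al n * ga n `^ (- r)) + weight n.+1 ^+ 2.
  move=> Nn; have [hC h1 hh g1] := HN n Nn.
  have an := al_gt0 n; have an1 := al_gt0 n.+1.
  have gn : 0 < ga n := lt_le_trans ltr01 g1.
  rewrite /moment_weight lerD2r /=.
  have gS : ga n.+1 = ga n + al n := gammaS al n.
  have gle : ga n <= ga n.+1 by rewrite gS lerDl ltW.
  have g2 : ga n.+1 `^ r <= 2 `^ r * ga n `^ r.
    rewrite -powRM ?(ltW gn) //; apply: powR_mono => //; first exact: le_trans (ltW gn) gle.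
    by rewrite gS mulr_natl mulr2n lerD2l (le_trans h1).
  have adiff : `|al n.+1 - al n| <= C * (al n * al n.+1).
    have -> : al n.+1 - al n = - ((al n.+1)^-1 - (al n)^-1) * (al n * al n.+1).
      by field; rewrite !gt_eqF.
    rewrite normrM normrN (gtr0_norm (mulr_gt0 an an1)).
    by rewrite ler_wpM2r // mulr_ge0 // ltW.
  have a2n : al n.+1 <= 2 * al n.
    have : C * (al n * al n.+1) <= al n.+1 / 2.
      have : C * al n <= C * (2 * C)^-1 by rewrite ler_pM2l.
      have -> : C * (2 * C)^-1 = 2^-1 by field; rewrite gt_eqF.
      by move=> h; rewrite mulrA mulrC ler_pM2l.
    by have := le_trans (ler_norm _) adiff; lra.
  set x := ga n `^ r in g2 *.
  have x0 : 0 < x by rewrite powR_gt0.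
  have x2E : ga n `^ (2 * r) = x ^+ 2.
    by rewrite [2 * r]mulrC powRrM powR_mulrn ?powR_ge0.
  have x1 : 1 <= x by rewrite -(@powRr0 R (ga n)) ler_powR.
  have xx2 : x <= x ^+ 2 by rewrite expr2 ler_peMl // ltW.
  have T2 : 0 < 2 `^ r :> R by rewrite powR_gt0.
  have w1 : weight n.+1 * al n `^ (2 / 3) <=
     2 `^ (1 + r) * (al n ^+ 2 * ga n `^ (2 * r) + al n * ga n `^ (- r)).
    have hw := holder_weight_le an g1.
    have -> : 2 `^ (1 + r) = 2 * 2 `^ r :> R.
      by rewrite powRD ?pnatr_eq0 ?implybT // powRr1.
    apply: (@le_trans _ _ (2 * 2 `^ r * (al n `^ (2 / 3) * (al n * x)))); last first.
      by rewrite ler_pM2l // mulr_gt0.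
    rewrite /weight.
    have -> : 2 * 2 `^ r * (al n `^ (2 / 3) * (al n * x))
        = (2 * al n) * (2 `^ r * x) * al n `^ (2 / 3) by ring.
    rewrite ler_wpM2r ?powR_ge0 //; apply: ler_pM => //; first exact: ltW.
    exact: powR_ge0.
  have gdiff : ga n.+1 `^ r - x <= r * 2 `^ r * x * al n.
    have gn1 : 0 < ga n.+1 := lt_le_trans gn gle.
    have := powR_ge_tangent1 (ltW r_gt1) (divr_ge0 (ltW gn) (ltW gn1)).
    rewrite powR_div ?(ltW gn) // -/x ler_pdivlMr ?powR_gt0 // => h.
    set X := ga n.+1 `^ r in h g2 *.
    have E : ga n / ga n.+1 - 1 = - (al n / ga n.+1).
      by rewrite gS; field; rewrite -gS gt_eqF.
    rewrite E in h.
    have aX : al n / ga n.+1 * X <= al n * (2 `^ r * x).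
      apply: ler_pM => //; first by rewrite divr_ge0 // ltW.
        exact: powR_ge0.
      by rewrite ler_pdivrMr // ler_peMr ?(ltW an) // (le_trans g1).
    have : r * (al n / ga n.+1 * X) <= r * (al n * (2 `^ r * x)) by rewrite ler_wpM2l.
    by lra.
  have w2 : `|weight n.+1 - weight n| <=
     (2 * C + r) * 2 `^ r * (al n ^+ 2 * ga n `^ (2 * r)).
    have -> : weight n.+1 - weight n =
        (al n.+1 - al n) * ga n.+1 `^ r + al n * (ga n.+1 `^ r - x).
      by rewrite /weight -/x; ring.
    apply: le_trans (ler_normD _ _) _; rewrite !normrM.
    rewrite (ger0_norm (powR_ge0 _ _)) (gtr0_norm an).
    have xle : x <= ga n.+1 `^ r by apply: powR_mono => //; exact: ltW.
    rewrite (@ger0_norm _ (_ - x)) ?subr_ge0 // x2E.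
    have t1 : `|al n.+1 - al n| * ga n.+1 `^ r
        <= C * (al n * (2 * al n)) * (2 `^ r * x).
      apply: ler_pM => //; first exact: powR_ge0.
      by apply: le_trans adiff _; rewrite ler_pM2l // ler_pM2l.
    have t2 : al n * (ga n.+1 `^ r - x) <= al n * (r * 2 `^ r * x * al n).
      by rewrite ler_pM2l.
    apply: le_trans (lerD t1 t2) _.
    have -> : C * (al n * (2 * al n)) * (2 `^ r * x) + al n * (r * 2 `^ r * x * al n)
       = (2 * C + r) * 2 `^ r * (al n ^+ 2 * x) by ring.
    rewrite ler_wpM2l //; last by rewrite ler_wpM2l ?sqr_ge0.
    by rewrite mulr_ge0 ?(ltW T2) // addr_ge0 // mulr_ge0 // ltW.
  have p0 : 0 <= al n * ga n `^ (- r) by rewrite mulr_ge0 ?powR_ge0 // ltW.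
  have q0 : 0 <= (2 * C + r) * 2 `^ r.
    by rewrite mulr_ge0 ?(ltW T2) // addr_ge0 // mulr_ge0 // ltW.
  apply: le_trans (lerD w1 w2) _.
  by rewrite /K [leRHS]mulrDl lerD2l ler_wpM2l // lerDl.
pose B2 := 2 `^ r / (r - 1) * ga N `^ (1 - r).
have Sg m : \sum_(N <= k < m) al k * ga k `^ (- r) <= B2.
  have [Nm|mN] := leqP N m; last first.
    rewrite big_geq ?(ltnW mN) // mulr_ge0 ?powR_ge0 // divr_ge0 ?powR_ge0 //.
    by rewrite subr_ge0 ltW.
  have [_ _ _ gN] := HN N (leqnn N).
  apply: sum_steps_powRN => //; first exact: gammaS.
    exact: lt_le_trans ltr01 gN.
  by move=> k Nk; have [_ h1 _ g1] := HN k Nk; exact: le_trans h1 g1.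
exists (\sum_(0 <= k < N.+1) moment_weight k + (K * (B1 + B2) + B1)) => n.
have [nN|Nn] := leqP n N.+1.
  rewrite (big_cat_nat (n:=n) (p:=N.+1)) //= -addrA lerDl.
  have B10 : 0 <= B1 by apply: le_trans (HB1 0%N); rewrite big_geq.
  have B20 : 0 <= B2 by apply: le_trans (Sg N); rewrite big_geq.
  apply: addr_ge0; first by apply: sumr_ge0 => k _; exact: moment_weight_ge0.
  by apply: addr_ge0 => //; apply: mulr_ge0 => //; exact: addr_ge0.
rewrite (big_cat_nat (n:=N.+1)) ?(ltnW Nn) //= lerD2l.
case: n Nn => // n Nn; rewrite big_add1 /=.
have tail (u : nat -> R) m : (forall k, 0 <= u k) ->
    \sum_(N <= k < m) u k <= \sum_(0 <= k < m) u k.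
  move=> u0; have [Nm|mN] := leqP N m.
    by rewrite [leRHS](big_cat_nat (n:=N)) //= lerDr; apply: sumr_ge0.
  by rewrite big_geq ?(ltnW mN) //; apply: sumr_ge0.
apply: (@le_trans _ _ (\sum_(N <= k < n) (K * (al k ^+ 2 * ga k `^ (2 * r)
     + al k * ga k `^ (- r)) + weight k.+1 ^+ 2))).
  by apply: ler_sum_nat => k /andP[Nk _]; exact: step.
rewrite big_split /= -mulr_sumr big_split /=.
apply: lerD.
  rewrite ler_wpM2l // lerD //.
  exact: le_trans (tail _ _ sq0) (HB1 n).
apply: le_trans (HB1 n.+1); rewrite big_nat_recl //=.
apply: (@le_trans _ _ (\sum_(0 <= k < n) weight k.+1 ^+ 2)).
  by apply: tail => k; exact: sqr_ge0.
rewrite (eq_bigr _ (fun k _ => sqr_weight k.+1)).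
by rewrite lerDr sq0.
Qed.

End steps.

(** * Summation by parts for the Poisson correction *)

Section abel.
Context {R : realType}.

Lemma dominated_cvgn (u a : nat -> R) B : (forall k, `|u k| <= a k) ->
  (forall n, \sum_(0 <= k < n) a k <= B) -> cvgn (fun n => \sum_(0 <= k < n) u k).
Proof.
move=> ua aB; have a0 k : 0 <= a k := le_trans (normr_ge0 _) (ua k).
apply: cauchy_cvgn => e e0; have [N HN] := small_tails a0 aB e0.
exists N => n m Nn nm; rewrite (big_cat_nat (n:=n)) //= addrAC subrr add0r.
apply: le_trans (ler_norm_sum _ _ _) _.
by apply: le_trans (HN n m Nn nm); apply: ler_sum => k _; exact: ua.
Qed.

Context (al : nat -> R) (r : R).
Hypothesis al_gt0 : forall n, 0 < al n.

Local Notation w := (weight al r).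

(** [P k] and [Q k] are the same Poisson correction evaluated before and after
    the [k]th noise variable is drawn; reindexing pairs [Q k] with [P k.+1],
    which differ only through the parameter of the recursion. *)
Lemma abel_cvgn (P Q phi : nat -> R) B :
  (forall k, 1 <= phi k) ->
  (forall k, `|P k| <= phi k) -> (forall k, `|Q k| <= phi k.+1) ->
  (forall k, `|P k.+1 - Q k| <= al k `^ (2 / 3) * phi k.+1 ^+ 2) ->
  (forall n, \sum_(0 <= k < n) moment_weight al r k * phi k ^+ 2 <= B) ->
  cvgn (fun n => \sum_(0 <= k < n) weight al r k * (P k - Q k)).
Proof.
move=> phi1 HP HQ HPQ HB.
pose t k := w k.+1 * (P k.+1 - Q k) + (w k.+1 - w k) * Q k.
have w0 k : 0 <= w k by exact: weight_ge0.
have mw0 k : 0 <= moment_weight al r k by exact: moment_weight_ge0.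
pose a k := moment_weight al r k * phi k ^+ 2.
have a0 k : 0 <= a k by rewrite mulr_ge0 ?sqr_ge0.
have phi2 k : phi k <= phi k ^+ 2.
  by rewrite expr2 ler_peMr // (le_trans ler01).
have ta k : `|t k| <= a k.+1.
  rewrite /t /a /moment_weight /=; apply: le_trans (ler_normD _ _) _.
  rewrite normrM [X in _ + X]normrM (ger0_norm (w0 _)) [leRHS]mulrDl mulrDl -addrA.
  apply: lerD.
    by rewrite -mulrA ler_wpM2l.
  apply: (@le_trans _ _ (`|w k.+1 - w k| * phi k.+1 ^+ 2)).
    by rewrite ler_wpM2l // (le_trans (HQ k)).
  by rewrite lerDl mulr_ge0 ?sqr_ge0.
have aB n : \sum_(0 <= k < n) a k.+1 <= B.
  apply: le_trans (HB n.+1); rewrite [leRHS]big_nat_recl //= lerDr.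
  exact: a0.
have ct := dominated_cvgn ta aB.
have cP : w n * P n @[n --> \oo] --> (0 : R).
  apply/cvgrPdist_le => e e0.
  have [N HN] := small_tails a0 HB (exprn_gt0 2 e0).
  exists N => // n /= Nn; rewrite sub0r normrN.
  rewrite -(ler_pXn2r (n:=2)) ?nnegrE ?(ltW e0) //.
  apply: le_trans (HN n n.+1 Nn (leqnSn n)).
  rewrite big_nat1 normrM exprMn /a; apply: ler_pM; rewrite ?sqr_ge0 //.
    rewrite real_normK ?num_real // /moment_weight lerDr.
    by rewrite addr_ge0 // mulr_ge0 ?powR_ge0.
  by rewrite lerXn2r ?nnegrE // (le_trans ler01).
have E n : \sum_(0 <= k < n) w k * (P k - Q k)
    = w 0%N * P 0%N - w n * P n + \sum_(0 <= k < n) t k.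
  elim: n => [|n IH]; first by rewrite !big_geq // subrr addr0.
  rewrite !big_nat_recr //= IH /t; ring.
rewrite (_ : (fun n => _) =
    (fun n => w 0%N * P 0%N - w n * P n) \+ (fun n => \sum_(0 <= k < n) t k)).
  apply: is_cvgD => //; apply: is_cvgB; first exact: is_cvg_cst.
  by apply/cvg_ex; exists 0.
by apply/funext => n; rewrite E.
Qed.

End abel.

(** * Borel measurability of vector-valued maps *)

Section measurable_rV.
Context {R : realType} {n : nat}.

Lemma open_measurable_rV (U : set 'rV[R]_n) : open U -> measurable U.
Proof. by move=> oU; apply: sub_sigma_algebra. Qed.

Lemma continuous_measurable_rV (h : 'rV[R]_n -> R) :
  continuous h -> measurable_fun [set: 'rV[R]_n] h.
Proof.
move=> ch; apply: (measurability _ (RGenOInfty.measurableE R)).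
move=> _ [_ [x ->] <-]; rewrite setTI; apply: open_measurable_rV.
by apply: open_comp => [y _|]; [exact: ch|exact: interval_open].
Qed.

Lemma measurable_coord i : measurable_fun [set: 'rV[R]_n] (fun x : 'rV[R]_n => x 0 i).
Proof. by apply: continuous_measurable_rV => x; exact: coord_continuous. Qed.

(** An open set is the union of the countably many boxes with rational centre
    and radius [1/(k+1)] that it contains. *)
Lemma measurable_rV d (T : measurableType d) (u : T -> 'rV[R]_n) :
  (forall i, measurable_fun [set: T] (fun t => u t 0 i)) ->
  measurable_fun [set: T] u.
Proof.
have dist (x q rho : R) : x - rho < q -> q < x + rho -> `|x - q| < rho.
  by move=> h1 h2; rewrite ltr_norml; apply/andP; split; lra.
move=> mu; apply: (measurability _ (erefl (<<s @open 'rV[R]_n >>))).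
move=> _ [U oU <-]; rewrite setTI.
pose c (p : {ffun 'I_n -> rat} * nat) : 'rV[R]_n := \row_i ratr (p.1 i).
pose B (p : {ffun 'I_n -> rat} * nat) : set 'rV[R]_n :=
  [set x | forall i, `|x 0 i - c p 0 i| < p.2.+1%:R^-1].
pose F p : set T := if pselect (B p `<=` U) then u @^-1` B p else set0.
have -> : u @^-1` U = \bigcup_p F p.
  apply/seteqP; split => [t Ut|t [p _]]; last first.
    by rewrite /F; case: pselect => // BU; exact: BU.
  have /nbhs_ballP[e /= e0 eU] : nbhs (u t) U by exact: open_nbhs_nbhs.
  have [k hk] : exists k, k.+1%:R^-1 < e / 2.
    have := near_infty_natSinv_lt (PosNum (divr_gt0 e0 (ltr0Sn R 1))).
    by move=> [N _ HN]; exists N; exact: HN (leqnn N).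
  have k0 : 0 < k.+1%:R^-1 :> R by rewrite invr_gt0.
  have ex (i : 'I_n) : exists q : rat, `|u t 0 i - ratr q| < k.+1%:R^-1.
    have lt1 : u t 0 i - k.+1%:R^-1 < u t 0 i + k.+1%:R^-1.
      by rewrite ltrD2l (lt_trans _ k0) // oppr_lt0.
    have [q] := rat_in_itvoo lt1; rewrite in_itv /= => /andP[q1 q2].
    by exists q; exact: dist.
  have [q Hq] := choice ex.
  exists ([ffun i => q i], k) => //; rewrite /F; case: pselect => [BU|nBU] /=.
    by move=> i; rewrite /c mxE ffunE; exact: Hq.
  exfalso; apply: nBU => x Bx; apply: eU.
  rewrite -ball_normE /=; move: k0 hk Bx Hq; rewrite /B /c /=; move: (k.+1%:R^-1) => rho k0 hk Bx Hq.
  apply: (@le_lt_trans _ _ (2 * rho)); last by lra.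
  rewrite [leLHS](mx_normrE (u t - x)); apply: bigmax_le => [|[a i] _]; first lra.
  rewrite /= ord1 !mxE; have := Bx i; have := Hq i; rewrite mxE ffunE /= => h1 h2.
  have -> : u t 0 i - x 0 i = (u t 0 i - ratr (q i)) - (x 0 i - ratr (q i)) by ring.
  by apply: le_trans (ler_normB _ _) _; lra.
apply: countable_bigcupT_measurable => [|p]; first exact: countableP.
rewrite /F; case: pselect => [BU|nBU] /=; last exact: measurable0.
have -> : u @^-1` B p = \bigcap_(i in [set: 'I_n])
    (fun t => u t 0 i - c p 0 i) @^-1` `](- p.2.+1%:R^-1), p.2.+1%:R^-1[.
  apply/seteqP; split => t Ht i; have := Ht i.
    by move=> h _; rewrite /= in_itv /= -ltr_norml.
  by move=> /(_ I); rewrite /= in_itv /= -ltr_norml.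
apply: fin_bigcap_measurable => // i _; rewrite -[X in measurable X]setTI.
by apply: measurable_funB => //; exact: measurable_cst.
Qed.

End measurable_rV.

(** * Integrating out the next noise variable *)

Section disintegration.
Local Open Scope ereal_scope.
Context {R : realType} {d d2 : measure_display} {Omega : measurableType d}
  {T2 : measurableType d2} (P : probability Omega R) (G : set (set Omega))
  (Z : Omega -> T2) (K : Omega -> {measure set T2 -> \bar R}).
Hypothesis subG : <<s G >> `<=` measurable.
Hypothesis mZ : measurable_fun [set: Omega] Z.
Hypothesis K1 : forall w, K w [set: T2] = 1.
Hypothesis condK : forall B : set T2, measurable B ->
  exists2 Y : Omega -> \bar R,
    is_cond_expectation P G (fun w => (\1_(Z @^-1` B) w)%:E) Y
    & {ae P, forall w, Y w = K w B}.

Local Notation T1 := (g_sigma_algebraType G).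

Import HBNNSimple.

Definition kint (h : T1 * T2 -> \bar R) (w : Omega) := \int[K w]_z h (w, z).

(** The kernel [K] is measurable in its first argument only up to null sets,
    one for each event.  For this reason the disintegration identity carries an
    exceptional null set that depends on the integrand. *)
Definition disint (h : T1 * T2 -> \bar R) := exists N : set Omega,
  [/\ measurable N, P N = 0, measurable_fun (~` N) (kint h)
    & \int[P]_(w in ~` N) kint h w = \int[P]_w h (w, Z w)].

Definition disint_set (C : set (T1 * T2)) := exists N : set Omega,
  [/\ measurable N, P N = 0, measurable_fun (~` N) (fun w => K w (xsection C w))
    & \int[P]_(w in ~` N) K w (xsection C w) = P [set w | C (w, Z w)]].

Let mN N : measurable N -> measurable (~` N : set Omega).
Proof. exact: measurableC. Qed.

(** A null set may be enlarged freely; this lets countably many exceptional sets be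
    merged into one. *)
Let enlarge N N' (h : Omega -> \bar R) : measurable N -> measurable N' -> P N' = 0 ->
  N `<=` N' -> measurable_fun (~` N) h -> (forall w, 0 <= h w) ->
  measurable_fun (~` N') h /\
  \int[P]_(w in ~` N') h w = \int[P]_(w in ~` N) h w.
Proof.
move=> mNN mN' PN' NN' mh h0; split.
  by apply: measurable_funS mh; [exact: mN|exact: subsetC].
rewrite [RHS](ge0_negligible_integral (N := N')) //; last exact: mN.
congr (integral _ _ _); apply/seteqP; split => w /= H.
  by split => //; move=> /NN'.
by case: H.
Qed.

Lemma measurable_graph : measurable_fun [set: Omega] (fun w => (w, Z w) : T1 * T2).
Proof.
apply: measurable_fun_pair => //.
by move=> _ A mA; rewrite setTI preimage_id; exact: subG.
Qed.

Let mgraph C : measurable (C : set (T1 * T2)) ->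
  measurable [set w : Omega | C (w, Z w)].
Proof. by move=> mC; rewrite -[X in measurable X]setTI; exact: measurable_graph. Qed.

Lemma disint_rectangle A B : measurable (A : set T1) -> measurable B ->
  disint_set (A `*` B).
Proof.
move=> mA mB; have [Y [mY Y0 HY] [N [mN0 PN0 NY]]] := condK mB.
have mA' : measurable (A : set Omega) by exact: subG.
have mY' : measurable_fun [set: Omega] Y.
  by move=> _ U mU; apply: subG; exact: mY.
pose Y' w := Y w * (\1_A w)%:E.
have mYA : measurable_fun [set: Omega] Y'.
  by apply: emeasurable_funM => //; apply/measurable_EFinP; exact: measurable_indic.
have KY w : (~` N) w -> K w (xsection (A `*` B) w) = Y' w.
  move=> Nw; have KB : Y w = K w B by apply: contrapT => h; apply: Nw; exact: NY.
  rewrite /Y' indicE; case: (boolP (w \in A)) => wA.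
    by rewrite in_xsectionX // mule1.
  by rewrite notin_xsectionX // measure0 mule0.
exists N; split => //.
  apply: (eq_measurable_fun Y'); last exact: measurable_funTS.
  by move=> w /set_mem /KY.
rewrite (eq_integral Y'); last by move=> w /set_mem /KY.
have -> : \int[P]_(w in ~` N) Y' w = \int[P]_w Y' w.
  rewrite [RHS](ge0_negligible_integral (N := N)) //; last first.
    by move=> w _; rewrite mule_ge0 // lee_fin.
  by rewrite setTD.
have -> : \int[P]_w Y' w = \int[P]_(w in A) Y w.
  rewrite [RHS]integral_mkcond; apply: eq_integral => w _.
  rewrite /Y' patchE indicE; case: ifPn => _; first by rewrite mule1.
  by rewrite mule0.
rewrite HY // integral_indic //.
  by congr (P _); apply/seteqP; split => w [h1 h2]; split.
by rewrite -[X in measurable X]setTI; exact: mZ.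
Qed.

(** Rectangles are the hypothesis on conditional laws, and a Dynkin argument
    extends it: complements keep the exceptional set, countable unions merge
    a sequence of them. *)
Lemma disint_measurable C : measurable (C : set (T1 * T2)) -> disint_set C.
Proof.
rewrite measurable_prod_measurableType.
apply: (dynkin_induction (G := [set A `*` B | A in measurable & B in measurable])) => /=.
- by rewrite measurable_prod_measurableType.
- move=> X Y [X1 mX1 [X2 mX2 <-{X}]] [Y1 mY1 [Y2 mY2 <-{Y}]].
  exists (X1 `&` Y1); first exact: measurableI.
  by exists (X2 `&` Y2); [exact: measurableI|rewrite setXI].
- by rewrite -setXTT; exact: disint_rectangle.
- by move=> _ [A mA [B mB <-]]; exact: disint_rectangle.
- move=> S mS [N [mN0 PN0 mK IK]].
  have KS w : K w (xsection (~` S) w) = 1 - K w (xsection S w).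
    have mX := measurable_xsection (w : T1) mS.
    have mX' := measurable_xsection (w : T1) (measurableC mS).
    have E : 1 = K w (xsection S w) + K w (xsection (~` S) w).
      rewrite -(K1 w) -measureU //.
        congr (K w _); apply/seteqP; split => // z _.
        by have [h|h] := pselect (S (w, z)); [left|right]; exact/xsectionP.
      apply/seteqP; split => // z [/xsectionP h1 /xsectionP h2]; exact: h2.
    have fin : K w (xsection S w) \is a fin_num.
      rewrite ge0_fin_numE //; apply: (@le_lt_trans _ _ 1); last by rewrite ltry.
      by rewrite E leeDl.
    by rewrite [in RHS]E addeAC subee // add0e.
  exists N; split => //.
    under eq_fun do rewrite KS.
    by apply: emeasurable_funB => //; exact: measurable_cst.
  have mD := mN mN0.
  have PD : P (~` N) = 1 by rewrite probability_setC // PN0 sube0.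
  have Ksum : \int[P]_(w in ~` N) K w (xsection S w)
      + \int[P]_(w in ~` N) K w (xsection (~` S) w) = 1.
    rewrite -ge0_integralD //; last first.
      under eq_fun do rewrite KS.
      by apply: emeasurable_funB => //; exact: measurable_cst.
    rewrite -[RHS]PD -[RHS]mul1e -integral_cst //; apply: eq_integral => w _.
    rewrite KS /= addeC subeK // ge0_fin_numE //; apply: (@le_lt_trans _ _ 1); last by rewrite ltry.
    by rewrite -(K1 w); apply: le_measure; rewrite ?inE //; exact: measurable_xsection.
  have fin : P [set w | S (w, Z w)] \is a fin_num by exact: fin_num_measure (mgraph mS).
  move: Ksum; rewrite IK => Ksum.
  have -> : [set w | (~` S) (w, Z w)] = ~` [set w | S (w, Z w)] by [].
  rewrite probability_setC; last exact: mgraph.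
  by rewrite -Ksum addeAC subee // add0e.
- move=> F mF tF HF; have [N HN] := choice HF.
  pose N' := \bigcup_k N k.
  have mN' : measurable N' by apply: bigcupT_measurable => k; have [] := HN k.
  have PN' : P N' = 0.
    apply/negligibleP => //; apply: negligible_bigcup => k.
    by have [mk Pk _ _] := HN k; apply/negligibleP.
  have big k := enlarge (let: And4 a _ _ _ := HN k in a) mN' PN'
     (bigcup_sup I) (let: And4 _ _ a _ := HN k in a) (fun w => measure_ge0 _ _).
  have KE w : K w (xsection (\bigcup_k F k) w) = \sum_(k <oo) K w (xsection (F k) w).
    rewrite xsection_bigcup measure_semi_bigcup //.
    - by move=> k; exact: measurable_xsection.
    - exact: trivIset_xsection.
    - by apply: bigcupT_measurable => k; exact: measurable_xsection.
  exists N'; split => //.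
    under eq_fun do rewrite KE.
    apply: ge0_emeasurable_sum => [k w _ _|k _]; first exact: measure_ge0.
    by have [] := big k.
  under eq_integral do rewrite KE.
  rewrite integral_nneseries //; last 2 first.
    exact: mN.
    by move=> k; have [] := big k.
  have -> : [set w | (\bigcup_k F k) (w, Z w)] = \bigcup_k [set w | F k (w, Z w)] by [].
  rewrite measure_semi_bigcup; last 3 first.
  - by move=> k; exact: mgraph.
  - by apply/trivIsetP => i j _ _ ij; apply/seteqP; split => // w [/= h1 h2];
      have /trivIsetP /(_ i j I I ij) /seteqP [+ _] := tF; move=> /(_ (w, Z w)); apply.
  - by apply: bigcupT_measurable => k; exact: mgraph.
  apply: eq_eseriesr => k _; have [_ ->] := big k.
  by have [] := HN k.
Qed.

Let kint_ge0 h w : (forall p, 0 <= h p) -> 0 <= kint h w.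
Proof. by move=> h0; apply: integral_ge0. Qed.

Let mhw (h : T1 * T2 -> \bar R) (w : Omega) : measurable_fun setT h ->
  measurable_fun [set: T2] (fun z => h (w, z)).
Proof. by move=> mh; exact: (measurable_fun_pair2 (w : T1) mh). Qed.

Let mhZ (h : T1 * T2 -> \bar R) : measurable_fun setT h ->
  measurable_fun [set: Omega] (fun w => h (w, Z w)).
Proof. by move=> mh; exact: (measurableT_comp mh measurable_graph). Qed.

Lemma disint_indic (c : R) C : (0 <= c)%R -> measurable (C : set (T1 * T2)) ->
  disint (fun p => (c * \1_C p)%:E).
Proof.
move=> c0 mC; have [N [mN0 PN0 mK IK]] := disint_measurable mC.
have mI : measurable_fun [set: T1 * T2] (fun p => (\1_C p : R)%:E).
  by apply/measurable_EFinP; exact: measurable_indic.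
have kE w : kint (fun p => (c * \1_C p)%:E) w = c%:E * K w (xsection C w).
  rewrite /kint; under eq_integral do rewrite EFinM.
  rewrite ge0_integralZl //; last exact: (mhw w mI).
  congr (_ * _); rewrite (eq_integral (fun z => (\1_(xsection C w) z : R)%:E)).
    rewrite integral_indic ?setIT //; exact: (measurable_xsection (w : T1) mC).
  by move=> z _; congr (_%:E); rewrite !indicE mem_xsection.
exists N; split => //.
  rewrite (_ : kint _ = fun w => c%:E * K w (xsection C w)); last exact/funext.
  exact: measurable_funeM.
under eq_integral do rewrite kE.
rewrite ge0_integralZl //; last exact: mN.
under [RHS]eq_integral do rewrite EFinM.
rewrite ge0_integralZl //; last exact: mhZ mI.
congr (_ * _); rewrite IK (eq_integral (fun w => (\1_[set w | C (w, Z w)] w : R)%:E)).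
  by rewrite integral_indic ?setIT //; exact: mgraph.
by move=> w _; congr (_%:E); rewrite !indicE.
Qed.

Lemma disintD h1 h2 : (forall p, 0 <= h1 p) -> (forall p, 0 <= h2 p) ->
  measurable_fun setT h1 -> measurable_fun setT h2 ->
  disint h1 -> disint h2 -> disint (fun p => h1 p + h2 p).
Proof.
move=> h10 h20 m1 m2 [N1 [mN1 PN1 mK1 IK1]] [N2 [mN2 PN2 mK2 IK2]].
have mU : measurable (N1 `|` N2) by exact: measurableU.
have PU : P (N1 `|` N2) = 0.
  by apply/negligibleP => //; apply: negligibleU; exact/negligibleP.
have [e1 e1'] := enlarge mN1 mU PU (@subsetUl _ N1 N2) mK1 (fun w => kint_ge0 w h10).
have [e2 e2'] := enlarge mN2 mU PU (@subsetUr _ N1 N2) mK2 (fun w => kint_ge0 w h20).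
have kE w : kint (fun p => h1 p + h2 p) w = kint h1 w + kint h2 w.
  by rewrite /kint ge0_integralD //; [exact: (mhw w m1)|exact: (mhw w m2)].
exists (N1 `|` N2); split; [exact: mU|exact: PU| |].
  rewrite (_ : kint _ = fun w => kint h1 w + kint h2 w); last exact/funext.
  exact: emeasurable_funD.
under eq_integral do rewrite kE.
rewrite ge0_integralD //; last 3 first.
- exact: mN.
- by move=> w _; exact: kint_ge0.
- by move=> w _; exact: kint_ge0.
rewrite e1' e2' IK1 IK2 ge0_integralD //; exact: mhZ.
Qed.

Lemma disint_nnsfun (s : {nnsfun (T1 * T2)%type >-> R}) : disint (fun p => (s p)%:E).
Proof.
pose l0 := finmap.enum_fset (fset_set (range s)).
have sE p : s p = (\sum_(y <- l0) y * \1_(s @^-1` [set y]) p)%R.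
  by rewrite {1}fimfunE fsbig_finite.
rewrite (_ : (fun p => _) = (fun p =>
    (\sum_(y <- l0) y * \1_(s @^-1` [set y]) p)%:E)); last first.
  by apply/funext => p; rewrite {1}sE.
have meas y : measurable (s @^-1` [set y]) by exact: measurable_funPTI.
have t0 y p : (0 <= y * \1_(s @^-1` [set y]) p)%R.
  have [y0|y0] := leP 0%R y; first by rewrite mulr_ge0.
  by rewrite preimage_nnfun0 // indic0 mulr0.
have dt y : disint (fun p => (y * \1_(s @^-1` [set y]) p)%:E).
  have [y0|y0] := leP 0%R y; first exact: disint_indic.
  have := disint_indic (lexx 0%R) (@measurable0 _ (T1 * T2)%type).
  by congr disint; apply/funext => p; rewrite preimage_nnfun0 // indic0 !mulr0.
elim: l0 {sE} => [|y l IH].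
  have := disint_indic (lexx 0%R) (@measurable0 _ (T1 * T2)%type).
  congr disint; apply/funext => p; by rewrite big_nil mul0r.
rewrite (_ : (fun p => _) = (fun p => (y * \1_(s @^-1` [set y]) p)%:E +
    (\sum_(z <- l) z * \1_(s @^-1` [set z]) p)%:E)); last first.
  by apply/funext => p; rewrite big_cons EFinD.
apply: disintD.
- by move=> p; rewrite lee_fin.
- by move=> p; rewrite lee_fin; apply: sumr_ge0 => z _.
- by apply/measurable_EFinP; apply: measurable_funM => //; exact: measurable_indic.
- apply/measurable_EFinP; apply: measurable_sum => z.
  by apply: measurable_funM => //; exact: measurable_indic.
- exact: dt.
- exact: IH.
Qed.

Lemma disint_ge0 (h : T1 * T2 -> \bar R) : (forall p, 0 <= h p) ->
  measurable_fun setT h -> disint h.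
Proof.
move=> h0 mh; pose s := nnsfun_approx measurableT mh.
have s0 n p : 0 <= (s n p)%:E by rewrite lee_fin.
have nds p : nondecreasing_seq (fun n => (s n p)%:E).
  by move=> n m nm; rewrite lee_fin; exact/lefP/nd_nnsfun_approx.
have sh p : (s n p)%:E @[n --> \oo] --> h p by exact: cvg_nnsfun_approx.
have ms n : measurable_fun [set: T1 * T2] (fun p => (s n p)%:E).
  by apply/measurable_EFinP.
have [N HN] := choice (fun n => disint_nnsfun (s n)).
pose N' := \bigcup_k N k.
have mN' : measurable N' by apply: bigcupT_measurable => k; have [] := HN k.
have PN' : P N' = 0.
  apply/negligibleP => //; apply: negligible_bigcup => k.
  by have [mk Pk _ _] := HN k; apply/negligibleP.
have big k := enlarge (let: And4 a _ _ _ := HN k in a) mN' PN'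
     (bigcup_sup I) (let: And4 _ _ a _ := HN k in a) (fun w => kint_ge0 w (s0 k)).
have klim w : kint (fun p => (s n p)%:E) w @[n --> \oo] --> kint h w.
  have E : (fun z => limn (fun n => (s n (w, z))%:E)) = (fun z => h (w, z)).
    by apply/funext => z; apply: cvg_lim => //; exact: sh.
  rewrite /kint -E; apply: cvg_monotone_convergence => // n.
  exact: (mhw w (ms n)).
exists N'; split => //.
  apply: (emeasurable_fun_cvg (fun n w => kint (fun p => (s n p)%:E) w)).
    by move=> n; have [] := big n.
  by move=> w _; exact: klim.
have lim1 : \int[P]_(w in ~` N') kint (fun p => (s n p)%:E) w @[n --> \oo] -->
    \int[P]_(w in ~` N') kint h w.
  have E : (fun w => limn (fun n => kint (fun p => (s n p)%:E) w)) = kint h.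
    by apply/funext => w; apply: cvg_lim => //; exact: klim.
  rewrite -E; apply: cvg_monotone_convergence => //.
  - exact: mN.
  - by move=> n; have [] := big n.
  - by move=> n w _; exact: kint_ge0.
  - move=> w _ n m nm; apply: ge0_le_integral => //; [exact: (mhw w (ms n))|exact: (mhw w (ms m))|].
    by move=> z _; exact: nds.
have lim2 : \int[P]_w (s n (w, Z w))%:E @[n --> \oo] --> \int[P]_w h (w, Z w).
  have E : (fun w => limn (fun n => (s n (w, Z w))%:E)) = (fun w => h (w, Z w)).
    by apply/funext => w; apply: cvg_lim => //; exact: sh.
  by rewrite -E; apply: cvg_monotone_convergence => // n; exact: (mhZ (ms n)).
have same n : \int[P]_(w in ~` N') kint (fun p => (s n p)%:E) w =
    \int[P]_w (s n (w, Z w))%:E.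
  by have [_ ->] := big n; have [] := HN n.
rewrite -(cvg_lim _ lim1) // -(cvg_lim _ lim2) //.
by congr (limn _); apply/funext => n; exact: same.
Qed.

(** If [m w] is the integral of [g (w, .)] against the conditional law of [Z],
    then [m] is a conditional expectation of [g (w, Z w)]. *)
Lemma integrate_out (g : T1 * T2 -> R) (m : Omega -> R) :
  measurable_fun setT g -> measurable_fun setT m ->
  (forall w, (K w).-integrable setT (fun z => (g (w, z))%:E)) ->
  (forall w, (m w)%:E = \int[K w]_z (g (w, z))%:E) ->
  P.-integrable setT (fun w => (g (w, Z w))%:E) ->
  P.-integrable setT (fun w => (m w)%:E) /\
  \int[P]_w (m w)%:E = \int[P]_w (g (w, Z w))%:E.
Proof.
move=> mg mm ig mE iZ; pose e := EFin \o g : T1 * T2 -> \bar R.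
have me : measurable_fun setT e by exact/measurable_EFinP.
have [N1 [mN1 PN1 mK1 IK1]] := disint_ge0 (funepos_ge0 e) (measurable_funepos me).
have [N2 [mN2 PN2 mK2 IK2]] := disint_ge0 (funeneg_ge0 e) (measurable_funeneg me).
have mU : measurable (N1 `|` N2) by exact: measurableU.
have PU : P (N1 `|` N2) = 0.
  by apply/negligibleP => //; apply: negligibleU; exact/negligibleP.
have [e1 e1'] := enlarge mN1 mU PU (@subsetUl _ N1 N2) mK1
   (fun w => kint_ge0 w (funepos_ge0 e)).
have [e2 e2'] := enlarge mN2 mU PU (@subsetUr _ N1 N2) mK2
   (fun w => kint_ge0 w (funeneg_ge0 e)).
rewrite IK1 in e1'; rewrite IK2 in e2'.
set D := ~` (N1 `|` N2) in e1 e2 e1' e2'.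
have mD : measurable D by exact: mN.
have mKE w : (m w)%:E = kint e^\+ w - kint e^\- w.
  rewrite mE [LHS]integralE; congr (_ - _); apply: eq_integral => z _;
    by rewrite ?funeposE ?funenegE.
pose eZ w := e (w, Z w).
have iZp : P.-integrable setT (fun w => e^\+ (w, Z w)).
  apply: eq_integrable (integrable_funepos measurableT iZ) => // w _.
  by rewrite !funeposE.
have iZn : P.-integrable setT (fun w => e^\- (w, Z w)).
  apply: eq_integrable (integrable_funeneg measurableT iZ) => // w _.
  by rewrite !funenegE.
have ip : P.-integrable D (kint e^\+).
  apply/integrableP; split => //.
  under eq_integral do rewrite gee0_abs ?kint_ge0 ?funepos_ge0 //.
  rewrite e1'; have /integrableP[_] := iZp.
  by under eq_integral do rewrite gee0_abs ?funepos_ge0 //.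
have ineg : P.-integrable D (kint e^\-).
  apply/integrableP; split => //.
  under eq_integral do rewrite gee0_abs ?kint_ge0 ?funeneg_ge0 //.
  rewrite e2'; have /integrableP[_] := iZn.
  by under eq_integral do rewrite gee0_abs ?funeneg_ge0 //.
have imD : P.-integrable D (fun w => (m w)%:E).
  have := integrableB mD ip ineg.
  by apply: eq_integrable => // w _; rewrite mKE.
have mmE : measurable_fun setT (fun w => (m w)%:E) by exact/measurable_EFinP.
have im : P.-integrable setT (fun w => (m w)%:E).
  apply/integrableP; split => //.
  rewrite (ge0_negligible_integral (N := N1 `|` N2)) //; last exact: measurableT_comp.
  by rewrite setTD; have /integrableP[] := imD.
split => //.
rewrite (negligible_integral mU measurableT im PU) setTD -/D.
rewrite (eq_integral (fun w => kint e^\+ w - kint e^\- w)); last by move=> w _.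
rewrite integralB // e1' e2' [RHS]integralE.
by congr (_ - _); apply: eq_integral => w _; rewrite ?funeposE ?funenegE.
Qed.

End disintegration.

(** * Convergence of square-integrable martingales *)

Section martingale.
Context {R : realType} {d : measure_display} {Omega : measurableType d}
  (P : probability Omega R) (G : nat -> set (set Omega)) (D : nat -> Omega -> R)
  (v : nat -> R) (B : R).
Hypothesis subG : forall n, <<s G n >> `<=` measurable.
Hypothesis GS : forall n, <<s G n >> `<=` <<s G n.+1 >>.
Hypothesis mD : forall n,
  measurable_fun [set: g_sigma_algebraType (G n.+1)] (D n : g_sigma_algebraType (G n.+1) -> R).
Hypothesis v_ge0 : forall n, 0 <= v n.
Hypothesis D2 : forall n, (\int[P]_w (D n w ^+ 2)%:E <= (v n)%:E)%E.
Hypothesis v_sum : forall n, \sum_(0 <= k < n) v k <= B.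
(** Orthogonality to the past is only tested against bounded functions; the stopping
    below makes the partial sums bounded where they are used. *)
Hypothesis orth : forall n (Y : Omega -> R) b,
  measurable_fun [set: g_sigma_algebraType (G n)] (Y : g_sigma_algebraType (G n) -> R) ->
  (forall w, `|Y w| <= b) -> (\int[P]_w (Y w * D n w)%:E = 0)%E.

Lemma filtration_le n m : (n <= m)%N -> <<s G n >> `<=` <<s G m >>.
Proof.
move=> nm; rewrite -(subnKC nm); elim: (m - n)%N => [|k IH]; first by rewrite addn0.
by rewrite addnS => A /IH; exact: GS.
Qed.

Lemma adapted_le n m (Y : Omega -> R) : (n <= m)%N ->
  measurable_fun [set: g_sigma_algebraType (G n)] (Y : g_sigma_algebraType (G n) -> R) ->
  measurable_fun [set: g_sigma_algebraType (G m)] (Y : g_sigma_algebraType (G m) -> R).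
Proof. by move=> nm mY _ U mU; apply: (filtration_le nm); exact: mY. Qed.

Lemma adapted_measurable n (Y : Omega -> R) :
  measurable_fun [set: g_sigma_algebraType (G n)] (Y : g_sigma_algebraType (G n) -> R) ->
  measurable_fun [set: Omega] Y.
Proof. by move=> mY _ U mU; apply: (@subG n); exact: mY. Qed.

Section stopped.
Variables (n0 : nat) (lam : R).
Hypothesis lam_gt0 : 0 < lam.

Definition psum j w : R := \sum_(n0 <= k < j) D k w.

Definition quiet j : set Omega := [set w | forall i, (i <= j)%N -> `|psum i w| < lam].

(** Stopping at the first exit from ]-lam, lam[ keeps the sum equal to the exit
    value, so that a large partial sum is still seen at the final time. *)
Definition stopped j w : R := \sum_(n0 <= k < j) \1_(quiet k) w * D k w.

Lemma adapted_psum j :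
  measurable_fun [set: g_sigma_algebraType (G j)] (psum j : g_sigma_algebraType (G j) -> R).
Proof.
rewrite /psum.
have [nj|jn] := leqP n0 j; last first.
  rewrite (_ : (fun w => _) = cst 0) //.
  by apply/funext => w; rewrite big_geq // ltnW.
rewrite (_ : (fun w => _) = (fun w => \sum_(k <- index_iota n0 j)
    (if (k < j)%N then D k w else 0))); last first.
  by apply/funext => w; apply: eq_big_nat => k /andP[_ ->].
apply: measurable_sum => k; case: ltnP => kj //.
exact: (adapted_le kj (@mD k)).
Qed.

Lemma quiet_adapted j : <<s G j >> (quiet j).
Proof.
have -> : quiet j = \bigcap_(i in [set i | (i <= j)%N])
    (fun w => `|psum i w|) @^-1` `]-oo, lam[.
  by apply/seteqP; split => w H i ij; have := H i ij; rewrite /= in_itv.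
apply: (@bigcap_measurableType _ (g_sigma_algebraType (G j))) => i ij.
rewrite -[X in measurable X]setTI.
have mi := adapted_le ij (@adapted_psum i).
by apply: (measurableT_comp (@normr_measurable R setT) mi).
Qed.

Lemma quiet_le i j : (i <= j)%N -> quiet j `<=` quiet i.
Proof. by move=> ij w H k ki; apply: H; exact: leq_trans ij. Qed.

Lemma stopped_quiet j w : quiet j w -> stopped j w = psum j w.
Proof.
move=> Qw; apply: eq_big_nat => k /andP[_ kj].
by rewrite indicE mem_set ?mul1r //; apply: quiet_le Qw; exact: ltnW.
Qed.

Lemma measurable_stopped j : measurable_fun [set: Omega] (stopped j).
Proof.
apply: measurable_sum => k; apply: measurable_funM.
  by apply: measurable_indic; apply: (@subG k); exact: quiet_adapted.
exact: adapted_measurable (@mD k).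
Qed.

Let mDk k : measurable_fun [set: Omega] (D k).
Proof. exact: adapted_measurable (@mD k). Qed.

Let mQ k : measurable (quiet k).
Proof. by apply: (@subG k); exact: quiet_adapted. Qed.

Let iD2 k : P.-integrable setT (fun w => (D k w ^+ 2)%:E).
Proof.
apply/integrableP; split.
  by apply/measurable_EFinP; exact: measurable_funX.
under eq_integral do rewrite gee0_abs ?lee_fin ?sqr_ge0 //.
by apply: le_lt_trans (D2 k) _; rewrite ltry.
Qed.

Let ge0_integrable (Y Y' : Omega -> R) : measurable_fun setT Y ->
  (forall w, `|Y w| <= Y' w) -> P.-integrable setT (fun w => (Y' w)%:E) ->
  P.-integrable setT (fun w => (Y w)%:E).
Proof.
move=> mY YY' iY'; apply: le_integrable iY' => //; first exact/measurable_EFinP.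
by move=> w _; rewrite /= lee_fin; apply: le_trans (YY' w) (ler_norm _).
Qed.

(** The cross terms vanish: where the next increment is added, the sum has not
    left ]-lam, lam[ yet, so it is a bounded function of the past. *)
Lemma stopped_second_moment j : (n0 <= j)%N ->
  P.-integrable setT (fun w => (stopped j w ^+ 2)%:E) /\
  (\int[P]_w (stopped j w ^+ 2)%:E <= (\sum_(n0 <= k < j) v k)%:E)%E.
Proof.
move=> nj; rewrite -(subnKC nj); elim: (j - n0)%N => [|i [IHi IHb]].
  have -> : (fun w => (stopped (n0 + 0) w ^+ 2)%:E) = cst 0%E.
    by apply/funext => w; rewrite /stopped addn0 big_geq // expr0n.
  split; first exact: integrable0.
  by rewrite integral0 addn0 big_geq.
rewrite addnS; set k := (n0 + i)%N in IHi IHb *.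
have nk : (n0 <= k)%N by exact: leq_addr.
pose Y w := \1_(quiet k) w * stopped k w.
have YE w : Y w = \1_(quiet k) w * psum k w.
  rewrite /Y indicE; case: (boolP (w \in quiet k)) => wQ; last by rewrite !mul0r.
  by rewrite stopped_quiet //; exact: set_mem.
have Yb w : `|Y w| <= lam.
  rewrite YE indicE; case: (boolP (w \in quiet k)) => wQ.
    by rewrite mul1r ltW //; exact: (set_mem wQ).
  by rewrite mul0r normr0 ltW.
have aY : measurable_fun [set: g_sigma_algebraType (G k)] (Y : g_sigma_algebraType (G k) -> R).
  rewrite (_ : Y = (fun w => \1_(quiet k) w * psum k w)); last exact/funext.
  apply: measurable_funM; last exact: adapted_psum.
  by apply: measurable_indic; exact: quiet_adapted.
have YD0 := orth aY Yb.
have mY := adapted_measurable aY.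
have iYD : P.-integrable setT (fun w => (Y w * D k w)%:E).
  apply: (ge0_integrable (Y' := fun w => lam * (1 + D k w ^+ 2))).
  - exact: measurable_funM.
  - move=> w; rewrite normrM; apply: ler_pM => //.
    have := sqr_ge0 (`|D k w| - 1); rewrite sqrrB real_normK ?num_real //.
    have := sqr_ge0 (D k w); lra.
  - under eq_fun do rewrite EFinM EFinD.
    apply: integrableZl => //; apply: integrableD => //.
    exact: finite_measure_integrable_cst.
pose X w := \1_(quiet k) w * D k w ^+ 2.
have mX : measurable_fun setT X.
  by apply: measurable_funM; [exact: measurable_indic|exact: measurable_funX].
have X0 w : 0 <= X w by rewrite mulr_ge0 ?sqr_ge0.
have XD w : X w <= D k w ^+ 2.
  by rewrite /X indicE; case: (_ \in _); rewrite ?mul1r ?mul0r ?sqr_ge0.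
have iX : P.-integrable setT (fun w => (X w)%:E).
  by apply: (ge0_integrable (Y' := fun w => D k w ^+ 2)) => // w; rewrite ger0_norm.
have E : (fun w => (stopped k.+1 w ^+ 2)%:E) =
    (fun w => ((stopped k w ^+ 2)%:E + (2%:E * (Y w * D k w)%:E + (X w)%:E))%E).
  apply/funext => w; rewrite -EFinM -!EFinD; congr (_%:E).
  rewrite /stopped big_nat_recr //= -/(stopped k w) /Y /X indicE.
  by case: (_ \in _); rewrite ?mul1r ?mul0r ?addr0 ?expr0n /=; ring.
have iS : P.-integrable setT (fun w => (2%:E * (Y w * D k w)%:E + (X w)%:E)%E).
  by apply: integrableD => //; exact: integrableZl.
rewrite E; split; first exact: integrableD.
rewrite integralD // integralD //; last exact: integrableZl.
rewrite integralZl // YD0 mule0 add0e big_nat_recr //= EFinD.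
apply: leeD => //; apply: le_trans (D2 k).
apply: ge0_le_integral => //.
- by move=> w _; rewrite lee_fin.
- exact/measurable_EFinP.
- by apply/measurable_EFinP; exact: measurable_funX.
- by move=> w _; rewrite lee_fin.
Qed.

Lemma loud_stopped j w : ~ quiet j w -> lam <= `|stopped j w|.
Proof.
move=> nQ.
have ex : exists i, (i <= j)%N && (lam <= `|psum i w|).
  apply: contrapT => nex; apply: nQ => i ij; rewrite ltNge; apply/negP => h.
  by apply: nex; exists i; rewrite ij.
case: (ex_minnP ex) => i /andP[ij hi] imin.
have n0i : (n0 <= i)%N.
  rewrite leqNgt; apply/negP => ni; move: hi.
  by rewrite /psum big_geq ?(ltnW ni) // normr0 leNgt lam_gt0.
suff -> : stopped j w = psum i w by [].
have tail0 : \sum_(i <= k < j) \1_(quiet k) w * D k w = 0.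
  rewrite big_nat_cond; apply: big1 => k /andP[/andP[ik _] _].
  by rewrite indicE memNset ?mul0r // => Qk; have := Qk i ik; rewrite ltNge hi.
rewrite /stopped (big_cat_nat n0i ij) /= tail0.
rewrite addr0; apply: eq_big_nat => k /andP[_ ki].
rewrite indicE mem_set ?mul1r // => l lk; rewrite ltNge; apply/negP => h.
have := imin l; rewrite h andbT (leq_trans lk) ?(leq_trans (ltnW ki)) //.
by move=> /(_ isT); rewrite leqNgt (leq_ltn_trans lk).
Qed.

(** Kolmogorov's inequality: Markov's inequality for the square of the stopped sum. *)
Lemma maximal_inequality t : (forall j, \sum_(n0 <= k < j) v k <= t) ->
  (P (\bigcup_j ~` quiet j) <= (t / lam ^+ 2)%:E)%E.
Proof.
move=> vt; have l2 : 0 < lam ^+ 2 by rewrite exprn_gt0.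
have Pj j : (P (~` quiet j) <= (t / lam ^+ 2)%:E)%E.
  have [nj|jn] := leqP n0 j; last first.
    have -> : ~` quiet j = set0.
      apply/seteqP; split => // w; apply => i ij.
      by rewrite /psum big_geq ?normr0 // ltnW // (leq_ltn_trans ij).
    have t0 : 0 <= t by apply: le_trans (vt 0%N); rewrite big_geq.
    by rewrite measure0 lee_fin divr_ge0 // ltW.
  have [_ hb] := stopped_second_moment nj.
  rewrite EFinM -lee_pdivrMr //; last by rewrite invr_gt0.
  rewrite invrK muleC.
  apply: (@le_trans _ _ (\int[P]_w (stopped j w ^+ 2)%:E)%E); last first.
    by apply: le_trans hb _; rewrite lee_fin.
  have mC : measurable (~` quiet j) by exact: measurableC.
  rewrite -[X in P X]setIT -(integral_indic P measurableT mC) -ge0_integralZl //; last 2 first.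
  - by apply/measurable_EFinP; exact: measurable_indic.
  - by rewrite lee_fin ltW.
  apply: ge0_le_integral => //.
  - by move=> w _; rewrite -EFinM lee_fin mulr_ge0 // ltW.
  - apply/measurable_EFinP; apply: measurable_funM => //; exact: measurable_indic.
  - apply/measurable_EFinP; apply: measurable_funX; exact: (@measurable_stopped j).
  - move=> w _; rewrite -EFinM lee_fin indicE.
    case: (boolP (w \in ~` quiet j)) => [/set_mem/loud_stopped h|_]; last first.
      by rewrite mulr0 sqr_ge0.
    rewrite mulr1 -[leRHS]real_normK ?num_real // lerXn2r ?nnegrE //.
    exact: ltW.
have mU : measurable (\bigcup_j ~` quiet j).
  by apply: bigcupT_measurable => j; exact: measurableC.
have cv := @nondecreasing_cvg_mu _ _ _ P (fun j => ~` quiet j)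
  (fun j => measurableC (mQ j)) mU.
rewrite -(cvg_lim _ (cv _)) //; last first.
  by apply/nondecreasing_seqP => j; apply/subsetPset/subsetC/quiet_le.
apply: lime_le; last exact: nearW.
by apply/cvg_ex; eexists; apply: cv; apply/nondecreasing_seqP => j;
  apply/subsetPset/subsetC/quiet_le.
Qed.

End stopped.

(** The variances have small tails, so by the maximal inequality the oscillation of
    the partial sums after a late time exceeds [lam] with small probability only. *)
Lemma martingale_cvg : {ae P, forall w, cvgn (fun n => \sum_(0 <= k < n) D k w)}.
Proof.
pose bad lam := \bigcap_n0 \bigcup_j ~` quiet n0 lam j.
have mquiet n0 lam j : measurable (quiet n0 lam j).
  by apply: (@subG j); exact: quiet_adapted.
have mU n0 lam : measurable (\bigcup_j ~` quiet n0 lam j).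
  by apply: bigcupT_measurable => j; exact: measurableC.
have bad0 lam : 0 < lam -> P.-negligible (bad lam).
  move=> l0; have mb : measurable (bad lam) by exact: bigcapT_measurable.
  apply/negligibleP => //; apply/eqP; rewrite eq_le measure_ge0 andbT.
  apply/lee_addgt0Pr => e e0; rewrite add0e.
  have [N HN] := small_tails v_ge0 v_sum (mulr_gt0 e0 (exprn_gt0 2 l0)).
  apply: (@le_trans _ _ (P (\bigcup_j ~` quiet N lam j))).
    by apply: le_measure; rewrite ?inE // => w; apply.
  have tail j : \sum_(N <= k < j) v k <= e * lam ^+ 2.
    have [Nj|jN] := leqP N j; first exact: HN.
    by rewrite big_geq ?(ltnW jN) // mulr_ge0 ?sqr_ge0 // ltW.
  by have := maximal_inequality l0 tail; rewrite mulfK // expf_neq0 // gt_eqF.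
have : P.-negligible (\bigcup_m bad m.+1%:R^-1).
  by apply: negligible_bigcup => m; apply: bad0; rewrite invr_gt0.
apply: negligibleS => w /= ncv; apply: contrapT => nb; apply: ncv.
apply: cauchy_cvgn => e e0.
have [m hm] : exists m, m.+1%:R^-1 < e / 2.
  have := near_infty_natSinv_lt (PosNum (divr_gt0 e0 (ltr0Sn R 1))).
  by move=> [N _ HN]; exists N; exact: HN (leqnn N).
have [n0 hn0] : exists n0, forall j, quiet n0 m.+1%:R^-1 j w.
  apply: contrapT => H; apply: nb; exists m => // n0 _.
  apply: contrapT => H'; apply: H; exists n0 => j.
  by apply: contrapT => H''; apply: H'; exists j.
exists n0 => n n' nn nn'.
have E i : (n0 <= i)%N -> \sum_(0 <= k < i) D k w =
    \sum_(0 <= k < n0) D k w + psum n0 i w.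
  by move=> ni; rewrite (big_cat_nat (n := n0)).
rewrite (E n nn) (E n' (leq_trans nn nn')).
have := hn0 n n (leqnn n); have := hn0 n' n' (leqnn n').
move: (m.+1%:R^-1) hm (psum n0 n w) (psum n0 n' w) (\sum_(_ <= _ < _) _).
move=> rho hrho p p' q hp' hp.
have -> : q + p' - (q + p) = p' - p by ring.
by apply: le_trans (ler_normB _ _) _; lra.
Qed.

End martingale.

(** * The noise of the recursion *)

Lemma coordB (R : realType) n (u v : 'rV[R]_n) i : (u - v) 0 i = u 0 i - v 0 i.
Proof. by rewrite !mxE. Qed.

Section noise.
Context {R : realType} {dt dz : nat} {d : measure_display}
  {Omega : measurableType d} (P : probability Omega R).
Context (F Ft : 'rV[R]_dt -> 'rV[R]_dz -> 'rV[R]_dt) (alpha : nat -> R) (r : R)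
  (theta : nat -> Omega -> 'rV[R]_dt) (Z : nat -> Omega -> 'rV[R]_dz)
  (Pi : 'rV[R]_dt -> R.-pker 'rV[R]_dz ~> 'rV[R]_dz) (f : 'rV[R]_dt -> R).
Hypothesis hF : measurable_fun [set: 'rV[R]_dt * 'rV[R]_dz] (fun x => F x.1 x.2).
Hypothesis hFt : measurable_fun [set: 'rV[R]_dt * 'rV[R]_dz] (fun x => Ft x.1 x.2).
Hypothesis alpha_gt0 : forall n, 0 < alpha n.
Hypothesis htheta0 : measurable_fun [set: Omega] (theta 0%N).
Hypothesis hZ : forall n, measurable_fun [set: Omega] (Z n).
Hypothesis htheta : forall n w,
     theta n.+1 w = theta n w - alpha n *: F (theta n w) (Z n.+1 w).
Hypothesis hPi : forall (n : nat) (B : set 'rV[R]_dz), measurable B ->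
     exists2 Y : Omega -> \bar R,
       is_cond_expectation P (history theta Z n)
         (fun w => (\1_(Z n.+1 @^-1` B) w)%:E) Y
       & {ae P, forall w, Y w = Pi (theta n w) (Z n w) B}.
Hypothesis weight_sum : exists B, forall n,
  \sum_(0 <= k < n) moment_weight alpha r k <= B.
Hypothesis grad_cont : continuous (grad f).
Hypothesis h2_int : forall x z, kernel_integrable Pi Ft x z.
Hypothesis h2 : forall x z, F x z - grad f x = Ft x z - kernel_int Pi Ft x z.

Local Notation H := (history theta Z).
Local Notation PF := (kernel_int Pi Ft).
Local Notation weight := (weight alpha r).

Lemma measurable_theta n : measurable_fun [set: Omega] (theta n).
Proof.
elim: n => // n IH; apply: measurable_rV => i.
have -> : (fun w => theta n.+1 w 0 i)
    = (fun w => theta n w 0 i - alpha n * F (theta n w) (Z n.+1 w) 0 i).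
  by apply/funext => w; rewrite htheta !mxE.
apply: measurable_funB; first exact: (measurableT_comp (measurable_coord i) IH).
apply: measurable_funM => //.
apply: (measurableT_comp (measurable_coord i)).
exact: (measurableT_comp hF (measurable_fun_pair IH (hZ n.+1))).
Qed.

Lemma history_measurable n : <<s H n >> `<=` measurable.
Proof.
apply: smallest_sub; first exact: sigma_algebra_measurable.
move=> _ [k _ [B mB <-]].
exact: (measurable_fun_pair (measurable_theta k) (hZ k)).
Qed.

Lemma history_le n m : (n <= m)%N -> <<s H n >> `<=` <<s H m >>.
Proof.
move=> nm; apply: sub_sigma_algebra2 => A [k kn HA].
by exists k => //; exact: leq_trans nm.
Qed.

Lemma adapted_pair k n : (k <= n)%N ->
  measurable_fun [set: g_sigma_algebraType (H n)]
    ((fun w => (theta k w, Z k w)) : g_sigma_algebraType (H n) -> 'rV[R]_dt * 'rV[R]_dz).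
Proof.
by move=> kn _ A mA; apply: sub_sigma_algebra; exists k => //; exists A.
Qed.

Lemma adapted_theta k n : (k <= n)%N -> measurable_fun [set: g_sigma_algebraType (H n)]
    (theta k : g_sigma_algebraType (H n) -> 'rV[R]_dt).
Proof. by move=> kn; have /measurable_fun_pairP[] := adapted_pair kn. Qed.

Lemma adapted_Z k n : (k <= n)%N -> measurable_fun [set: g_sigma_algebraType (H n)]
    (Z k : g_sigma_algebraType (H n) -> 'rV[R]_dz).
Proof. by move=> kn; have /measurable_fun_pairP[] := adapted_pair kn. Qed.

(** Integrals against the kernels need not be measurable in both arguments
    jointly; the Poisson equation expresses the integral through measurable functions. *)
Lemma measurable_kernel_int i :
  measurable_fun [set: 'rV[R]_dt * 'rV[R]_dz] (fun x => PF x.1 x.2 0 i).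
Proof.
have -> : (fun x : 'rV[R]_dt * 'rV[R]_dz => PF x.1 x.2 0 i) =
   (fun x => Ft x.1 x.2 0 i - F x.1 x.2 0 i + grad f x.1 0 i).
  apply/funext => -[x z] /=; have := congr1 (fun u : 'rV[R]_dt => u 0 i) (h2 x z).
  by rewrite !coordB => /(congr1 (fun t => Ft x z 0 i - F x z 0 i + grad f x 0 i - t)); lra.
have mc := @measurable_coord R dt i.
apply: measurable_funD.
  apply: measurable_funB; first exact: (measurableT_comp mc hFt).
  exact: (measurableT_comp mc hF).
have mg : measurable_fun [set: 'rV[R]_dt] (fun x => grad f x 0 i).
  apply: continuous_measurable_rV => x.
  exact: (@continuous_comp _ _ _ (grad f) (fun u => u 0 i) x (@grad_cont x)
    (@coord_continuous _ _ _ 0 i _)).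
exact: (measurableT_comp mg measurable_fst).
Qed.

Lemma le_exit_time (Q : set 'rV[R]_dt) (th : nat -> 'rV[R]_dt) n :
  ((n%:R)%:E <= exit_time Q th)%E <-> (forall k, (k < n)%N -> Q (th k)).
Proof.
split=> [/ereal_infP h k kn|h].
  apply: contrapT => nQ; have : ((n%:R)%:E <= (k%:R)%:E :> \bar R)%E.
    by apply: h; left; exists k.
  by rewrite lee_fin ler_nat leqNgt kn.
apply/ereal_infP => _ [[k nQ <-]|->]; last by rewrite leey.
by rewrite lee_fin ler_nat leqNgt; apply/negP => /h.
Qed.

Section local.
Variables (A C : R) (phi : 'rV[R]_dz -> R)
  (g : nat -> 'rV[R]_dt * 'rV[R]_dz -> \bar R).
Local Notation Q := (@box R dt A).
Hypothesis C_ge0 : 0 <= C.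
Hypothesis mphi : measurable_fun [set: 'rV[R]_dz] phi.
Hypothesis phi_ge1 : forall z, 1 <= phi z.
Hypothesis phi_bound : forall x z, Q x ->
  Num.max (Num.max (enorm (F x z)) (enorm (Ft x z))) (enorm (PF x z)) <= phi z.
Hypothesis phi_holder : forall x' x'' z, Q x' -> Q x'' ->
  enorm (PF x' z - PF x'' z) <= phi z * enorm (x' - x'') `^ (2 / 3).
Hypothesis mg : forall n, measurable_fun [set: 'rV[R]_dt * 'rV[R]_dz] (g n).
Hypothesis g_cond : forall n, is_cond_expectation P (H 0)
  (fun w => (phi (Z n w) ^+ 2 *
     \1_[set w' | ((n%:R)%:E <= exit_time Q (theta ^~ w'))%E] w)%:E)
  (fun w => g n (theta 0%N w, Z 0%N w)).

(** The moment bounds hold conditionally on the initial state only; on this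
    event they hold with the constant [C]. *)
Definition start : set Omega :=
  [set w | forall n, (g n (theta 0%N w, Z 0%N w) <= C%:E)%E].

Definition inside n : set Omega := [set w | forall k, (k < n)%N -> Q (theta k w)].

Definition moment n w : R := \1_(start `&` inside n) w * phi (Z n w).

Lemma start_adapted n : <<s H n >> start.
Proof.
apply: (history_le (leq0n n)).
have -> : start = \bigcap_n
    ((fun w => g n (theta 0%N w, Z 0%N w)) @^-1` `]-oo, C%:E]).
  apply/seteqP; split => w h k; first by move=> _; rewrite /= in_itv /=; exact: h.
  by have := h k I; rewrite /= in_itv.
apply: (@bigcapT_measurable _ (g_sigma_algebraType (H 0))) => k.
rewrite -[X in measurable X]setTI.
apply: (measurableT_comp (@mg k) (@adapted_pair 0 0 (leqnn 0))) => //.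
exact: emeasurable_itv.
Qed.

Lemma inside_adapted n : <<s H n >> (inside n.+1).
Proof.
have -> : inside n.+1 = \bigcap_(k in [set k | (k <= n)%N]) (theta k @^-1` Q).
  by apply/seteqP; split => w h k; exact: h.
apply: (@bigcap_measurableType _ (g_sigma_algebraType (H n))) => k kn.
rewrite -[X in measurable X]setTI; apply: (adapted_theta kn) => //.
have cQ : closed Q by apply: compact_closed; [exact: norm_hausdorff|exact: box_compact].
rewrite -[Q]setCK; apply: measurableC; apply: open_measurable_rV.
exact: closed_openC.
Qed.

Lemma inside_adapted_le n : <<s H n >> (inside n).
Proof.
case: n => [|n]; last exact: (history_le (leqnSn n)) (@inside_adapted n).
have -> : inside 0 = [set: Omega] by apply/seteqP; split.
exact: (@measurableT _ (g_sigma_algebraType (H 0))).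
Qed.

Let mE n : <<s H n >> (start `&` inside n).
Proof.
apply: (@measurableI _ (g_sigma_algebraType (H n))); first exact: start_adapted.
exact: inside_adapted_le.
Qed.

Let mE1 n : <<s H n >> (start `&` inside n.+1).
Proof.
apply: (@measurableI _ (g_sigma_algebraType (H n))); first exact: start_adapted.
exact: inside_adapted.
Qed.

Let phi_ge0 z : 0 <= phi z. Proof. exact: le_trans ler01 (phi_ge1 z). Qed.

Lemma moment_ge0 n w : 0 <= moment n w.
Proof. by rewrite mulr_ge0. Qed.

Lemma measurable_moment n : measurable_fun [set: Omega] (moment n).
Proof.
apply: measurable_funM.
  by apply: measurable_indic; exact: (@history_measurable n).
exact: (measurableT_comp mphi (hZ n)).
Qed.

Lemma moment_le n : (\int[P]_w (moment n w ^+ 2)%:E <= C%:E)%E.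
Proof.
have mS : measurable start by exact: (@history_measurable 0) (@start_adapted 0).
have [_ g0 gint] := g_cond n.
have -> : (\int[P]_w (moment n w ^+ 2)%:E =
    \int[P]_(w in start) g n (theta 0%N w, Z 0%N w))%E.
  rewrite (gint _ (@start_adapted 0)) [RHS]integral_mkcond; apply: eq_integral => w _.
  rewrite patchE /moment !indicE in_setI.
  case: (w \in start); rewrite [_ && _]/=; last by rewrite mul0r expr0n.
  rewrite exprMn mulrC; congr ((_ * _)%:E).
  have -> : [set w' | ((n%:R)%:E <= exit_time Q (theta ^~ w'))%E] = inside n.
    by apply/seteqP; split => w'; rewrite /= le_exit_time.
  by case: (_ \in _); rewrite ?expr1n ?expr0n.
have mgn : measurable_fun [set: Omega] (fun w => g n (theta 0%N w, Z 0%N w)).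
  exact: (measurableT_comp (@mg n) (measurable_fun_pair htheta0 (hZ 0))).
apply: (@le_trans _ _ (\int[P]_(w in start) (C%:E))%E).
  by apply: ge0_le_integral => //; exact: measurable_funTS.
rewrite integral_cst // -[leRHS]mule1; apply: lee_pmul => //.
exact: probability_le1.
Qed.

Let moment_sq_integrable n : P.-integrable setT (fun w => (moment n w ^+ 2)%:E).
Proof.
apply/integrableP; split.
  by apply/measurable_EFinP; apply: measurable_funX; exact: measurable_moment.
under eq_integral do rewrite gee0_abs ?lee_fin ?sqr_ge0 //.
by apply: le_lt_trans (moment_le n) _; rewrite ltry.
Qed.

Lemma moment_integrable n : P.-integrable setT (fun w => (moment n w)%:E).
Proof.
have h : P.-integrable setT (fun w => (1%:E + (moment n w ^+ 2)%:E)%E).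
  by apply: integrableD => //; exact: finite_measure_integrable_cst.
apply: le_integrable h => //.
  by apply/measurable_EFinP; exact: measurable_moment.
move=> w _; rewrite -EFinD !abse_EFin lee_fin !ger0_norm ?moment_ge0 ?addr_ge0 ?sqr_ge0 //.
by have := sqr_ge0 (moment n w - 1); rewrite sqrrB; have := sqr_ge0 (moment n w); lra.
Qed.

Let coord_bound (u : 'rV[R]_dt) i b : enorm u <= b -> `|u 0 i| <= b.
Proof. exact: le_trans (coord_le_enorm u i). Qed.

Let F_le x z : Q x -> enorm (F x z) <= phi z.
Proof. by move=> /phi_bound -/(_ z); rewrite !ge_max -andbA => /and3P[]. Qed.

Let Ft_le x z : Q x -> enorm (Ft x z) <= phi z.
Proof. by move=> /phi_bound -/(_ z); rewrite !ge_max -andbA => /and3P[]. Qed.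

Let PF_le x z : Q x -> enorm (PF x z) <= phi z.
Proof. by move=> /phi_bound -/(_ z); rewrite !ge_max -andbA => /and3P[]. Qed.

Section coordinate.
Variable i : 'I_dt.

Definition active n w : R := weight n * \1_(start `&` inside n.+1) w.

(** Weighted increments of the noise that are orthogonal to the past. *)
Definition increment n w : R :=
  active n w * (Ft (theta n w) (Z n.+1 w) 0 i - PF (theta n w) (Z n w) 0 i).

Let adapted_active n : measurable_fun [set: g_sigma_algebraType (H n)]
  (active n : g_sigma_algebraType (H n) -> R).
Proof.
by apply: measurable_funM => //; apply: measurable_indic; exact: mE1.
Qed.

Let active_Ft n w : `|active n w * Ft (theta n w) (Z n.+1 w) 0 i| <= weight n * moment n.+1 w.
Proof.
have w0 := weight_ge0 r alpha_gt0 n.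
rewrite /active /moment normrM normrM (ger0_norm w0) -mulrA ler_wpM2l // !indicE.
case: (boolP (w \in _)) => wE; last by rewrite normr0 !mul0r.
rewrite normr1 !mul1r; have [_ wI] := set_mem wE.
by apply: coord_bound; apply: Ft_le; exact: wI.
Qed.

Let active_PF n w : `|active n w * PF (theta n w) (Z n w) 0 i| <= weight n * moment n w.
Proof.
have w0 := weight_ge0 r alpha_gt0 n.
rewrite /active /moment normrM normrM (ger0_norm w0) -mulrA ler_wpM2l // !indicE.
case: (boolP (w \in start `&` inside n.+1)) => wE; last first.
  by rewrite normr0 mul0r mulr_ge0.
have [wS wI] := set_mem wE.
rewrite mem_set; last by split => // k kn; apply: wI; exact: ltnW.
by rewrite normr1 !mul1r; apply: coord_bound; apply: PF_le; exact: wI.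
Qed.

Lemma adapted_increment n : measurable_fun [set: g_sigma_algebraType (H n.+1)]
  (increment n : g_sigma_algebraType (H n.+1) -> R).
Proof.
have mc := @measurable_coord R dt i.
apply: measurable_funM.
  by move=> _ U mU; apply: (history_le (leqnSn n)); exact: adapted_active.
have mth := adapted_theta (leqnSn n); apply: measurable_funB.
  apply: (measurableT_comp mc).
  exact: (measurableT_comp hFt (measurable_fun_pair mth (adapted_Z (leqnn n.+1)))).
exact: (measurableT_comp (measurable_kernel_int i)
  (measurable_fun_pair mth (adapted_Z (leqnSn n)))).
Qed.

Lemma increment_second_moment n :
  (\int[P]_w (increment n w ^+ 2)%:E <= (4 * C * weight n ^+ 2)%:E)%E.
Proof.
have minc : measurable_fun [set: Omega] (increment n).
  by move=> _ U mU; apply: (@history_measurable n.+1); exact: adapted_increment.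
have mm k : measurable_fun [set: Omega] (fun w => (moment k w ^+ 2)%:E).
  by apply/measurable_EFinP; apply: measurable_funX; exact: measurable_moment.
have w0 := weight_ge0 r alpha_gt0 n.
apply: (@le_trans _ _ (\int[P]_w ((2 * weight n ^+ 2)%:E *
    ((moment n.+1 w ^+ 2)%:E + (moment n w ^+ 2)%:E)))%E).
  apply: ge0_le_integral => //.
  - by move=> w _; rewrite lee_fin sqr_ge0.
  - by apply/measurable_EFinP; exact: measurable_funX.
  - by apply: measurable_funeM; exact: emeasurable_funD.
  - move=> w _; rewrite -EFinD -EFinM lee_fin.
    rewrite -[leLHS]real_normK ?num_real //.
    have h : `|increment n w| <= weight n * moment n.+1 w + weight n * moment n w.
      rewrite /increment mulrBr; apply: le_trans (ler_normB _ _) _.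
      exact: lerD (active_Ft n w) (active_PF n w).
    apply: (@le_trans _ _ ((weight n * moment n.+1 w + weight n * moment n w) ^+ 2)).
      by rewrite lerXn2r ?nnegrE // addr_ge0 // mulr_ge0 ?moment_ge0.
    apply: le_trans (sqrrD_le2 _ _) _; rewrite !exprMn.
    by rewrite le_eqVlt; apply/orP; left; apply/eqP; ring.
have wp : (0 <= 2 * weight n ^+ 2) by rewrite mulr_ge0 ?sqr_ge0.
rewrite ge0_integralZl //; last 2 first.
- exact: emeasurable_funD.
- by move=> w _; rewrite -EFinD lee_fin addr_ge0 ?sqr_ge0.
rewrite ge0_integralD //; last 2 first.
- by move=> w _; rewrite lee_fin sqr_ge0.
- by move=> w _; rewrite lee_fin sqr_ge0.
have -> : 4 * C * weight n ^+ 2 = 2 * weight n ^+ 2 * (C + C) by ring.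
rewrite [leRHS]EFinM EFinD; apply: lee_pmul => //.
  by apply: adde_ge0; apply: integral_ge0 => w _; rewrite lee_fin sqr_ge0.
by apply: leeD; exact: moment_le.
Qed.

(** Integrating out [Z n.+1] replaces the first Poisson term by the second one. *)
Lemma increment_orthogonal n (Y : Omega -> R) (b : R) :
  measurable_fun [set: g_sigma_algebraType (H n)] (Y : g_sigma_algebraType (H n) -> R) ->
  (forall w, `|Y w| <= b) -> (\int[P]_w (Y w * increment n w)%:E = 0)%E.
Proof.
move=> aY Yb.
have mc := @measurable_coord R dt i.
pose c w := Y w * active n w.
have ac : measurable_fun [set: g_sigma_algebraType (H n)] (c : g_sigma_algebraType (H n) -> R).
  exact: measurable_funM.
have mcw : measurable_fun [set: Omega] c.
  by move=> _ U mU; apply: (@history_measurable n); exact: ac.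
pose gg (p : g_sigma_algebraType (H n) * 'rV[R]_dz) := c p.1 * Ft (theta n p.1) p.2 0 i.
pose m w := c w * PF (theta n w) (Z n w) 0 i.
have mgg : measurable_fun setT gg.
  apply: measurable_funM; first exact: (measurableT_comp ac measurable_fst).
  apply: (measurableT_comp mc).
  have mth : measurable_fun setT
      (fun p : g_sigma_algebraType (H n) * 'rV[R]_dz => theta n p.1).
    exact: (measurableT_comp (adapted_theta (leqnn n)) measurable_fst).
  exact: (measurableT_comp hFt (measurable_fun_pair mth measurable_snd)).
have mm : measurable_fun setT m.
  have mPF : measurable_fun [set: Omega] (fun w => PF (theta n w) (Z n w) 0 i).
    exact: (measurableT_comp (measurable_kernel_int i)
      (measurable_fun_pair (measurable_theta n) (hZ n))).
  exact: (measurable_funM mcw mPF).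
have ig w : (Pi (theta n w) (Z n w)).-integrable setT (fun z => (gg (w, z))%:E).
  under eq_fun do rewrite /gg /= EFinM.
  by apply: integrableZl => //; exact: h2_int.
have mE' w : (m w)%:E = (\int[Pi (theta n w) (Z n w)]_z (gg (w, z))%:E)%E.
  under eq_integral do rewrite /gg /= EFinM.
  rewrite integralZl //; last exact: h2_int.
  rewrite /m EFinM; congr (_ * _)%E; rewrite /kernel_int mxE /Rintegral fineK //.
  by apply: integrable_fin_num => //; exact: h2_int.
have iZ : P.-integrable setT (fun w => (gg (w, Z n.+1 w))%:E).
  have h : P.-integrable setT (fun w => ((b * weight n)%:E * (moment n.+1 w)%:E)%E).
    by apply: integrableZl => //; exact: moment_integrable.
  apply: le_integrable h => //.
    have mFt : measurable_fun [set: Omega] (fun w => Ft (theta n w) (Z n.+1 w) 0 i).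
      apply: (measurableT_comp mc).
      exact: (measurableT_comp hFt (measurable_fun_pair (measurable_theta n) (hZ n.+1))).
    by apply/measurable_EFinP; exact: (measurable_funM mcw mFt).
  move=> w _; rewrite -EFinM !abse_EFin lee_fin; apply: le_trans (ler_norm _).
  rewrite /gg /c /= -mulrA normrM -[leRHS]mulrA; apply: ler_pM => //; exact: active_Ft.
have [im eq] := integrate_out (@history_measurable n) (hZ n.+1)
  (fun w => prob_kernel (Z n w)) (@hPi n) mgg mm ig mE' iZ.
have -> : (fun w => (Y w * increment n w)%:E) =
    (fun w => ((gg (w, Z n.+1 w))%:E - (m w)%:E)%E).
  by apply/funext => w; rewrite -EFinB /gg /m /c /increment /=; congr (_%:E); ring.
rewrite integralB // eq subee //.
exact: integrable_fin_num.
Qed.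

Lemma increment_cvg : {ae P, forall w, cvgn (fun n => \sum_(0 <= k < n) increment k w)}.
Proof.
have [B HB] := weight_sum.
have v0 n : 0 <= 4 * C * weight n ^+ 2 by rewrite mulr_ge0 ?sqr_ge0 // mulr_ge0.
have vB n : \sum_(0 <= k < n) 4 * C * weight k ^+ 2 <= 4 * C * B.
  rewrite -mulr_sumr ler_wpM2l ?mulr_ge0 //; apply: le_trans (HB n).
  apply: ler_sum => k _; rewrite /moment_weight lerDr.
  by rewrite addr_ge0 // mulr_ge0 ?powR_ge0 // weight_ge0.
exact: (martingale_cvg (@history_measurable) (fun n => history_le (leqnSn n))
  adapted_increment v0 increment_second_moment vB increment_orthogonal).
Qed.

End coordinate.

Lemma moments_summable : {ae P, forall w, exists B, forall n,
  \sum_(0 <= k < n) moment_weight alpha r k * moment k w ^+ 2 <= B}.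
Proof.
have [B HB] := weight_sum.
pose u k w := (moment_weight alpha r k * moment k w ^+ 2)%:E.
have mw0 k : 0 <= moment_weight alpha r k by exact: moment_weight_ge0.
have u0 k w : (0 <= u k w)%E by rewrite lee_fin mulr_ge0 ?sqr_ge0.
have mm k : measurable_fun [set: Omega] (fun w => (moment k w ^+ 2)%:E).
  by apply/measurable_EFinP; apply: measurable_funX; exact: measurable_moment.
have mu k : measurable_fun [set: Omega] (u k).
  apply/measurable_EFinP; apply: measurable_funM => //.
  exact: measurable_funX (measurable_moment k).
have mS : measurable_fun [set: Omega] (fun w => \sum_(0 <= k <oo) u k w)%E.
  by apply: ge0_emeasurable_sum.
have iS : P.-integrable setT (fun w => \sum_(0 <= k <oo) u k w)%E.
  apply/integrableP; split => //.
  under eq_integral do rewrite gee0_abs ?nneseries_ge0 //.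
  rewrite integral_nneseries //; apply: (@le_lt_trans _ _ (C * B)%:E); last by rewrite ltry.
  apply: lime_le.
    by apply: is_cvg_nneseries => k _ _; apply: integral_ge0.
  apply: nearW => n; apply: (@le_trans _ _
     (\sum_(0 <= k < n) (C * moment_weight alpha r k)%:E)%E).
    apply: lee_sum => k _; rewrite /u; under eq_integral do rewrite EFinM.
    rewrite ge0_integralZl //; last 2 first.
    - by move=> w _; rewrite lee_fin sqr_ge0.
    - by rewrite lee_fin.
    rewrite (mulrC C) EFinM; apply: lee_pmul.
    - by rewrite lee_fin.
    - by apply: integral_ge0 => w _; rewrite lee_fin sqr_ge0.
    - exact: lexx.
    - exact: moment_le.
  by rewrite sumEFin lee_fin -mulr_sumr ler_wpM2l.
apply: filterS (integrable_ae measurableT iS) => w /(_ I) fin.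
exists (fine (\sum_(0 <= k <oo) u k w)%E) => n; rewrite -lee_fin fineK // -sumEFin.
by apply: nneseries_lim_ge => k _ _; exact: u0.
Qed.

(** The Poisson equation splits the noise into an increment orthogonal to the past
    and the change of the Poisson correction when [Z k] is replaced by [Z k.+1].
    The first series converges as a martingale, the second one by summation by
    parts, since the correction depends Hoelder-continuously on the slowly
    varying recursion. *)
Lemma noise_sum_on_start : {ae P, forall w, start w -> (forall n, Q (theta n w)) ->
  forall i, cvgn (fun n => \sum_(0 <= k < n) gamma alpha k `^ r *
     (alpha k * (F (theta k w) (Z k.+1 w) - grad f (theta k w)) 0 i))}.
Proof.
have all_i : {ae P, forall w, forall i, cvgn (fun n => \sum_(0 <= k < n) increment i k w)}.
  by apply: filter_forall => i; exact: increment_cvg.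
apply: filterS2 all_i moments_summable => w cinc [B HB] wS wQ i.
have momE n : moment n w = phi (Z n w).
  by rewrite /moment indicE mem_set ?mul1r //; split => // k _.
pose p k := PF (theta k w) (Z k w) 0 i.
pose q k := PF (theta k w) (Z k.+1 w) 0 i.
have cabel : cvgn (fun n => \sum_(0 <= k < n) weight k * (p k - q k)).
  apply: (@abel_cvgn _ alpha r alpha_gt0 p q (fun k => phi (Z k w)) B) => //.
  - by move=> k; apply: coord_bound; exact: PF_le.
  - by move=> k; apply: coord_bound; exact: PF_le.
  - move=> k; have phik := phi_ge1 (Z k.+1 w).
    have -> : p k.+1 - q k = (PF (theta k.+1 w) (Z k.+1 w) - PF (theta k w) (Z k.+1 w)) 0 i.
      by rewrite coordB.
    apply: le_trans (coord_le_enorm _ _) _.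
    apply: le_trans (phi_holder _ (wQ _) (wQ _)) _.
    rewrite htheta addrAC subrr add0r enormN enormZ gtr0_norm //.
    rewrite powRM ?enorm_ge0 ?(ltW (alpha_gt0 k)) // mulrCA ler_wpM2l ?powR_ge0 //.
    rewrite expr2 ler_wpM2l //.
    apply: (@le_trans _ _ (phi (Z k.+1 w) `^ (2 / 3))).
      by apply: powR_mono; [lra|exact: enorm_ge0|exact: F_le].
    by apply: ler1_powR => //; lra.
  - by move=> n; under eq_bigr do rewrite -momE; exact: HB.
have E : (fun n => \sum_(0 <= k < n) gamma alpha k `^ r *
     (alpha k * (F (theta k w) (Z k.+1 w) - grad f (theta k w)) 0 i)) =
  (fun n => \sum_(0 <= k < n) increment i k w) \+
  (fun n => \sum_(0 <= k < n) weight k * (p k - q k)).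
  apply/funext => n /=; rewrite -big_split /=; apply: eq_bigr => k _.
  rewrite h2 /increment /active indicE mem_set; last by split => // j _.
  rewrite coordB mulr1 /weight /p /q; ring.
by rewrite E; exact: (is_cvgD (cinc i) cabel).
Qed.

End local.

Hypothesis h3 : forall (Q : set 'rV[R]_dt) (s : R), compact Q -> 0 < s < 1 ->
     exists phi : 'rV[R]_dz -> R,
     [/\ measurable_fun [set: 'rV[R]_dz] phi,
         (forall z, 1 <= phi z),
         (forall x z, Q x ->
            Num.max (Num.max (enorm (F x z)) (enorm (Ft x z)))
              (enorm (kernel_int Pi Ft x z)) <= phi z),
         (forall x' x'' z, Q x' -> Q x'' ->
            enorm (kernel_int Pi Ft x' z - kernel_int Pi Ft x'' z) <=
              phi z * enorm (x' - x'') `^ s)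
       & exists g : nat -> 'rV[R]_dt * 'rV[R]_dz -> \bar R,
         [/\ (forall n, measurable_fun [set: 'rV[R]_dt * 'rV[R]_dz] (g n)),
             (forall n, is_cond_expectation P (history theta Z 0)
                (fun w => (phi (Z n w) ^+ 2 *
                   \1_[set w' | ((n%:R)%:E <= exit_time Q (theta ^~ w'))%E]
                     w)%:E)
                (fun w => g n (theta 0%N w, Z 0%N w)))
           & forall x z, (ereal_sup (range (fun n => g n (x, z))) < +oo)%E]].

(** The events [start] with integer constants exhaust the space, since the
    conditional moments are finite.  The Hoelder exponent 2/3 is one for which the
    weights are summable. *)
Lemma noise_sum_cvg : {ae P, forall w, forall A : nat,
  (forall n, box A%:R (theta n w)) ->
  forall i, cvgn (fun n => \sum_(0 <= k < n) gamma alpha k `^ r *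
     (alpha k * (F (theta k w) (Z k.+1 w) - grad f (theta k w)) 0 i))}.
Proof.
apply/ae_foralln => A.
have s01 : 0 < (2 / 3 : R) < 1 by apply/andP; split; lra.
have [phi [mphi phi1 phib phih [g [mg gc gfin]]]] := h3 (@box_compact R dt A%:R) s01.
have all_C : {ae P, forall w, forall C : nat, start C%:R g w ->
    (forall n, box A%:R (theta n w)) ->
    forall i, cvgn (fun n => \sum_(0 <= k < n) gamma alpha k `^ r *
     (alpha k * (F (theta k w) (Z k.+1 w) - grad f (theta k w)) 0 i))}.
  apply/ae_foralln => C.
  exact: (noise_sum_on_start (ler0n R C) mphi phi1 phib phih mg gc).
apply: filterS all_C => w HC wQ.
have := gfin (theta 0%N w) (Z 0%N w).
set s := ereal_sup _ => sfin.
have gs n : (g n (theta 0%N w, Z 0%N w) <= s)%E.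
  by apply: ereal_sup_ubound; exists n.
have [C hC] : exists C : nat, (s <= C%:R%:E)%E.
  case: s sfin {gs} => [s| |] // _; last by exists 0%N; rewrite leNye.
  by exists (Num.truncn `|s|).+1; rewrite lee_fin (le_trans (ler_norm _)) // ltW // truncnS_gt.
by apply: (HC C) => // n; exact: le_trans (gs n) hC.
Qed.

End noise.

(** * Convergence and rates of stochastic gradient search *)

Unset Implicit Arguments.
Set Strict Implicit.
Set Printing Implicit Defensive.

Theorem theorem3p1 (R : realType) (dt dz : nat)
  (hdt : (0 < dt)%N) (hdz : (0 < dz)%N)
  (d : measure_display) (Omega : measurableType d) (P : probability Omega R)
  (F : 'rV[R]_dt -> 'rV[R]_dz -> 'rV[R]_dt)
  (hF : measurable_fun [set: 'rV[R]_dt * 'rV[R]_dz] (fun x => F x.1 x.2))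
  (alpha : nat -> R) (halpha : forall n, 0 < alpha n)
  (theta : nat -> Omega -> 'rV[R]_dt) (Z : nat -> Omega -> 'rV[R]_dz)
  (htheta0 : measurable_fun [set: Omega] (theta 0%N))
  (hZ : forall n, measurable_fun [set: Omega] (Z n))
  (htheta : forall n w,
     theta n.+1 w = theta n w - alpha n *: F (theta n w) (Z n.+1 w))
  (Pi : 'rV[R]_dt -> R.-pker 'rV[R]_dz ~> 'rV[R]_dz)
  (hPi : forall (n : nat) (B : set 'rV[R]_dz), measurable B ->
     exists2 Y : Omega -> \bar R,
       is_cond_expectation P (history theta Z n)
         (fun w => (\1_(Z n.+1 @^-1` B) w)%:E) Y
       & {ae P, forall w, Y w = Pi (theta n w) (Z n w) B})
  (h1_lim : alpha n @[n --> \oo] --> (0 : R))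
  (h1_limsup : (limn_esup
     (fun n => `|(alpha n.+1)^-1 - (alpha n)^-1|%:E) < +oo)%E)
  (h1_sum : (\sum_(0 <= n <oo) (alpha n)%:E = +oo)%E)
  (r : R) (hr : 1 < r)
  (h1_r : (\sum_(0 <= n <oo)
     (alpha n ^+ 2 * gamma alpha n `^ (2 * r))%:E < +oo)%E)
  (f : 'rV[R]_dt -> R)
  (hf_diff : forall x, differentiable f x)
  (hf_lip : [locally [lipschitz (grad f) x | x in setT]])
  (Ft : 'rV[R]_dt -> 'rV[R]_dz -> 'rV[R]_dt)
  (hFt : measurable_fun [set: 'rV[R]_dt * 'rV[R]_dz] (fun x => Ft x.1 x.2))
  (h2_int : forall x z, kernel_integrable Pi Ft x z)
  (h2 : forall x z, F x z - grad f x = Ft x z - kernel_int Pi Ft x z)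
  (h3 : forall (Q : set 'rV[R]_dt) (s : R), compact Q -> 0 < s < 1 ->
     exists phi : 'rV[R]_dz -> R,
     [/\ measurable_fun [set: 'rV[R]_dz] phi,
         (forall z, 1 <= phi z),
         (forall x z, Q x ->
            Num.max (Num.max (enorm (F x z)) (enorm (Ft x z)))
              (enorm (kernel_int Pi Ft x z)) <= phi z),
         (forall x' x'' z, Q x' -> Q x'' ->
            enorm (kernel_int Pi Ft x' z - kernel_int Pi Ft x'' z) <=
              phi z * enorm (x' - x'') `^ s)
       & exists g : nat -> 'rV[R]_dt * 'rV[R]_dz -> \bar R,
         [/\ (forall n, measurable_fun [set: 'rV[R]_dt * 'rV[R]_dz] (g n)),
             (forall n, is_cond_expectation P (history theta Z 0)
                (fun w => (phi (Z n w) ^+ 2 *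
                   \1_[set w' | ((n%:R)%:E <= exit_time Q (theta ^~ w'))%E]
                     w)%:E)
                (fun w => g n (theta 0%N w, Z 0%N w)))
           & forall x z, (ereal_sup (range (fun n => g n (x, z))) < +oo)%E]])
  (h4 : forall (Q : set 'rV[R]_dt) (a : R), compact Q -> (f @` Q) a ->
     exists delta mu M : R,
     [/\ 0 < delta <= 1, 1 < mu <= 2, 1 <= M
       & forall x, Q x -> `|f x - a| <= delta ->
           `|f x - a| <= M * enorm (grad f x) `^ mu])
  (delta mu M : 'rV[R]_dt -> R)
  (hloc : forall x,
     [/\ 0 < delta x <= 1, 1 < mu x <= 2, 1 <= M x
       & forall x', enorm (x' - x) <= delta x ->
           `|f x' - f x| <= M x * enorm (grad f x') `^ mu x]) :
  let p := Num.min 1 r in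
  let thetahat w := limn (theta ^~ w) in
  let rhat w := loj_r (mu (thetahat w)) in
  let phat w := loj_p r (mu (thetahat w)) in
  let qhat w := loj_q r (mu (thetahat w)) in
  [/\ {ae P, forall w, bounded_path (theta ^~ w) ->
         cvgn (theta ^~ w) /\ grad f (thetahat w) = 0},
      {ae P, forall w, bounded_path (theta ^~ w) -> (r%:E < rhat w)%E ->
         [/\ (fun n => enorm (grad f (theta n w)) ^+ 2)
               =o_\oo (fun n => gamma alpha n `^ (- phat w)),
             (fun n => `|f (theta n w) - f (thetahat w)|)
               =o_\oo (fun n => gamma alpha n `^ (- phat w))
           & (fun n => enorm (theta n w - thetahat w))
               =o_\oo (fun n => gamma alpha n `^ (- qhat w))]},
      {ae P, forall w, bounded_path (theta ^~ w) -> (rhat w <= r%:E)%E ->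
         [/\ (fun n => enorm (grad f (theta n w)) ^+ 2)
               =O_\oo (fun n => gamma alpha n `^ (- phat w)),
             (fun n => `|f (theta n w) - f (thetahat w)|)
               =O_\oo (fun n => gamma alpha n `^ (- phat w))
           & (fun n => enorm (theta n w - thetahat w))
               =O_\oo (fun n => gamma alpha n `^ (- qhat w))]}
    & {ae P, forall w, bounded_path (theta ^~ w) ->
         (fun n => enorm (grad f (theta n w)) ^+ 2)
           =o_\oo (fun n => gamma alpha n `^ (- p)) /\
         (fun n => `|f (theta n w) - f (thetahat w)|)
           =o_\oo (fun n => gamma alpha n `^ (- p))}].
Proof.
move=> p thetahat rhat phat qhat.
pose xi w k := F (theta k w) (Z k.+1 w) - grad f (theta k w).
have gub := gamma_unbounded halpha h1_sum.
have wsum := moment_weight_sum halpha h1_lim h1_limsup h1_sum hr h1_r.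
have noise := noise_sum_cvg hF hFt halpha htheta0 hZ htheta hPi wsum
  (@grad_continuous R dt f hf_lip) h2_int h2 h3.
have tame : {ae P, forall w, bounded_path (theta ^~ w) ->
    exists2 A : R, (forall n, box A (theta n w)) & forall i, cvgn (fun n =>
      \sum_(0 <= k < n) gamma alpha k `^ r * (alpha k * xi w k 0 i))}.
  apply: filterS noise => w sum_cvg; rewrite /bounded_path; set s := ereal_sup _ => s_fin.
  have le_s n : ((enorm (theta n w))%:E <= s)%E by apply: ereal_sup_ubound; exists n.
  have [A inA] : exists A : nat, forall n, box A%:R (theta n w).
    case: s s_fin le_s => [s| |] // _ le_s; last by have := le_s 0%N; rewrite leeNy_eq.
    exists (Num.truncn `|s|).+1 => n; rewrite /box /=.
    apply: le_trans (mxnorm_le_enorm _) _.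
    have /le_trans : enorm (theta n w) <= s by rewrite -lee_fin; exact: le_s.
    by apply; rewrite (le_trans (ler_norm _)) // ltW // truncnS_gt.
  by exists A%:R => //; exact: sum_cvg inA.
have descent w n : theta n.+1 w = theta n w - alpha n *: (grad f (theta n w) + xi w n).
  by rewrite htheta /xi addrCA subrr addr0.
have conclusion w A (inA : forall n, box A (theta n w)) sum_cvg :=
  path_conclusion halpha h1_lim gub hr hf_diff hf_lip inA (descent w) sum_cvg h4 hloc.
by split; apply: filterS tame => w /[apply] -[A inA sum_cvg];
  have [] := conclusion w A inA sum_cvg.
Qed.
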